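(* Let $C>1$ be a constant. There exists $\epsilon_0>0$ such that for every fixed $\epsilon\in(0,\epsilon_0)$ there is a constant $K=K(\epsilon,C)>0$ with the following property. For each $t$, let $G^{(1)},\dots,G^{(t)}$ be connected regular graphs with $2\le |V(G^{(i)})|\le C$ for all $i\in[t]$, let $G=\square_{i=1}^t G^{(i)}$, let $d=\sum_{i=1}^t d(G^{(i)})$ be the degree of $G$, let $n=|V(G)|$ and let $p=\frac{1+\epsilon}{d}$. Then, with probability tending to one as $t\to\infty$, $G_p$ has a component of order $(1+o(1))yn$, where $y=y(\epsilon)$ is the unique solution in $(0,1)$ of $y=1-\exp(-(1+\epsilon)y)$, and every other component of $G_p$ has order at most $Kd$.
   Context: The Cartesian product $G=G^{(1)}\square\cdots\square G^{(t)}$ has vertex set $V(G^{(1)})\times\cdots\times V(G^{(t)})$, and $u=(u_1,\dots,u_t)$, $v=(v_1,\dots,v_t)$ are adjacent iff there is $i$ with $u_iv_i\in E(G^{(i)})$ and $u_j=v_j$ for all $j\ne i$. $d(H)$ denotes the degree of a regular graph $H$. $G_p$ is the random subgraph of $G$ obtained by retaining each edge independently with probability $p$. *)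

(* Defs.v *)
From HB Require Import structures.
From mathcomp Require Import all_boot all_order all_algebra.
From mathcomp Require Import all_classical all_reals all_analysis.

Set Implicit Arguments.
Unset Strict Implicit.
Unset Printing Implicit Defensive.

Import Order.TTheory GRing.Theory Num.Theory.
Local Open Scope ring_scope.

Record graph := Graph { gsize : nat; gadj : rel 'I_gsize }.
Arguments gadj : clear implicits.

Definition simple_graph (G : graph) : Prop :=
  symmetric (gadj G) /\ irreflexive (gadj G).

Definition connected_graph (G : graph) : Prop :=
  forall u v : 'I_(gsize G), connect (gadj G) u v.

Definition regular_of_degree (G : graph) (k : nat) : Prop :=
  forall v : 'I_(gsize G), #|[set w | gadj G v w]| = k.

Definition cvert (t : nat) (Gs : 'I_t -> graph) : finType :=
  {dffun forall i : 'I_t, 'I_(gsize (Gs i))}.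

Definition cadj (t : nat) (Gs : 'I_t -> graph) : rel (cvert Gs) :=
  fun u v => [exists i : 'I_t, gadj (Gs i) (u i) (v i) &&
                 [forall j : 'I_t, (j != i) ==> (u j == v j)]].

Section RandomSubgraph.
Variable V : finType.

(* Undirected edges of e, each listed once as an ordered pair (x,y)
   with rank x < rank y. *)
Definition edges (e : rel V) : {set V * V} :=
  [set x | e x.1 x.2 && (enum_rank x.1 < enum_rank x.2)%N].

Definition sub_adj (S : {set V * V}) : rel V :=
  fun x y => ((x, y) \in S) || ((y, x) \in S).

Definition comp (S : {set V * V}) (x : V) : {set V} :=
  [set y | connect (sub_adj S) x y].

Definition prob_Gp (R : realType) (e : rel V) (p : R)
  (A : pred {set V * V}) : R :=
  \sum_(S in powerset (edges e) | A S)
     p ^+ #|S| * (1 - p) ^+ (#|edges e| - #|S|).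
End RandomSubgraph.

Definition giant_prob (R : realType) (eps K delta y : R)
    (t : nat) (Gs : 'I_t -> graph) (dg : 'I_t -> nat) : R :=
  let d : R := (\sum_(i < t) dg i)%:R in
  let n : R := #|cvert Gs|%:R in
  let p : R := (1 + eps) / d in
  prob_Gp (@cadj t Gs) p
    (fun S => [exists x : cvert Gs,
       ((1 - delta) * y * n <= #|comp S x|%:R <= (1 + delta) * y * n) &&
       [forall z : cvert Gs, ~~ connect (sub_adj S) x z ==>
          (#|comp S z|%:R <= K * d)]]).

(* Main.v *)
(** Write [lam = 1 + eps], [p = lam / d], and call a component big if it has at
    least [s = Kn d] vertices.  A set of [k] vertices of the product spans
    [O(k log k)] edges, so it has [k d - O(k log k)] boundary edges, and an
    exploration supermartingale bounds the probability that a given vertex lies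
    in a component of order [k] by [(lam1 exp (- (lam1 - 1)))^k] for every [k] up
    to a fixed power [L] of [d], for any [lam1 < lam]: there are no components of
    order between [s] and [L].  The same exploration up to a small multiple of
    [d] compares with a branching process, so a vertex is in a big component with
    probability close to [y]; a bounded-difference variance estimate concentrates
    the number of these vertices.

    For uniqueness delete each edge of [G_p] with probability [q = 1 / (4 s)].
    If [G_p] has two big components, then with probability at least [1/2] so does
    the thinned graph, inside these two.  But in the thinned graph every vertex is
    within distance 2 of a big component: the neighbourhood of radius 2 meets
    about [d^2] disjoint slices, and each of them is again supercritical.  By
    expansion, any two unions of big components (all of order at least [L]) are
    therefore joined by many disjoint paths of length at most 5, one of which
    reappears when the deleted edges are restored. *)

(* The thinning has to be this weak so that components of order [s] of [G_p], and not only linear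
   ones, remain visible in the thinned graph. The conditional probability of restoring an edge is
   then only of order [d^-2], and a path of 5 edges reappears with probability of order [d^-10].
   With [Cn] the integer part of [C], [n] may be as large as [Cn^t], so a union bound over unions of
   [k] components needs a failure probability well below [n^-k]: about [d^11] disjoint paths per
   component. A factor [t] lost in the expansion and [d^6] lost in making the paths disjoint lead to
   [L] of order [d^18]. A gap reaching that far is affordable because isoperimetry costs only
   [O(log L)] edges per vertex. The size of [n] also dictates distance 2: neighbours alone offer
   linearly many slices, each failing with constant probability, which need not beat [n]; pairs of
   coordinates offer quadratically many. Finally, [K] has to be large because the gap estimate is
   summed over [n] starting vertices. *)
From HB Require Import structures.
From mathcomp Require Import all_boot all_order all_algebra.
From mathcomp Require Import reals sequences exp.
From mathcomp Require Import ring lra zify.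
Require Import Defs.
Set Implicit Arguments.
Unset Strict Implicit.
Unset Printing Implicit Defensive.
Import Order.TTheory GRing.Theory Num.Theory.
Local Open Scope ring_scope.

(** * Bernoulli sums over edge subsets *)

Section Weights.
Variables (R : realFieldType) (T : finType).
Implicit Types (a b p : R) (F S D : {set T}) (f g : {set T} -> R) (e : T).

(** The weights are not normalised: [a + b = 1] gives a product measure, while [b = 1] gives the
    subset generating function that closes [merge_prob]. *)
Definition wsum a b F f : R :=
  \sum_(S in powerset F) a ^+ #|S| * b ^+ (#|F| - #|S|) * f S.

Lemma wsum_set0 a b f : wsum a b set0 f = f set0.
Proof. by rewrite /wsum powerset0 big_set1 cards0 !expr0 !mul1r. Qed.

Lemma wsum_split a b F e f : e \in F ->
  wsum a b F f = a * wsum a b (F :\ e) (fun S => f (e |: S)) + b * wsum a b (F :\ e) f.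
Proof.
move=> eF; rewrite /wsum (bigID (fun S : {set T} => e \in S)) /=.
have cF : #|F| = #|F :\ e|.+1 by rewrite (cardsD1 e F) eF.
congr (_ + _).
  rewrite big_distrr /= (reindex_onto (fun S => e |: S) (fun S => S :\ e)) /=; last first.
    by move=> S /andP[_ eS]; rewrite setD1K.
  apply: eq_big => [S|S].
    rewrite !inE eqxx /= andbT subUset sub1set eF /= subsetD1.
    apply/andP/andP => -[SF H]; split=> //.
      by move/eqP: H => <-; rewrite !inE eqxx.
    by rewrite setU1K.
  rewrite !inE eqxx /= andbT subUset sub1set eF /= => /andP[SF /eqP H].
  have eS : e \notin S by rewrite -H !inE eqxx.
  by rewrite cardsU1 eS add1n cF subSS exprS !mulrA.
rewrite big_distrr /=; apply: eq_big => [S|S]; first by rewrite !inE subsetD1.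
rewrite !inE => /andP[SF eS].
have le : (#|S| <= #|F :\ e|)%N by apply: subset_leq_card; rewrite subsetD1 SF.
by rewrite cF subSn // exprS !mulrA [b * _]mulrC.
Qed.

Lemma eq_wsum a b F f g : (forall S, S \subset F -> f S = g S) -> wsum a b F f = wsum a b F g.
Proof. by move=> fg; apply: eq_bigr => S; rewrite inE => /fg ->. Qed.

Lemma wsum_le a b F f g : 0 <= a -> 0 <= b ->
  (forall S, S \subset F -> f S <= g S) -> wsum a b F f <= wsum a b F g.
Proof.
move=> a0 b0 fg; apply: ler_sum => S; rewrite inE => /fg fgS.
by rewrite ler_wpM2l // mulr_ge0 // exprn_ge0.
Qed.

Lemma wsum_ge0 a b F f : 0 <= a -> 0 <= b ->
  (forall S, S \subset F -> 0 <= f S) -> 0 <= wsum a b F f.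
Proof.
move=> a0 b0 f0; apply: sumr_ge0 => S; rewrite inE => /f0 fS.
by rewrite mulr_ge0 // mulr_ge0 // exprn_ge0.
Qed.

Lemma wsumD a b F f g : wsum a b F (fun S => f S + g S) = wsum a b F f + wsum a b F g.
Proof. by rewrite /wsum -big_split /=; apply: eq_bigr => S _; rewrite mulrDr. Qed.

Lemma wsumZ a b F c f : wsum a b F (fun S => c * f S) = c * wsum a b F f.
Proof. by rewrite /wsum big_distrr /=; apply: eq_bigr => S _; rewrite mulrCA. Qed.

Lemma wsum_sum (I : finType) (P : pred I) a b F (f : I -> {set T} -> R) :
  wsum a b F (fun S => \sum_(i | P i) f i S) = \sum_(i | P i) wsum a b F (f i).
Proof.
rewrite /wsum exchange_big /=; apply: eq_bigr => S _.
by rewrite big_distrr.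
Qed.

Lemma set_remove_ind (P : {set T} -> Prop) :
  P set0 -> (forall F e, e \in F -> P (F :\ e) -> P F) -> forall F, P F.
Proof.
move=> P0 PS F; move: {2}#|F| (erefl #|F|) => k; elim: k F => [|k IH] F.
  by move/eqP; rewrite cards_eq0 => /eqP ->.
move=> cF; have /card_gt0P[e eF] : (0 < #|F|)%N by rewrite cF.
by apply: (PS F e eF); apply: IH; move: cF; rewrite (cardsD1 e) eF => -[].
Qed.

Lemma wsum_cst a b F (c : R) : wsum a b F (fun=> c) = (a + b) ^+ #|F| * c.
Proof.
elim/set_remove_ind: F => [|F e eF IH]; first by rewrite wsum_set0 cards0 expr0 mul1r.
by rewrite (wsum_split _ _ _ eF) IH [in RHS](cardsD1 e) eF add1n exprS; ring.
Qed.

Definition Ex p := wsum p (1 - p).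

Lemma Ex_cst p F (c : R) : Ex p F (fun=> c) = c.
Proof. by rewrite /Ex wsum_cst addrC subrK expr1n mul1r. Qed.

Lemma wsum_fubini a b F1 F2 f : [disjoint F1 & F2] ->
  wsum a b (F1 :|: F2) f = wsum a b F1 (fun S1 => wsum a b F2 (fun S2 => f (S1 :|: S2))).
Proof.
elim/set_remove_ind: F1 f => [|F e eF IH] f dis.
  by rewrite set0U wsum_set0; apply: eq_wsum => S _; rewrite set0U.
have eF2 : e \notin F2 by apply: contraTN eF => eF2; rewrite (disjointFl dis).
have dis' : [disjoint F :\ e & F2].
  by apply: disjointWl dis; apply: subsetDl.
rewrite (@wsum_split _ _ (F :|: F2) e) ?inE ?eF // [RHS](wsum_split _ _ _ eF).
have -> : (F :|: F2) :\ e = (F :\ e) :|: F2.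
  apply/setP => x; rewrite !inE; case: eqVneq => [->|] //=.
  by rewrite (negbTE eF2).
rewrite !IH //; congr (a * _ + _); apply: eq_wsum => S _; apply: eq_wsum => S' _.
by rewrite setUA.
Qed.

Lemma disjoint_setD D F : [disjoint D & F :\: D].
Proof. by rewrite -setI_eq0; apply/eqP/setP => x; rewrite !inE; case: (x \in D). Qed.

(** Independence, with each [f i] seeing only the trace on [D i]. It serves for disjoint paths in
    [split_prob] and for disjoint slices in [sparse_prob]. *)
Lemma Ex_prod_disjoint (I : finType) (A : {set I}) p F (D : I -> {set T})
    (f : I -> {set T} -> R) :
  (forall i, i \in A -> D i \subset F) ->
  (forall i j, i \in A -> j \in A -> i != j -> [disjoint D i & D j]) ->
  Ex p F (fun S => \prod_(i in A) f i (S :&: D i)) = \prod_(i in A) Ex p (D i) (f i).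
Proof.
move: {2}#|A| (erefl #|A|) => k; elim: k A F => [|k IH] A F.
  move/eqP; rewrite cards_eq0 => /eqP -> _ _.
  rewrite big_set0 -[RHS](Ex_cst p F 1); apply: eq_wsum => S _.
  by rewrite big_set0.
move=> cA DF dis; have /card_gt0P[i iA] : (0 < #|A|)%N by rewrite cA.
rewrite (big_setD1 i) //= -(IH _ (F :\: D i)); first last.
- by move=> j l; rewrite !inE => /andP[_ jA] /andP[_ lA]; apply: dis.
- move=> j; rewrite !inE => /andP[ji jA]; rewrite subsetD DF //=.
  exact: dis.
- by move: cA; rewrite (cardsD1 i) iA => -[].
rewrite /Ex -{1}(setID F (D i)) (setIidPr (DF i iA)).
rewrite wsum_fubini; last exact: disjoint_setD.
rewrite mulrC -wsumZ; apply: eq_wsum => S SD; rewrite mulrC -wsumZ; apply: eq_wsum => S' S'F.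
rewrite (big_setD1 i) //=; congr (f i _ * _).
  apply/setP => x; rewrite !inE.
  case xD: (x \in D i) => /=; last first.
    by rewrite andbF; apply/esym/negbTE/negP => /(subsetP SD); rewrite xD.
  rewrite andbT; case xS': (x \in S'); last by rewrite orbF.
  by move/subsetP/(_ _ xS'): S'F; rewrite !inE xD.
apply: eq_bigr => j; rewrite !inE => /andP[ji jA]; congr (f j _).
apply/setP => x; rewrite !inE andb_orl; case xS: (x \in S) => //=.
have xi := subsetP SD _ xS.
rewrite (disjointFr (dis i j iA jA _) xi) 1?eq_sym //=.
Qed.

Lemma Ex_sub p F D : D \subset F -> Ex p F (fun S => (D \subset S)%:R) = p ^+ #|D|.
Proof.
elim/set_remove_ind: D F => [|D e eD IH] F DF.
  rewrite cards0 expr0 -[RHS](Ex_cst p F 1).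
  by apply: eq_wsum => S _; rewrite sub0set.
have eF := subsetP DF _ eD.
rewrite /Ex (wsum_split _ _ _ eF) (cardsD1 e) eD add1n exprS -(IH (F :\ e)); last first.
  exact: setSD.
rewrite [X in _ + _ * X](@eq_wsum _ _ _ _ (fun=> 0)) => [|S SF].
  rewrite [wsum _ _ _ (fun=> 0)]Ex_cst mulr0 addr0; congr (_ * _).
  by apply: eq_wsum => S _; rewrite subDset.
case: (boolP (_ \subset _)) => // /subsetP/(_ _ eD) /(subsetP SF).
by rewrite !inE eqxx.
Qed.

Lemma Ex_le p F f g : 0 <= p <= 1 ->
  (forall S, S \subset F -> f S <= g S) -> Ex p F f <= Ex p F g.
Proof. by move=> /andP[p0 p1]; apply: wsum_le; rewrite ?subr_ge0. Qed.

Lemma Ex_ge0 p F f : 0 <= p <= 1 ->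
  (forall S, S \subset F -> 0 <= f S) -> 0 <= Ex p F f.
Proof. by move=> /andP[p0 p1]; apply: wsum_ge0; rewrite ?subr_ge0. Qed.

Lemma Ex_le1 p F (A : pred {set T}) : 0 <= p <= 1 -> Ex p F (fun S => (A S)%:R) <= 1.
Proof.
move=> p01; rewrite -[leRHS](Ex_cst p F); apply: Ex_le => // S _.
by case: (A S).
Qed.

Lemma Ex_bigsum (I : finType) (P : pred I) p F (f : I -> {set T} -> R) :
  Ex p F (fun S => \sum_(i | P i) f i S) = \sum_(i | P i) Ex p F (f i).
Proof. exact: wsum_sum. Qed.

(* Two ways to reveal a pair [S' \subset S]: thin [S] by [q], or sprinkle the
   complement of [S'] with the conditional probability [r]. *)
Lemma thinning_sprinkling p q r F (g : {set T} -> {set T} -> R) :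
  (1 - p * (1 - q)) * r = p * q ->
  Ex p F (fun S => Ex (1 - q) S (fun S' => g S' S)) =
  Ex (p * (1 - q)) F (fun S' => Ex r (F :\: S') (fun D => g S' (S' :|: D))).
Proof.
move=> hr; elim/set_remove_ind: F g => [|F e eF IH] g.
  by rewrite /Ex !wsum_set0 set0D !wsum_set0 setU0.
rewrite /Ex (wsum_split _ _ _ eF) [in RHS](wsum_split _ _ _ eF).
have -> : wsum p (1 - p) (F :\ e) (fun S => wsum (1 - q) (1 - (1 - q)) (e |: S)
     (fun S' => g S' (e |: S))) =
   (1 - q) * Ex p (F :\ e) (fun S => Ex (1 - q) S (fun S' => g (e |: S') (e |: S)))
  + q * Ex p (F :\ e) (fun S => Ex (1 - q) S (fun S' => g S' (e |: S))).
  rewrite -!wsumZ -wsumD; apply: eq_wsum => S; rewrite subsetD1 => /andP[SF eS].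
  rewrite (@wsum_split _ _ _ e) ?inE ?eqxx // setU1K //; congr (_ + _ * _); ring.
rewrite (IH (fun S' S => g (e |: S') (e |: S))) (IH (fun S' S => g S' (e |: S))).
rewrite [wsum p _ _ _]IH.
have -> : wsum (p * (1 - q)) (1 - p * (1 - q)) (F :\ e)
   (fun S' => wsum r (1 - r) (F :\: S') (fun D => g S' (S' :|: D))) =
   r * Ex (p * (1 - q)) (F :\ e) (fun S' => Ex r (F :\ e :\: S') (fun D => g S' (e |: (S' :|: D))))
  + (1 - r) * Ex (p * (1 - q)) (F :\ e) (fun S' => Ex r (F :\ e :\: S') (fun D => g S' (S' :|: D))).
  rewrite -!wsumZ -wsumD; apply: eq_wsum => S; rewrite subsetD1 => /andP[SF eS].
  rewrite (@wsum_split _ _ _ e) ?inE ?eF ?eS //.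
  have -> : (F :\: S) :\ e = F :\ e :\: S.
    by apply/setP => x; rewrite !inE; case: (x == e); rewrite ?andbF.
  by congr (_ * _ + _); apply: eq_wsum => D _; rewrite setUCA.
have -> : wsum (p * (1 - q)) (1 - p * (1 - q)) (F :\ e)
   (fun S => wsum r (1 - r) (F :\: (e |: S)) (fun D => g (e |: S) (e |: S :|: D))) =
   Ex (p * (1 - q)) (F :\ e)
    (fun S => Ex r (F :\ e :\: S) (fun D => g (e |: S) (e |: (S :|: D)))).
  apply: eq_wsum => S _; rewrite setDDl; apply: eq_wsum => D _; by rewrite setUA.
(* [X], [Y], [Z] collect the cases that [e] lies in both sets, in the larger one only, or in
   neither; [hr] gives the middle case probability [p * q] on both sides. *)
set X := Ex _ _ (fun S' => Ex r _ (fun D => g (e |: S') _)).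
set Y := Ex _ _ (fun S' => Ex r _ (fun D => g S' (e |: _))).
set Z := Ex _ _ _.
rewrite [RHS](_ : _ = p * (1 - q) * X + (1 - p * (1 - q)) * r * Y
   + (1 - p * (1 - q) - (1 - p * (1 - q)) * r) * Z); last by ring.
by rewrite hr; ring.
Qed.

Definition osc_le (c : R) F f :=
  forall e S, e \in F -> S \subset F :\ e -> `|f (e |: S) - f S| <= c.

(** Law of total variance: conditioning on [e] averages the conditional variances and adds
    [p * (1 - p) * (E1 - E0) ^+ 2], where the conditional means differ by at most [c]. Keeping the
    factor [p] matters: for [p] of order [1 / d] it cancels the [d] in the number of edges. *)
Lemma variance_bound p F f (c : R) : 0 <= p <= 1 -> osc_le c F f ->
  Ex p F (fun S => f S ^+ 2) - (Ex p F f) ^+ 2 <= #|F|%:R * (p * c ^+ 2).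
Proof.
move=> p01; have /andP[p0 p1] := p01.
elim/set_remove_ind: F f => [|F e eF IH] f osc.
  by rewrite /Ex !wsum_set0 cards0 mul0r subrr.
have H (h : {set T} -> {set T}) : (h = setU [set e]) \/ (h = id) ->
    osc_le c (F :\ e) (fun S => f (h S)).
  move=> hh e' S; rewrite !inE => /andP[ne e'F] SF.
  have e'S : S \subset F :\ e'.
    by apply: (subset_trans SF); rewrite setDDl setDS // subsetUr.
  case: hh => ->; last exact: osc.
  rewrite setUCA; apply: osc => //.
  rewrite subUset sub1set !inE eq_sym ne eF /=; exact: e'S.
have V1 := IH _ (H _ (or_introl erefl)).
have V0 := IH _ (H _ (or_intror erefl)).
rewrite (cardsD1 e F) eF /Ex !(wsum_split _ _ _ eF).
set E1 := wsum _ _ _ (fun S => f _); set E0 := wsum _ _ _ f.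
set Q1 := wsum _ _ _ (fun S => f (_ |: _) ^+ 2); set Q0 := wsum _ _ _ (fun S => f _ ^+ 2).
have {}V1 : Q1 - E1 ^+ 2 <= #|F :\ e|%:R * (p * c ^+ 2) by exact: V1.
have {}V0 : Q0 - E0 ^+ 2 <= #|F :\ e|%:R * (p * c ^+ 2) by exact: V0.
have dE : `|E1 - E0| <= c.
  have -> : E1 - E0 = Ex p (F :\ e) (fun S => f (e |: S) - f S).
    rewrite /Ex (@eq_wsum _ _ _ _ (fun S => f (e |: S) + (-1) * f S)); last first.
      by move=> S _; rewrite mulN1r.
    by rewrite wsumD wsumZ mulN1r.
  have b S : S \subset F :\ e -> - c <= f (e |: S) - f S <= c.
    by move=> SF; rewrite -ler_norml; apply: osc.
  rewrite ler_norml -{1}(Ex_cst p (F :\ e) (- c)) -{2}(Ex_cst p (F :\ e) c).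
  by apply/andP; split; apply: Ex_le => // S /b /andP[].
have dE2 : (E1 - E0) ^+ 2 <= c ^+ 2.
  by rewrite -real_normK ?num_real // lerXn2r ?nnegrE // (le_trans _ dE).
rewrite natrD mulrDl mul1r [leLHS](_ : _ = p * (Q1 - E1 ^+ 2) + (1 - p) * (Q0 - E0 ^+ 2)
   + p * (1 - p) * (E1 - E0) ^+ 2); last by ring.
have A1 := ler_wpM2l p0 V1.
have A2 : (1 - p) * (Q0 - E0 ^+ 2) <= (1 - p) * (#|F :\ e|%:R * (p * c ^+ 2)).
  by rewrite ler_wpM2l // subr_ge0.
have A3 : p * (1 - p) * (E1 - E0) ^+ 2 <= p * c ^+ 2.
  rewrite -mulrA ler_wpM2l //; apply: le_trans dE2.
  by rewrite ler_piMl // ?sqr_ge0 // gerBl.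
have -> : true%:R = 1 :> R by [].
lra.
Qed.

Lemma chebyshev p F f (c a : R) : 0 <= p <= 1 -> osc_le c F f -> 0 <= a ->
  a ^+ 2 * Ex p F (fun S => (a <= `|f S - Ex p F f|)%R%:R) <= #|F|%:R * (p * c ^+ 2).
Proof.
move=> p01 osc a0; apply: le_trans (variance_bound p01 osc).
set mu := Ex p F f.
have -> : Ex p F (fun S => f S ^+ 2) - mu ^+ 2 = Ex p F (fun S => (f S - mu) ^+ 2).
  rewrite [RHS]/Ex [RHS](@eq_wsum _ _ _ _ (fun S => f S ^+ 2 + ((- 2 * mu) * f S + mu ^+ 2))).
    rewrite wsumD wsumD wsumZ [wsum _ _ _ (fun=> mu ^+ 2)]Ex_cst -/(Ex p F f) -/mu /Ex; ring.
  by move=> S _; ring.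
rewrite -wsumZ; apply: Ex_le => // S _.
case: (boolP (a <= _)) => [h|_]; last by rewrite mulr0 sqr_ge0.
by rewrite mulr1 -[leRHS]real_normK ?num_real // lerXn2r // nnegrE.
Qed.

End Weights.

(** * Reachability and crossing edges *)

Section Reach.
Variable V : finType.
Implicit Types (S F : {set V * V}) (U Z X : {set V}) (x y : V) (e : V * V).

Definition reach S U : {set V} := [set y | [exists x in U, connect (sub_adj S) x y]].

Definition crossing F U : {set V * V} := [set e in F | (e.1 \in U) != (e.2 \in U)].

Lemma sub_adj_sym S : symmetric (sub_adj S).
Proof. by move=> x y; rewrite /sub_adj orbC. Qed.

Lemma sub_adj_connect_sym S : connect_sym (sub_adj S).
Proof. exact/sym_connect_sym/sub_adj_sym. Qed.

Lemma sub_adjS S S' : S \subset S' -> subrel (sub_adj S) (sub_adj S').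
Proof.
by move=> /subsetP SS x y /orP[] /SS H; apply/orP; [left|right].
Qed.

Lemma connectS S S' x y : S \subset S' ->
  connect (sub_adj S) x y -> connect (sub_adj S') x y.
Proof.
move=> SS; apply: connect_sub => u v uv; apply: connect1.
exact: (sub_adjS SS).
Qed.

Lemma reach_sub S U : U \subset reach S U.
Proof.
by apply/subsetP => x xU; rewrite inE; apply/exists_inP; exists x.
Qed.

Lemma reach_closed S U x y : sub_adj S x y -> x \in reach S U -> y \in reach S U.
Proof.
move=> xy; rewrite !inE => /exists_inP[u uU ux]; apply/exists_inP; exists u => //.
exact: connect_trans ux (connect1 xy).
Qed.

Lemma connect_closed S Z x y : (forall u v, sub_adj S u v -> u \in Z -> v \in Z) ->
  connect (sub_adj S) x y -> x \in Z -> y \in Z.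
Proof.
move=> cl /connectP[s]; elim: s x => [|z s IH] x /=; first by move=> _ ->.
by move=> /andP[xz ps] ly xZ; apply: (IH z ps ly); apply: cl xz xZ.
Qed.

Lemma reach_min S U Z : U \subset Z ->
  (forall x y, sub_adj S x y -> x \in Z -> y \in Z) -> reach S U \subset Z.
Proof.
move=> UZ cl; apply/subsetP => y; rewrite inE => /exists_inP[x xU xy].
exact: connect_closed cl xy (subsetP UZ _ xU).
Qed.

Lemma comp_reach S x : comp S x = reach S [set x].
Proof.
apply/setP => y; rewrite !inE; apply/idP/exists_inP => [xy|[z]].
  by exists x => //; rewrite inE.
by rewrite inE => /eqP ->.
Qed.

Definition joins e x y := (e == (x, y)) || (e == (y, x)).

(** An exploration step: an open edge at [U] is traded for its far end, after which only the edges
    of [S] remain to be revealed. *)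
Lemma reach_add S U e a b : joins e a b -> a \in U ->
  reach (e |: S) U = reach S (b |: U).
Proof.
move=> ej aU.
have adj x y : sub_adj (e |: S) x y ->
    [\/ sub_adj S x y, x = a /\ y = b | x = b /\ y = a].
  rewrite /sub_adj !inE; case/orP: ej => /eqP -> /orP[] /orP[].
  - by rewrite xpair_eqE => /andP[/eqP -> /eqP ->]; constructor 2.
  - by move=> H; constructor 1; rewrite H.
  - by rewrite xpair_eqE => /andP[/eqP -> /eqP ->]; constructor 3.
  - by move=> H; constructor 1; rewrite H orbT.
  - by rewrite xpair_eqE => /andP[/eqP -> /eqP ->]; constructor 3.
  - by move=> H; constructor 1; rewrite H.
  - by rewrite xpair_eqE => /andP[/eqP -> /eqP ->]; constructor 2.
  - by move=> H; constructor 1; rewrite H orbT.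
apply/eqP; rewrite eqEsubset; apply/andP; split; apply: reach_min.
- exact: subset_trans (subsetUr _ _) (reach_sub _ _).
- move=> x y /adj[xy|[-> ->] _|[-> ->] _]; first exact: reach_closed.
    by apply: (subsetP (reach_sub _ _)); rewrite !inE eqxx.
  by apply: (subsetP (reach_sub _ _)); rewrite !inE aU orbT.
- rewrite subUset reach_sub andbT sub1set.
  apply: (@reach_closed _ _ a); last exact: (subsetP (reach_sub _ _)).
  by rewrite /sub_adj !inE; case/orP: ej => /eqP ->; rewrite eqxx ?orbT.
- move=> x y xy; apply: reach_closed.
  by apply: (sub_adjS _ xy); apply: subsetUr.
Qed.

Lemma reach_nocross F S U : crossing F U = set0 -> S \subset F -> reach S U = U.
Proof.
move=> c0 SF; apply/eqP; rewrite eqEsubset reach_sub andbT.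
apply: reach_min => // x y.
have H u v : (u, v) \in S -> (u \in U) = (v \in U).
  move=> /(subsetP SF) uv; apply/eqP/negPn/negP => ne.
  have : (u, v) \in crossing F U by rewrite inE uv.
  by rewrite c0 inE.
by case/orP => /H ->.
Qed.

Lemma crossingP F U e : e \in crossing F U -> e \in F /\ exists a b, [/\ joins e a b, a \in U & b \notin U].
Proof.
rewrite inE => /andP[eF]; case e1: (e.1 \in U); case e2: (e.2 \in U) => // _; split=> //.
  by exists e.1, e.2; rewrite /joins e1 e2 -surjective_pairing eqxx.
by exists e.2, e.1; rewrite /joins e1 e2 -surjective_pairing eqxx orbT.
Qed.

Lemma joins_crossing F U e a b : joins e a b -> (e \in crossing F U) = (e \in F) && ((a \in U) != (b \in U)).
Proof. by rewrite inE => /orP[] /eqP -> //=; case: (a \in U); case: (b \in U). Qed.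

Lemma crossingD1 F e U : crossing (F :\ e) U = crossing F U :\ e.
Proof. by apply/setP => x; rewrite !inE andbA. Qed.

(** The orientation under which [edges] lists the pair. *)
Definition mk_edge x y : V * V :=
  if (enum_rank x < enum_rank y)%N then (x, y) else (y, x).

Lemma mk_edge_joins x y : joins (mk_edge x y) x y.
Proof. by rewrite /joins /mk_edge; case: ifP; rewrite eqxx ?orbT. Qed.

Lemma mk_edge_inj x : injective (mk_edge x).
Proof.
move=> y z; have := mk_edge_joins x z; rewrite /joins => H E; move: H; rewrite -E.
case/orP: (mk_edge_joins x y) => /eqP -> /orP[] /eqP [] //.
- by move=> <-.
- by move=> ->.
Qed.

Lemma joinsC e x y : joins e x y = joins e y x.
Proof. by rewrite /joins orbC. Qed.

Lemma joins_sub_adj S e x y : joins e x y -> e \in S -> sub_adj S x y.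
Proof. by rewrite /sub_adj => /orP[] /eqP ->  ->; rewrite ?orbT. Qed.

Section Host.
Variable h : rel V.
Hypothesis hsym : symmetric h.
Hypothesis hirr : irreflexive h.

Lemma mk_edge_edges x y : (mk_edge x y \in edges h) = h x y.
Proof.
rewrite inE /mk_edge; case: ifP => /= [->|]; first by rewrite andbT.
move/negbT; rewrite -leqNgt leq_eqVlt hsym => /orP[/eqP|->]; last by rewrite andbT.
by move/val_inj/enum_rank_inj ->; rewrite hirr.
Qed.

Lemma edges_mk_edge e x y : e \in edges h -> joins e x y -> e = mk_edge x y.
Proof.
rewrite inE /mk_edge => /andP[_ lt] /orP[] /eqP E; move: lt; rewrite E /=; first by move->.
by move=> lt; rewrite ltnNge (ltnW lt).
Qed.

Lemma edges_joins e x y : e \in edges h -> joins e x y -> h x y.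
Proof. by move=> eh ej; rewrite -mk_edge_edges -(edges_mk_edge eh ej). Qed.

Definition nbrs x : {set V} := [set w | h x w].

Definition inner_boundary (A : {set V}) : {set V} := [set u in A | [exists w, (w \notin A) && h u w]].

Lemma card_edges_le : (#|edges h| <= \sum_(x : V) #|nbrs x|)%N.
Proof.
have -> : (\sum_(x : V) #|nbrs x| = #|[set e : V * V | h e.1 e.2]|)%N.
  rewrite -sum1_card (eq_bigl (fun e : V * V => xpredT e.1 && (e.2 \in nbrs e.1))).
    rewrite -(pair_big_dep xpredT (fun x y => y \in nbrs x) (fun _ _ => 1%N)) /=.
    by apply: eq_bigr => x _; rewrite sum1_card.
  by move=> e; rewrite !inE.
by apply: subset_leq_card; apply/subsetP => e; rewrite !inE => /andP[].
Qed.

Lemma card_crossing X : #|crossing (edges h) X| = (\sum_(x in X) #|nbrs x :\: X|)%N.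
Proof.
have -> : (\sum_(x in X) #|nbrs x :\: X| =
   #|[set e : V * V | [&& e.1 \in X, e.2 \notin X & h e.1 e.2]]|)%N.
  rewrite -sum1_card (eq_bigl (fun e : V * V => (e.1 \in X) && (e.2 \in nbrs e.1 :\: X))).
    rewrite -(pair_big_dep (mem X) (fun x y => y \in nbrs x :\: X) (fun _ _ => 1%N)) /=.
    by apply: eq_bigr => x _; rewrite sum1_card.
  by move=> e; rewrite !inE.
rewrite -(card_in_imset (f := fun e : V * V => mk_edge e.1 e.2)); last first.
  move=> [a b] [c d]; rewrite !inE /= => /and3P[aX bX _] /and3P[cX dX _] E.
  have := mk_edge_joins c d; rewrite /joins -E.
  case/orP: (mk_edge_joins a b) => /eqP -> /orP[] /eqP[] E1 E2.
  - by rewrite E1 E2.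
  - by rewrite -E1 aX in dX.
  - by rewrite -E2 aX in dX.
  - by rewrite E1 E2.
apply: eq_card => e; apply/idP/imsetP => [ecr|].
  have [eh [a [b [ej aX bX]]]] := crossingP ecr.
  exists (a, b) => /=; last exact: edges_mk_edge.
  by rewrite inE /= aX bX (edges_joins eh ej).
case=> -[a b]; rewrite inE /= => /and3P[aX bX ab] ->.
by rewrite (joins_crossing _ _ (mk_edge_joins a b)) mk_edge_edges ab aX (negbTE bX).
Qed.

(** Two losses of at most [#|U|] each: old crossing edges that end in [b] become internal, and
    neighbours of [b] inside [U] give no new crossing edge. The edges from [b] to the remaining
    neighbours are unrevealed by the hypothesis on [F]. *)
Lemma crossing_card_low F U e a b : F \subset edges h ->
  (forall e', e' \in edges h -> e'.1 \notin U -> e'.2 \notin U -> e' \in F) ->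
  joins e a b -> a \in U -> b \notin U ->
  (#|crossing F U| + #|nbrs b| <= #|crossing (F :\ e) (b |: U)| + 2 * #|U|)%N.
Proof.
move=> Fh inv ej aU bU.
pose tb (e' : V * V) := (e'.1 == b) || (e'.2 == b).
pose X1 := [set e' in crossing F U | ~~ tb e'].
pose Y := mk_edge b @: (nbrs b :\: U).
have cY : (#|nbrs b| <= #|Y| + #|U|)%N.
  rewrite card_imset; last exact: mk_edge_inj.
  by rewrite -(cardsID U) addnC leq_add2l subset_leq_card // subsetIr.
have cX : (#|crossing F U| <= #|X1| + #|U|)%N.
  have sub : crossing F U \subset X1 :|: mk_edge b @: U.
    apply/subsetP => e' e'c; rewrite inE /X1 inE e'c /=.
    case tbe: (tb e') => //=.
    have [e'F [x [y [e'j xU yU]]]] := crossingP e'c.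
    apply/imsetP; exists x => //; apply: edges_mk_edge (subsetP Fh _ e'F) _.
    rewrite joinsC; suff <- : y = b by [].
    move: tbe; rewrite /tb; case/orP: e'j => /eqP -> /= /orP[] /eqP //.
      by move=> E; rewrite -E xU in bU.
    by move=> E; rewrite -E xU in bU.
  apply: leq_trans (subset_leq_card sub) _.
  by apply: leq_trans (leq_card_setU _ _) _; rewrite leq_add2l leq_imset_card.
have dis : [disjoint X1 & Y].
  rewrite -setI_eq0; apply/eqP/setP => e'; rewrite !inE.
  apply/negbTE/negP => /andP[/andP[_ ntb] /imsetP[z _ E]].
  move: ntb; rewrite /tb E; case/orP: (mk_edge_joins b z) => /eqP -> /=; by rewrite eqxx ?orbT.
have sub : X1 :|: Y \subset crossing (F :\ e) (b |: U).
  rewrite subUset; apply/andP; split; apply/subsetP => e'.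
    rewrite !inE => /andP[/andP[e'F cc] ntb].
    rewrite e'F andbT; move: ntb; rewrite /tb negb_or => /andP[/negbTE n1 /negbTE n2].
    rewrite n1 n2 /= cc andbT; apply: contraFN n1 => /eqP E; move: n2; rewrite E.
    by case/orP: ej => /eqP -> /=; rewrite eqxx.
  case/imsetP => z /setDP[]; rewrite inE => bz zU ->.
  rewrite (joins_crossing _ _ (mk_edge_joins b z)) !inE eqxx /= (negbTE zU) orbF.
  have nzb : z != b by apply: contraTneq bz => ->; rewrite hirr.
  rewrite nzb andbT; apply/andP; split.
    apply: contraNneq zU => E; move: (mk_edge_joins b z) ej; rewrite /joins E.
    case/orP => /eqP -> /orP[] /eqP[] *; subst; by [].
  apply: inv; first by rewrite mk_edge_edges.
    by case/orP: (mk_edge_joins b z) => /eqP ->.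
  by case/orP: (mk_edge_joins b z) => /eqP ->.
have := subset_leq_card sub; rewrite cardsU (disjoint_setI0 dis) cards0 subn0 => H.
apply: leq_trans (leq_add cX cY) _; rewrite addnACA addnn mul2n.
by rewrite leq_add2r.
Qed.

(** Every new crossing edge is incident to [b]; the inequality is strict because [e] itself
    disappears. *)
Lemma crossing_card_up F U e a b : F \subset edges h -> e \in F ->
  joins e a b -> a \in U -> b \notin U ->
  (#|crossing (F :\ e) (b |: U)| < #|crossing F U| + #|nbrs b|)%N.
Proof.
move=> Fh eF ej aU bU.
have sub : crossing (F :\ e) (b |: U) \subset (crossing F U :\ e) :|: mk_edge b @: nbrs b.
  apply/subsetP => e' e'c; have := e'c; rewrite !inE => /andP[/andP[ne e'F]].
  rewrite ne e'F /=; case: (eqVneq e'.1 b) => [E1|n1] /=.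
    move=> _; apply/orP; right; apply/imsetP; exists e'.2.
      rewrite inE -E1; apply: edges_joins (subsetP Fh _ e'F) _.
      by rewrite /joins -surjective_pairing eqxx.
    by apply: edges_mk_edge (subsetP Fh _ e'F) _; rewrite /joins -E1 -surjective_pairing eqxx.
  case: (eqVneq e'.2 b) => [E2|n2] /=; last by move->.
  move=> _; apply/orP; right; apply/imsetP; exists e'.1.
    rewrite inE -E2 hsym; apply: edges_joins (subsetP Fh _ e'F) _.
    by rewrite /joins -surjective_pairing eqxx.
  by apply: edges_mk_edge (subsetP Fh _ e'F) _; rewrite /joins -E2 -surjective_pairing eqxx orbT.
have := subset_leq_card sub => /leq_trans -/(_ _ (leq_card_setU _ _)) H.
have ecr : e \in crossing F U by rewrite (joins_crossing _ _ ej) eF aU (negbTE bU).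
move: H; rewrite [#|crossing F U|](cardsD1 e) ecr card_imset; last exact: mk_edge_inj.
by [].
Qed.

Lemma reach_sub_host (Q : {set V}) F U :
  (forall x y, h x y -> y \in Q) -> F \subset edges h -> U \subset Q -> reach F U \subset Q.
Proof.
move=> hQ Fh UQ; apply: reach_min => // x y /orP[] /(subsetP Fh) xy _.
  by apply: (hQ x); apply: (edges_joins xy); rewrite /joins eqxx.
by apply: (hQ x); apply: (edges_joins xy); rewrite /joins eqxx orbT.
Qed.

End Host.
End Reach.

(** * Exploration of one component *)

Section Exploration.
Variables (R : realFieldType) (V : finType).
Implicit Types (p a b y w : R) (S F : {set V * V}) (U X : {set V}) (v : V).

Lemma Ex_step p F U e u v (f : {set V * V} -> {set V} -> R) :
  e \in F -> joins e u v -> u \in U ->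
  Ex p F (fun S => f S (reach S U)) =
  p * Ex p (F :\ e) (fun S => f (e |: S) (reach S (v |: U)))
  + (1 - p) * Ex p (F :\ e) (fun S => f S (reach S U)).
Proof.
move=> eF ej uU; rewrite /Ex (wsum_split _ _ _ eF); congr (_ * _ + _).
by apply: eq_wsum => S _; rewrite (reach_add _ ej uU).
Qed.

(* Supermartingale of the edge-by-edge exploration: each discovered vertex pays a
   factor [a], each edge found closed a factor [b]. *)
Lemma gap_potential p a b F U : 0 <= p <= 1 -> 0 <= a -> 1 <= b ->
  p * a + (1 - p) * b <= 1 ->
  Ex p F (fun S => a ^+ #|reach S U :\: U| * b ^+ #|crossing F (reach S U)|) <= 1.
Proof.
move=> p01 a0 b1 ab; have /andP[p0 p1] := p01.
have b0 : 0 <= b by apply: le_trans b1.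
move: {2}#|F| (leqnn #|F|) => n; elim: n F U => [|n IH] F U.
  rewrite leqn0 cards_eq0 => /eqP ->.
  rewrite /Ex wsum_set0 (@reach_nocross _ set0) ?sub0set //; last first.
    by apply/setP => x; rewrite !inE.
  by rewrite setDv cards0 expr0 mul1r [crossing _ _](_ : _ = set0) ?cards0 ?expr0 //; apply/setP => x; rewrite !inE.
move=> cF; have [c0|[e ec]] := set_0Vmem (crossing F U).
  rewrite -[leRHS](Ex_cst p F 1); apply: Ex_le => // S SF.
  by rewrite (reach_nocross c0 SF) setDv c0 !cards0 !expr0 mulr1.
have [eF [u [v [ej uU vU]]]] := crossingP ec.
have cF' : (#|F :\ e| <= n)%N by move: cF; rewrite (cardsD1 e) eF.
rewrite (Ex_step p (fun S X => a ^+ #|X :\: U| * b ^+ #|crossing F X|) eF ej uU).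
apply: le_trans ab; apply: lerD.
  rewrite ler_wpM2l // -[leRHS]mulr1; apply: le_trans (ler_wpM2l a0 (IH _ (v |: U) cF')).
  rewrite -wsumZ; apply: Ex_le => // S SF.
  have sub := reach_sub S (v |: U).
  have uR : u \in reach S (v |: U) by apply: (subsetP sub); rewrite !inE uU orbT.
  have vR : v \in reach S (v |: U) by apply: (subsetP sub); rewrite !inE eqxx.
  have -> : reach S (v |: U) :\: (v |: U) = (reach S (v |: U) :\: U) :\ v.
    by apply/setP => x; rewrite !inE; case: (x == v); case: (x \in U); rewrite ?andbF.
  rewrite [X in a ^+ X * _ <= _](cardsD1 v) inE vU vR /= add1n exprS -mulrA.
  by rewrite crossingD1 (cardsD1 e (crossing F _)) (joins_crossing _ _ ej) eF uR vR.
rewrite ler_wpM2l ?subr_ge0 // -[leRHS]mulr1.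
apply: le_trans (ler_wpM2l b0 (IH _ U cF')).
rewrite -wsumZ; apply: Ex_le => // S SF; rewrite mulrCA ler_wpM2l ?exprn_ge0 //.
rewrite -exprS crossingD1 ler_weXn2l //.
by rewrite (cardsD1 e (crossing F _)) -[_.+1]add1n leq_add2r; case: (_ \in _).
Qed.

Section Host.
Variables (h : rel V) (Q : {set V}).
Hypothesis hsym : symmetric h.
Hypothesis hirr : irreflexive h.
Hypothesis hQ : forall u v : V, h u v -> v \in Q.

(** Markov's inequality for the potential: a component of order [k] has [k.-1] discovered vertices
    besides [v], and at least [B] closed edges leave it. *)
Lemma gap_bound p a b v k B : 0 <= p <= 1 -> 0 <= a -> 1 <= b ->
  p * a + (1 - p) * b <= 1 -> v \in Q ->
  (forall X, #|X| = k -> X \subset Q -> (B <= #|crossing (edges h) X|)%N) ->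
  a ^+ k.-1 * b ^+ B * Ex p (edges h) (fun S => (#|comp S v| == k)%:R) <= 1.
Proof.
move=> p01 a0 b1 ab vQ iso.
apply: le_trans (gap_potential (edges h) [set v] p01 a0 b1 ab).
rewrite -wsumZ; apply: Ex_le => // S SF; rewrite comp_reach.
case: eqP => [ck|_]; last first.
  by rewrite mulr0 mulr_ge0 // exprn_ge0 // (le_trans _ b1).
have vR : v \in reach S [set v] by apply: (subsetP (reach_sub _ _)); rewrite inE.
rewrite mulr1 -ck [in leLHS](cardsD1 v) vR add1n /=.
rewrite ler_wpM2l ?exprn_ge0 // ler_weXn2l //; apply: iso => //.
by apply: (reach_sub_host hsym hirr hQ) => //; rewrite sub1set.
Qed.

Variables (d0 d1 : nat).
Hypothesis hd : forall x, x \in Q -> (d0 <= #|nbrs h x| <= d1)%N.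

(* [psi] is evaluated at the number of discovered vertices and the number of
   unrevealed edges leaving them; an open edge to a new vertex changes the latter by
   at least [d0 - 2 m] because at most [m] vertices have been discovered. *)
Lemma explore p m (psi : nat -> nat -> R) (f : nat -> R) F U : 0 <= p <= 1 ->
  (forall k, (k < m)%N -> f k <= psi k 0%N) ->
  (forall k k' c, (m <= k)%N -> (k <= k')%N -> f k' <= psi k c) ->
  (forall k c c', (k < m)%N -> (c.+1 + d0 <= c' + 2 * m)%N -> (c' <= c + d1)%N ->
     p * psi k.+1 c' + (1 - p) * psi k c <= psi k c.+1) ->
  F \subset edges h -> U \subset Q ->
  (forall e, e \in edges h -> e.1 \notin U -> e.2 \notin U -> e \in F) ->
  Ex p F (fun S => f #|reach S U|) <= psi #|U| #|crossing F U|.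
Proof.
move=> p01 f0 fm st; have /andP[p0 p1] := p01.
move: {2}#|F| (leqnn #|F|) => n; elim: n F U => [|n IH] F U cF Fh UQ inv;
  (have [mU|Um] := leqP m #|U|;
    first by rewrite -[leRHS](Ex_cst p F); apply: Ex_le => // S _; apply: fm => //;
      apply: subset_leq_card; apply: reach_sub);
  (have [c0|[e ec]] := set_0Vmem (crossing F U);
    first by rewrite -[leRHS](Ex_cst p F); apply: Ex_le => // S SF;
      rewrite (reach_nocross c0 SF) c0 cards0; apply: f0).
  by move: cF; have [eF _] := crossingP ec; rewrite leqn0 cards_eq0 => /eqP E; rewrite E inE in eF.
have [eF [u [v [ej uU vU]]]] := crossingP ec.
have cF' : (#|F :\ e| <= n)%N by move: cF; rewrite (cardsD1 e) eF.
have Fh' : F :\ e \subset edges h by apply: subset_trans (subsetDl _ _) Fh.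
have vQ : v \in Q by apply: (hQ (u := u)); apply: (edges_joins hsym hirr) (subsetP Fh _ eF) ej.
rewrite (Ex_step p (fun S X => f #|X|) eF ej uU).
have cc : #|crossing F U| = #|crossing (F :\ e) U|.+1 by rewrite crossingD1 (cardsD1 e (crossing F U)) ec.
have low := crossing_card_low hsym hirr Fh inv ej uU vU.
have up := crossing_card_up hsym hirr Fh eF ej uU vU.
have /andP[h0 h1] := hd vQ.
rewrite cc in low up *.
apply: le_trans (st _ _ #|crossing (F :\ e) (v |: U)| Um _ _); first last.
- by rewrite -ltnS -addSn; apply: leq_trans up _; rewrite leq_add2l.
- apply: leq_trans (_ : _ <= #|crossing (F :\ e) U|.+1 + #|nbrs h v|)%N _; first by rewrite leq_add2l.
  by apply: leq_trans low _; rewrite leq_add2l leq_mul2l ltnW.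
apply: lerD.
  rewrite ler_wpM2l //; have := IH (F :\ e) (v |: U) cF' Fh'.
  rewrite cardsU1 vU add1n; apply.
    by rewrite subUset sub1set vQ.
  move=> e' e'h; rewrite !inE !negb_or => /andP[n1 n1'] /andP[n2 n2'].
  rewrite inv // andbT; apply: contraNneq n1' => E.
  by move: n2 n2'; rewrite E; case/orP: ej => /eqP -> /=; rewrite ?uU ?eqxx.
rewrite ler_wpM2l ?subr_ge0 //; apply: IH => // e' e'h n1 n2.
rewrite !inE inv // andbT; apply: contraNneq n1 => E.
by move: n2; rewrite E; case/orP: ej => /eqP -> /=; rewrite ?uU.
Qed.

Lemma explore_vertex p m (psi : nat -> nat -> R) (f : nat -> R) v : 0 <= p <= 1 ->
  (forall k, (k < m)%N -> f k <= psi k 0%N) ->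
  (forall k k' c, (m <= k)%N -> (k <= k')%N -> f k' <= psi k c) ->
  (forall k c c', (k < m)%N -> (c.+1 + d0 <= c' + 2 * m)%N -> (c' <= c + d1)%N ->
     p * psi k.+1 c' + (1 - p) * psi k c <= psi k c.+1) -> v \in Q ->
  Ex p (edges h) (fun S => f #|comp S v|) <= psi 1%N #|nbrs h v|.
Proof.
move=> p01 f0 fm st vQ.
have -> : #|nbrs h v| = #|crossing (edges h) [set v]|.
  rewrite card_crossing // big_set1; apply: eq_card => x; rewrite !inE.
  by case: eqP => [->|//]; rewrite hirr.
rewrite -[X in psi X _](cards1 v).
have -> : Ex p (edges h) (fun S => f #|comp S v|) =
          Ex p (edges h) (fun S => f #|reach S [set v]|).
  by apply: eq_wsum => S _; rewrite comp_reach.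
by apply: (explore p01 f0 fm st) => //; rewrite sub1set.
Qed.

(** If [1 - y] bounds the extinction probability from a vertex, then [th = 1 - p * y] does so for a
    pending edge. The hypothesis on [y] makes [th ^+ c] a supersolution for [c] pending edges, which
    bounds the probability of dying before [m] vertices. *)
Lemma big_comp_lower p y m v : 0 <= p <= 1 -> 0 <= y <= 1 -> (2 * m <= d0)%N ->
  (1 - p * y) ^+ (d0 - 2 * m) <= 1 - y -> v \in Q ->
  y <= Ex p (edges h) (fun S => (m <= #|comp S v|)%N%:R).
Proof.
move=> p01 /andP[y0 y1] m2 hy vQ; have /andP[p0 p1] := p01.
set th := 1 - p * y in hy.
have py1 : p * y <= 1 by apply: le_trans y1; rewrite ler_piMl.
have th0 : 0 <= th by rewrite subr_ge0.
have th1 : th <= 1 by rewrite gerBl mulr_ge0.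
suff H : Ex p (edges h) (fun S => (#|comp S v| < m)%N%:R) <= 1 - y.
  have E : Ex p (edges h) (fun S => (m <= #|comp S v|)%N%:R) +
           Ex p (edges h) (fun S => (#|comp S v| < m)%N%:R) = 1.
    rewrite -wsumD -[RHS](Ex_cst p (edges h) 1); apply: eq_wsum => S _.
    by rewrite ltnNge; case: (_ <= _)%N; rewrite ?addr0 ?add0r.
  move: E H; set X1 := Ex _ _ (fun S => (m <= _)%N%:R); set X2 := Ex _ _ _.
  by move=> E H; lra.
pose psi k c := if (k < m)%N then th ^+ c else 0.
have psi_le k c : psi k c <= th ^+ c by rewrite /psi; case: ifP => // _; apply: exprn_ge0.
apply: le_trans (_ : psi 1%N #|nbrs h v| <= _); last first.
  apply: le_trans (psi_le _ _) _; apply: le_trans hy.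
  rewrite ler_wiXn2l //; apply: leq_trans (leq_subr _ _) _.
  by have /andP[] := hd vQ.
apply: (explore_vertex (m := m) (f := fun k => (k < m)%N%:R)) => // [k km|k k' c mk_edge kk'|k c c' km low _].
- by rewrite /psi km expr0.
- by rewrite /psi ltnNge (leq_trans mk_edge kk') /= ltnNge mk_edge.
- apply: le_trans (_ : p * (th ^+ c * (1 - y)) + (1 - p) * th ^+ c <= _).
    apply: lerD; apply: ler_wpM2l => //; rewrite ?subr_ge0 //.
    apply: le_trans (psi_le _ _) _.
    apply: le_trans (_ : th ^+ (c + (d0 - 2 * m)) <= _).
      apply: ler_wiXn2l => //; move: low m2; clear; lia.
    by rewrite exprD ler_wpM2l ?exprn_ge0.
  rewrite /psi km exprS le_eqVlt; apply/orP; left; apply/eqP; rewrite /th; ring.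
Qed.

(** The point [w] satisfies its fixpoint inequality with a factor [rho] to spare, and this factor
    pays for each vertex discovered. Since [w <= y], the correction outweighs [th ^+ c] once [m]
    vertices are found; at the start it costs only [rho ^+ m.-1]. *)
Lemma big_comp_upper p y w rho m v : 0 <= p <= 1 -> 0 <= w -> w <= y -> y <= 1 ->
  0 < rho -> (2 * m <= d0)%N ->
  1 - y <= (1 - p * y) ^+ d1 ->
  (1 - p * w) ^+ (d0 - 2 * m) <= rho * (1 - w) -> v \in Q ->
  Ex p (edges h) (fun S => (m <= #|comp S v|)%N%:R) <= y + rho ^+ m.-1.
Proof.
move=> p01 w0 wy y1 rho0 m2 hy hw vQ; have /andP[p0 p1] := p01.
set th := 1 - p * y in hy; set ze := 1 - p * w in hw.
have y0 := le_trans w0 wy.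
have py1 : p * y <= 1 by apply: le_trans y1; rewrite ler_piMl.
have th0 : 0 <= th by rewrite subr_ge0.
have th1 : th <= 1 by rewrite gerBl mulr_ge0.
have thze : th <= ze by rewrite lerB // ler_wpM2l.
have ze1 : ze <= 1 by rewrite gerBl mulr_ge0.
have ze0 := le_trans th0 thze.
(* [1 - th ^+ c] is the survival probability; the other term makes up for
   processes which stop after reaching [m] vertices. *)
pose psi k c := 1 - th ^+ c + rho ^+ (m - k) * ze ^+ c.
apply: le_trans (_ : psi 1%N #|nbrs h v| <= _); last first.
  rewrite /psi subn1; apply: lerD.
    rewrite lerBlDr -lerBlDl; apply: le_trans hy _.
    by rewrite ler_wiXn2l //; have /andP[] := hd vQ.
  by rewrite ler_piMr ?exprn_ile1 // exprn_ge0 // ltW.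
apply: (explore_vertex (m := m) (f := fun k => (m <= k)%N%:R)) => // [k km|k k' c mk_edge kk'|k c c' km low up].
- by rewrite /psi leqNgt km !expr0 subrr add0r mulr1 exprn_ge0 // ltW.
- rewrite /psi (leq_trans mk_edge kk') (eqP mk_edge) expr0 mul1r -addrA lerDl.
  by rewrite addrC subr_ge0 lerXn2r ?nnegrE.
- have A : th ^+ c * (1 - y) <= th ^+ c'.
    apply: le_trans (_ : th ^+ (c + d1) <= _); last by rewrite ler_wiXn2l.
    by rewrite exprD ler_wpM2l ?exprn_ge0.
  have B : ze ^+ c' <= ze ^+ c * (rho * (1 - w)).
    apply: le_trans (_ : ze ^+ (c + (d0 - 2 * m)) <= _).
      apply: ler_wiXn2l => //; move: low m2; clear; lia.
    by rewrite exprD ler_wpM2l ?exprn_ge0.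
  rewrite /psi; have -> : (m - k = (m - k.+1).+1)%N by rewrite subnSK.
  set r := rho ^+ (m - k.+1).
  have r0 : 0 <= r by rewrite exprn_ge0 // ltW.
  have A' : p * (th ^+ c * (1 - y)) <= p * th ^+ c' by rewrite ler_wpM2l.
  have B' : p * (r * ze ^+ c') <= p * (r * (ze ^+ c * (rho * (1 - w)))).
    by rewrite !ler_wpM2l.
  rewrite !exprS -/r -subr_ge0.
  rewrite (_ : _ - _ = (p * th ^+ c' - p * (th ^+ c * (1 - y))) +
    (p * (r * (ze ^+ c * (rho * (1 - w)))) - p * (r * ze ^+ c'))); last first.
    rewrite /ze /th; ring.
  by rewrite addr_ge0 // subr_ge0.
Qed.

End Host.
End Exploration.

(** * Geometry of Cartesian products *)

Local Close Scope ring_scope.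

Section Product.
Variables (t : nat) (Gs : 'I_t -> graph) (dg : 'I_t -> nat) (Cn : nat).
Hypothesis Gsimple : forall i, simple_graph (Gs i).
Hypothesis Gconn : forall i, connected_graph (Gs i).
Hypothesis Greg : forall i, regular_of_degree (Gs i) (dg i).
Hypothesis G2 : forall i, 2 <= gsize (Gs i).
Hypothesis GC : forall i, gsize (Gs i) <= Cn.

Local Notation V := (cvert Gs).
Local Notation deg := (\sum_(i < t) dg i).
Implicit Types (u v w x : V) (X A Q : {set V}) (J Y : {set 'I_t}).

Definition upd u i (a : 'I_(gsize (Gs i))) : V := [ffun j => dfwith u a j].

Lemma upd_in u i a : @upd u i a i = a.
Proof. by rewrite ffunE dfwith_in. Qed.

Lemma upd_out u i a j : j != i -> @upd u i a j = u j.
Proof. by move=> ji; rewrite ffunE dfwith_out // eq_sym. Qed.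

Definition dadj i u v :=
  gadj (Gs i) (u i) (v i) && [forall j : 'I_t, (j != i) ==> (u j == v j)].

Lemma dadjP i u v :
  reflect (gadj (Gs i) (u i) (v i) /\ forall j, j != i -> u j = v j) (dadj i u v).
Proof.
apply: (iffP andP) => -[H1 H2]; split=> //; first by move=> j ji; apply/eqP/(implyP (forallP H2 j)).
by apply/forallP => j; apply/implyP => ji; apply/eqP/H2.
Qed.

Lemma dadj_sym i u v : dadj i u v = dadj i v u.
Proof.
have [s _] := Gsimple i.
by apply/dadjP/dadjP => -[H1 H2]; split; rewrite 1?s // => j ji; rewrite H2.
Qed.

Lemma dadj_neq i u v : dadj i u v -> u i != v i.
Proof.
have [_ irr] := Gsimple i.
by move/dadjP => [H _]; apply: contraTneq H => ->; rewrite irr.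
Qed.

Lemma dadj_uniq i j u v : dadj i u v -> dadj j u v -> i = j.
Proof.
move=> /dadj_neq n /dadjP[_ H]; apply/eqP; apply: contraNT n => ij.
by rewrite H.
Qed.

Lemma cadjE u v : @cadj t Gs u v = [exists i, dadj i u v].
Proof. by []. Qed.

Lemma cadj_sym : symmetric (@cadj t Gs).
Proof. by move=> u v; rewrite !cadjE; apply: eq_existsb => i; apply: dadj_sym. Qed.

Lemma cadj_irr : irreflexive (@cadj t Gs).
Proof.
by move=> u; rewrite cadjE; apply/existsP => -[i /dadj_neq]; rewrite eqxx.
Qed.

Lemma sum_dadj (P : pred 'I_t) u v :
  \sum_(i | P i) (dadj i u v : nat) = [exists (i | P i), dadj i u v].
Proof.
case: (boolP [exists (i | P i), dadj i u v]) => [/exists_inP[i Pi ad]|/exists_inPn H].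
  rewrite (bigD1 i) //= ad big1 // => j /andP[_ ji].
  by case: (boolP (dadj j u v)) => // /(dadj_uniq ad) E; rewrite E eqxx in ji.
by rewrite big1 // => i /H /negbTE ->.
Qed.

Lemma card_dadj i v : #|[set w | dadj i v w]| = dg i.
Proof.
rewrite -(Greg (v i)) -(card_imset _ (f := upd v (i := i))); last first.
  by move=> a b /(congr1 (fun u : V => u i)); rewrite !upd_in.
apply: eq_card => w; apply/idP/imsetP => [|[a]]; rewrite inE.
  move=> /dadjP[H1 H2]; exists (w i); first by rewrite inE.
  apply/ffunP => j; have [->|ji] := eqVneq j i; first by rewrite upd_in.
  by rewrite upd_out // H2.
move=> va ->; rewrite inE; apply/dadjP; rewrite upd_in; split=> // j ji.
by rewrite upd_out.
Qed.

Lemma card_dadjs (P : pred 'I_t) v :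
  #|[set w | [exists (i | P i), dadj i v w]]| = \sum_(i | P i) dg i.
Proof.
rewrite -sum1dep_card big_mkcond /=.
transitivity (\sum_w \sum_(i | P i) (dadj i v w : nat)).
  by apply: eq_bigr => w _; rewrite sum_dadj; case: ifP.
rewrite exchange_big; apply: eq_bigr => i _ /=.
by rewrite -(card_dadj i v) -sum1dep_card [RHS]big_mkcond; apply: eq_bigr => w _; case: ifP.
Qed.

Lemma card_nbrs v : #|nbrs (@cadj t Gs) v| = deg.
Proof. by rewrite -(card_dadjs xpredT v); apply: eq_card => w; rewrite [LHS]inE [RHS]inE. Qed.

Lemma has_nbr i (a : 'I_(gsize (Gs i))) : exists b, gadj (Gs i) a b.
Proof.
have [b nab] : exists b : 'I_(gsize (Gs i)), b != a.
  have : 0 < #|[set~ a]| by rewrite cardsC1 card_ord -ltnS prednK ?G2 // ltnW // G2.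
  by move=> /card_gt0P[b]; rewrite !inE => ?; exists b.
have /connectP[[|c s] /=] := Gconn a b; first by move=> _ E; rewrite E eqxx in nab.
by move=> /andP[ac _] _; exists c.
Qed.

Lemma cvert_witness : V.
Proof. by apply: finfun => i; exact: (Ordinal (ltnW (G2 i))). Qed.

Lemma dg_gt0 i : 0 < dg i.
Proof.
have [b ab] := has_nbr (cvert_witness i).
by rewrite -(Greg (cvert_witness i)); apply/card_gt0P; exists b; rewrite inE.
Qed.

Lemma dg_le i : dg i <= Cn.
Proof.
rewrite -(Greg (cvert_witness i)); apply: leq_trans (max_card _) _.
by rewrite card_ord.
Qed.

Lemma deg_ge : t <= deg.
Proof.
rewrite -[leqLHS]card_ord -sum1_card; apply: leq_sum => i _; exact: dg_gt0.
Qed.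

Lemma deg_le : deg <= Cn * t.
Proof.
rewrite mulnC -[t in leqRHS]card_ord -sum_nat_const; apply: leq_sum => i _; exact: dg_le.
Qed.

Lemma card_cvert_le : #|V| <= Cn ^ t.
Proof.
rewrite card_dep_ffun foldrE big_image -[t in leqRHS]card_ord -prod_nat_const /=.
by apply: leq_prod => i _; rewrite card_ord.
Qed.

Lemma card_cvert_ge : 2 ^ t <= #|V|.
Proof.
rewrite card_dep_ffun foldrE big_image -[t in leqLHS]card_ord -prod_nat_const /=.
by apply: leq_prod => i _; rewrite card_ord.
Qed.

Section Isoperimetry.
Variable X : {set V}.

(* Vertices of [X] that agree with [u] from coordinate [k] on.  In direction [k] an
   edge of [X] has an endpoint whose tail_class at least doubles from [k] to [k + 1], and
   a given vertex doubles at most [log2 #|X|] times. *)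
Definition tail_class k u : {set V} :=
  [set v in X | [forall j : 'I_t, (k <= j) ==> (v j == u j)]].

Lemma tail_classP k u v :
  reflect (v \in X /\ forall j : 'I_t, k <= j -> v j = u j) (v \in tail_class k u).
Proof.
rewrite inE; apply: (iffP andP) => -[H1 H2]; split=> //.
  by move=> j kj; apply/eqP/(implyP (forallP H2 j)).
by apply/forallP => j; apply/implyP => kj; apply/eqP/H2.
Qed.

Definition minority k u := 2 * #|tail_class k u| <= #|tail_class k.+1 u|.

(** The two endpoints differ in coordinate [k], so their classes at level [k] are disjoint, while
    both lie in one class at level [k.+1]; the smaller fills at most half of it. *)
Lemma dadj_minority (k : 'I_t) u w : dadj k u w -> minority k u || minority k w.
Proof.
move=> uw; have /dadjP[_ H] := uw.
have E : tail_class k.+1 w = tail_class k.+1 u.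
  apply/setP => v; apply/tail_classP/tail_classP => -[vX Hv]; split=> // j kj;
    by rewrite Hv // H // ; apply: contraTneq kj => ->; rewrite ltnn.
have dis : tail_class k u :&: tail_class k w = set0.
  apply/setP => v; rewrite !in_set0 in_setI; apply/negbTE/negP => /andP[/tail_classP[_ Hu] /tail_classP[_ Hw]].
  by have := dadj_neq uw; rewrite -Hu // Hw // eqxx.
have sub : tail_class k u :|: tail_class k w \subset tail_class k.+1 u.
  rewrite subUset -{2}E; apply/andP; split; apply/subsetP => v /tail_classP[vX Hv];
    by apply/tail_classP; split=> // j kj; rewrite Hv // ltnW.
have := subset_leq_card sub; rewrite cardsU dis cards0 subn0 /minority E.
by move=> H'; case: (leqP #|tail_class k u| #|tail_class k w|) => H2; apply/orP; [left|right]; lia.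
Qed.

Lemma minority_count u : u \in X ->
  \sum_(k < t) (minority k u : nat) <= trunc_log 2 #|X|.
Proof.
move=> uX; have X0 : 0 < #|X| by apply/card_gt0P; exists u.
apply: trunc_log_max => //.
have le : #|tail_class t u| <= #|X| by apply: subset_leq_card; apply/subsetP => v; rewrite inE => /andP[].
apply: leq_trans le; rewrite -(big_mkord xpredT (fun k => (minority k u : nat))).
suff H k : 2 ^ (\sum_(0 <= j < k) (minority j u : nat)) <= #|tail_class k u| by exact: H.
elim: k => [|k IH].
  by rewrite big_geq // expn0; apply/card_gt0P; exists u; apply/tail_classP.
rewrite big_nat_recr //= expnD; case: (boolP (minority k u)) => [m|_].
  by apply: leq_trans m; rewrite expn1 mulnC leq_mul2l.
rewrite expn0 muln1; apply: leq_trans IH _; apply: subset_leq_card.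
by apply/subsetP => v /tail_classP[vX H]; apply/tail_classP; split=> // j kj; rewrite H // ltnW.
Qed.

(** Each internal edge is charged to a minority endpoint. A vertex is charged in at most
    [trunc_log 2 #|X|] directions, with at most [Cn] edges in each; the factor 2 appears because the
    left side counts every edge from both ends. *)
Lemma isoperimetry :
  \sum_(u in X) #|nbrs (@cadj t Gs) u :&: X| <= 2 * Cn * #|X| * trunc_log 2 #|X|.
Proof.
pose N (k : 'I_t) := \sum_(u in X) \sum_(w in X) (minority k u * dadj k u w).
have -> : \sum_(u in X) #|nbrs (@cadj t Gs) u :&: X| =
    \sum_(k < t) \sum_(u in X) \sum_(w in X) (dadj k u w : nat).
  rewrite exchange_big; apply: eq_bigr => u _; rewrite exchange_big /=.
  rewrite -sum1_card big_mkcond [RHS]big_mkcond; apply: eq_bigr => w _.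
  rewrite (sum_dadj xpredT) in_setI inE -cadjE; by case: (_ \in X); case: (cadj _ _).
apply: leq_trans (_ : \sum_(k < t) 2 * N k <= _).
  apply: leq_sum => k _; rewrite mul2n -addnn {2}/N [X in _ <= _ + X]exchange_big /N -big_split /=.
  apply: leq_sum => u _; rewrite -big_split /=; apply: leq_sum => w _.
  rewrite [dadj k w u]dadj_sym -mulnDl; case: (boolP (dadj k u w)) => //= /dadj_minority.
  by rewrite muln1; case: (minority k u); case: (minority k w).
rewrite -big_distrr /= /N exchange_big /=.
have -> : 2 * Cn * #|X| * trunc_log 2 #|X| = 2 * \sum_(u in X) trunc_log 2 #|X| * Cn.
  rewrite sum_nat_const; ring.
rewrite leq_mul2l /=.
apply: leq_sum => u uX.
apply: leq_trans (_ : (\sum_(k < t) (minority k u : nat)) * Cn <= _); last first.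
  by rewrite leq_mul2r minority_count ?orbT.
rewrite big_distrl /=; apply: leq_sum => k _.
rewrite -big_distrr leq_mul2l; apply/orP; right.
apply: leq_trans (dg_le k); rewrite -(card_dadj k u) -sum1dep_card big_mkcond [leqRHS]big_mkcond.
by apply: leq_sum => w _; case: ifP; case: (dadj k u w).
Qed.

End Isoperimetry.

(** * Vertex expansion of the product *)

Definition hybrid (k : nat) u v : V := [ffun j : 'I_t => if j < k then v j else u j].

(** The value is a plain number so that the code ['I_Cn] in [expansion] does not depend on the
    direction; a value out of range leaves [z] unchanged. *)
Definition set_coord (z : V) (k : 'I_t) (c : nat) : V :=
  if insub c is Some a then upd z (i := k) a else z.

Lemma upd_dadj u i a b : gadj (Gs i) a b -> @cadj t Gs (@upd u i a) (@upd u i b).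
Proof.
move=> ab; rewrite cadjE; apply/existsP; exists i; apply/dadjP.
by rewrite !upd_in; split=> // j ji; rewrite !upd_out.
Qed.

Lemma line_boundary A u (k : 'I_t) a b : @upd u k a \in A -> @upd u k b \notin A ->
  exists c, @upd u k c \in inner_boundary (@cadj t Gs) A.
Proof.
move=> aA /negP bA; case: (boolP [exists c, @upd u k c \in inner_boundary (@cadj t Gs) A]) => [/existsP //|/existsPn H].
case: bA.
have cl (x y : 'I_(gsize (Gs k))) : gadj (Gs k) x y -> @upd u k x \in A -> @upd u k y \in A.
  move=> xy xA; apply/negPn/negP => yA; have /negP[] := H x; rewrite inE xA /=.
  by apply/existsP; exists (@upd u k y); rewrite yA upd_dadj.
have /connectP[s] := Gconn a b.
elim: s a aA => [|c s IH] a aA /=; first by move=> _ ->.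
by move=> /andP[ac ps]; apply: IH => //; apply: cl ac aA.
Qed.

(* For [u] in [A] and [v] outside, some step of the interpolation [hybrid] leaves [A]
   along a line, which then contains a boundary vertex [z]; the pair is recovered
   from the direction, [z], a coordinate and the complementary hybrid. *)
Lemma expansion A : #|A| * #|~: A| <= t * #|inner_boundary (@cadj t Gs) A| * Cn * #|V|.
Proof.
pose Phi (q : 'I_t * V * 'I_Cn * V) : V * V :=
  let x := set_coord q.1.1.2 q.1.1.1 q.1.2 in let w := q.2 in let k := q.1.1.1 in
  ([ffun j : 'I_t => if (j < k)%N then w j else x j], [ffun j : 'I_t => if (j < k)%N then x j else w j]).
have -> : t * #|inner_boundary (@cadj t Gs) A| * Cn * #|V| = #|setX (setX (setX [set: 'I_t] (inner_boundary (@cadj t Gs) A)) [set: 'I_Cn]) [set: V]|.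
  by rewrite !cardsX !cardsT !card_ord.
rewrite -cardsX; apply: leq_trans (leq_imset_card Phi _); apply: subset_leq_card.
apply/subsetP => -[u v]; rewrite in_setX inE => /= /andP[uA vA].
have [k kA kA'] : exists2 k : 'I_t, hybrid k u v \in A & hybrid k.+1 u v \notin A.
  apply/exists_inP; apply: contraNT vA => /exists_inPn H.
  suff I k : k <= t -> hybrid k u v \in A.
    suff -> : v = hybrid t u v by apply: I.
    by apply/ffunP => j; rewrite ffunE ltn_ord.
  elim: k => [_|k IH kt].
    by suff -> : hybrid 0 u v = u by []; apply/ffunP => j; rewrite ffunE.
  by have /negPn := H (Ordinal kt) (IH (ltnW kt)).
pose h := hybrid k u v.
have E1 : h = @upd h k (u k).
  apply/ffunP => j; have [->|jk] := eqVneq j k; first by rewrite upd_in /h ffunE ltnn.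
  by rewrite upd_out.
have E2 : hybrid k.+1 u v = @upd h k (v k).
  apply/ffunP => j; have [->|jk] := eqVneq j k; first by rewrite upd_in ffunE leqnn.
  by rewrite upd_out // /h !ffunE ltnS leq_eqVlt val_eqE (negbTE jk).
rewrite -/h E1 in kA; rewrite E2 in kA'.
have [c cA] := line_boundary kA kA'.
have cC : u k < Cn by apply: leq_trans (GC k).
apply/imsetP; exists (k, @upd h k c, Ordinal cC, hybrid k v u).
  by rewrite !in_setX !in_setT cA.
(* Resetting coordinate [k] to [u k] undoes the walk along the line from the hybrid to the boundary
   vertex. *)
have X : set_coord (@upd h k c) k (u k) = h.
  rewrite /set_coord valK; apply/ffunP => j.
  have [->|jk] := eqVneq j k; first by rewrite upd_in /h ffunE ltnn.
  by rewrite !upd_out.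
rewrite /Phi /= X; congr pair; apply/ffunP => j; by rewrite !ffunE; case: (j < k).
Qed.

(** * Disjoint slices at distance two from a vertex *)

Section Flips.
Variables (J : {set 'I_t}) (v : V).

(** The default is never taken: a connected factor with two vertices gives every vertex a
    neighbour. *)
Definition sigma i (a : 'I_(gsize (Gs i))) := odflt a [pick b | gadj (Gs i) a b].

Lemma sigma_adj i a : gadj (Gs i) a (sigma a).
Proof.
rewrite /sigma; case: pickP => [b //|H].
by have [b] := has_nbr a; rewrite H.
Qed.

Lemma sigma_neq i (a : 'I_(gsize (Gs i))) : sigma a != a.
Proof.
have [_ irr] := Gsimple i.
by apply: contraTneq (sigma_adj a) => ->; rewrite irr.
Qed.

Definition flip Y : V := [ffun i => if i \in Y then sigma (v i) else v i].

(** The subproduct through [flip Y] in the directions outside [J]. All of [J] is frozen, not only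
    [Y], so that distinct subsets of [J] give disjoint slices. *)
Definition slice Y : {set V} := [set u : V | [forall (i | i \in J), u i == flip Y i]].

Lemma sliceP Y u : reflect (forall i, i \in J -> u i = flip Y i) (u \in slice Y).
Proof. by rewrite inE; apply: (iffP forall_inP) => H i /H /eqP. Qed.

Lemma flip_slice Y : flip Y \in slice Y.
Proof. exact/sliceP. Qed.

Lemma slice_disjoint Y Y' : Y \subset J -> Y' \subset J -> Y != Y' ->
  [disjoint slice Y & slice Y'].
Proof.
move=> YJ Y'J; apply: contraR => /pred0Pn[u /andP[/sliceP H /sliceP H']].
apply/eqP/setP => i; case: (boolP (i \in J)) => [iJ|niJ]; last first.
  have out (Z : {set 'I_t}) : Z \subset J -> (i \in Z) = false.
    by move=> ZJ; apply: contraNF niJ => iZ; apply: (subsetP ZJ).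
  by rewrite !out.
have := H i iJ; rewrite (H' i iJ) !ffunE.
case: (i \in Y); case: (i \in Y') => // E; have := sigma_neq (v i); last by rewrite E eqxx.
by rewrite -E eqxx.
Qed.

Lemma flip_near Y : #|Y| = 2 ->
  exists2 z, @cadj t Gs v z & @cadj t Gs z (flip Y).
Proof.
move/eqP/cards2P => [a [b [ab ->]]]; exists (flip [set a]).
  rewrite cadjE; apply/existsP; exists a; apply/dadjP.
  rewrite !ffunE inE eqxx sigma_adj; split=> // j ja.
  by rewrite ffunE inE (negbTE ja).
rewrite cadjE; apply/existsP; exists b; apply/dadjP.
rewrite !ffunE !inE eqxx orbT eq_sym (negbTE ab) sigma_adj; split=> // j jb.
by rewrite !ffunE !inE (negbTE jb) orbF.
Qed.

End Flips.

(** The induced subgraph on [Q], kept on the whole vertex type so that its edges form a subset of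
    those of the product. *)
Definition restrict (h : rel V) Q : rel V := fun x y => [&& h x y, x \in Q & y \in Q].

Lemma restrict_sym Q : symmetric (restrict (@cadj t Gs) Q).
Proof. by move=> x y; rewrite /restrict cadj_sym [(x \in _) && _]andbC. Qed.

Lemma restrict_irr Q : irreflexive (restrict (@cadj t Gs) Q).
Proof. by move=> x; rewrite /restrict cadj_irr. Qed.

Lemma nbrs_restrict_sub Q x : nbrs (restrict (@cadj t Gs) Q) x \subset nbrs (@cadj t Gs) x.
Proof. by apply/subsetP => y; rewrite !inE => /and3P[]. Qed.

Lemma slice_deg J v Y x : x \in slice J v Y ->
  deg <= #|nbrs (restrict (@cadj t Gs) (slice J v Y)) x| + Cn * #|J|.
Proof.
move=> xs; rewrite (bigID (mem J)) /= addnC; apply: leq_add; last first.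
  by rewrite mulnC -sum_nat_const; apply: leq_sum => i _; apply: dg_le.
rewrite -(card_dadjs _ x); apply: subset_leq_card; apply/subsetP => w.
rewrite !inE => /exists_inP[i iJ /[dup] xw /dadjP[_ H]].
have -> : restrict (@cadj t Gs) (slice J v Y) x w =
   [&& @cadj t Gs x w, x \in slice J v Y & w \in slice J v Y] by [].
rewrite xs /= cadjE; apply/andP; split; first by apply/existsP; exists i.
apply/sliceP => j jJ; rewrite -H; first exact: (sliceP _ _ _ _ xs).
by apply: contraNneq iJ => <-.
Qed.

Lemma restrict_boundary Q X d0 :
  (forall x, x \in Q -> d0 <= #|nbrs (restrict (@cadj t Gs) Q) x|) -> X \subset Q ->
  #|X| * d0 <= #|crossing (edges (restrict (@cadj t Gs) Q)) X| + 2 * Cn * #|X| * trunc_log 2 #|X|.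
Proof.
move=> hd XQ; apply: leq_trans (_ : _ <= #|crossing (edges (restrict (@cadj t Gs) Q)) X| +
  \sum_(u in X) #|nbrs (@cadj t Gs) u :&: X|) _; last by rewrite leq_add2l isoperimetry.
rewrite card_crossing; [|exact: restrict_sym|exact: restrict_irr].
rewrite -big_split -sum_nat_const /=; apply: leq_sum => x xX.
apply: leq_trans (hd x (subsetP XQ _ xX)) _.
rewrite -(cardsID X) addnC leq_add2l; apply: subset_leq_card.
exact/setSI/nbrs_restrict_sub.
Qed.

End Product.

Local Open Scope ring_scope.

(** * Merging large components by sprinkling *)

Lemma card_bigcup_le (I T : finType) (A : {set I}) (F : I -> {set T}) :
  (#|\bigcup_(i in A) F i| <= \sum_(i in A) #|F i|)%N.
Proof.
elim/big_rec2: _ => [|i n B _ le]; first by rewrite cards0.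
by apply: leq_trans (leq_card_setU _ _) _; rewrite leq_add2l.
Qed.

(** A maximal conflict-free subset conflicts with every point of [X], so its conflict neighbourhoods
    cover [X]. *)
Lemma independent_subset (T : finType) (X : {set T}) (conf : rel T) (B : nat) :
  symmetric conf -> reflexive conf ->
  (forall x, x \in X -> #|[set y | conf x y]| <= B)%N ->
  exists2 I : {set T}, I \subset X /\ {in I &, forall x y, x != y -> ~~ conf x y}
    & (#|X| <= #|I| * B)%N.
Proof.
move=> csym crefl cB.
pose P (I : {set T}) := (I \subset X) &&
  [forall x in I, forall y in I, (x != y) ==> ~~ conf x y].
have [|I /maxsetP[/andP[IX /forall_inP HI] maxI]] := @ex_maxset _ P.
  by exists set0; rewrite /P sub0set; apply/forall_inP => x; rewrite inE.
have HI' : {in I &, forall x y, x != y -> ~~ conf x y}.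
  by move=> x y xI yI; apply/implyP; have /forall_inP := HI x xI; apply.
exists I; first by [].
have sub : X \subset \bigcup_(x in I) [set y | conf x y].
  apply/subsetP => y yX; apply/negPn/negP => ny.
  have nyI x : x \in I -> ~~ conf x y.
    by move=> xI; apply: contra ny => xy; apply/bigcupP; exists x; rewrite ?inE.
  suff E : y |: I = I by have := nyI y; rewrite crefl -{1}E setU11 => /(_ isT).
  apply: maxI; last exact: subsetUr.
  rewrite /P subUset sub1set yX IX /=; apply/forall_inP => a aI; apply/forall_inP => b bI.
  apply/implyP => ab; move: aI bI; rewrite !inE => /orP[/eqP Ea|aI] /orP[/eqP Eb|bI].
  - by rewrite Ea Eb eqxx in ab.
  - by rewrite Ea csym nyI.
  - by rewrite Eb nyI.
  - exact: HI'.
apply: leq_trans (subset_leq_card sub) _; apply: leq_trans (card_bigcup_le _ _) _.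
rewrite -sum_nat_const; apply: leq_sum => x xI; apply: cB.
exact: (subsetP IX).
Qed.

Section Merge.
Variables (V : finType) (h : rel V) (D : nat).
Hypothesis hsym : symmetric h.
Hypothesis hirr : irreflexive h.
Hypothesis hD : forall x, (#|nbrs h x| <= D)%N.
Implicit Types (S P : {set V * V}) (A B W : {set V}) (x y z u w : V).

Definition rel1 x y := (x == y) || h x y.

Lemma rel1_sym : symmetric rel1.
Proof. by move=> x y; rewrite /rel1 eq_sym hsym. Qed.

Fixpoint ball k x : {set V} :=
  if k is k'.+1 then \bigcup_(y in ball k' x) [set z | rel1 y z] else [set x].

Lemma card_ball k x : (#|ball k x| <= D.+1 ^ k)%N.
Proof.
elim: k => [|k IH] /=; first by rewrite cards1.
apply: leq_trans (card_bigcup_le _ _) _; rewrite expnSr.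
apply: leq_trans (_ : \sum_(y in ball k x) D.+1 <= _)%N; last first.
  by rewrite sum_nat_const leq_mul2r IH orbT.
apply: leq_sum => y _.
have -> : [set z | rel1 y z] = y |: nbrs h y.
  by apply/setP => z; rewrite !inE /rel1 eq_sym.
by rewrite cardsU1 -[D.+1]add1n; apply: leq_add; rewrite ?hD //; case: (_ \notin _).
Qed.

Lemma ball_step k x y z : y \in ball k x -> rel1 y z -> z \in ball k.+1 x.
Proof. by move=> yx yz; apply/bigcupP; exists y; rewrite ?inE. Qed.

Lemma ball_mono k x y : y \in ball k x -> y \in ball k.+1 x.
Proof. by move=> H; apply: ball_step H _; rewrite /rel1 eqxx. Qed.

Lemma ball_trans j k x y z : y \in ball j x -> z \in ball k y -> z \in ball (j + k) x.
Proof.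
move=> yx; elim: k z => [|k IH] z; first by rewrite inE addn0 => /eqP ->.
case/bigcupP => w /IH wx; rewrite inE => wz; rewrite addnS.
exact: ball_step wx wz.
Qed.

Lemma ball_sym k x y : y \in ball k x -> x \in ball k y.
Proof.
elim: k y => [|k IH] y; first by rewrite !inE eq_sym.
case/bigcupP => w /IH wx; rewrite inE => wy.
by rewrite -add1n; apply: ball_trans wx; apply: (@ball_step 0 _ y); rewrite ?inE // rel1_sym.
Qed.

(** Only the first end of each edge is asked to be near [u]: two path sets with a common edge share
    that end, and this is what [pconf_card] uses. *)
Definition link n k u x y P :=
  [&& P \subset edges h, (#|P| <= n)%N, [forall e in P, e.1 \in ball k u]
    & connect (sub_adj P) x y].

Lemma link_trans n m k u x y z P P' : link n k u x y P -> link m k u y z P' ->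
  link (n + m) k u x z (P :|: P').
Proof.
move=> /and4P[P1 P2 /forall_inP P3 P4] /and4P[Q1 Q2 /forall_inP Q3 Q4]; apply/and4P; split.
- by rewrite subUset P1.
- exact: leq_trans (leq_card_setU _ _) (leq_add P2 Q2).
- by apply/forall_inP => e; rewrite inE => /orP[/P3|/Q3].
- apply: connect_trans (connectS _ P4) (connectS _ Q4); first exact: subsetUl.
  exact: subsetUr.
Qed.

Lemma link_step k u x y : rel1 x y -> x \in ball k u -> y \in ball k u ->
  exists P, link 1 k u x y P.
Proof.
rewrite /rel1; have [-> _ _ _|nxy /= xy xu yu] := eqVneq x y.
  exists set0; rewrite /link sub0set cards0 connect0 andbT /=.
  by apply/forall_inP => e; rewrite inE.
exists [set mk_edge x y]; rewrite /link sub1set (mk_edge_edges hsym hirr) xy cards1 /=.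
apply/andP; split.
  by apply/forall_inP => e; rewrite inE => /eqP ->; case/orP: (mk_edge_joins x y) => /eqP ->.
by apply: connect1; apply: joins_sub_adj (mk_edge_joins x y) _; rewrite inE.
Qed.

Definition near2 x y := [exists u, rel1 x u && rel1 u y].

Lemma near2_refl x : near2 x x.
Proof. by apply/existsP; exists x; rewrite /rel1 eqxx. Qed.

Variable M : nat.
Hypothesis hexp : forall A, (#|A| * #|~: A| <= M * #|inner_boundary h A| * #|V|)%N.

Section Split.
Variables (A B : {set V}).
Hypothesis dAB : [disjoint A & B].
Hypothesis cover : forall x, exists2 w, w \in A :|: B & near2 x w.
Hypothesis leAB : (#|A| <= #|B|)%N.

(** A cut separating [A] from [B] in which each vertex is within distance 2 of the set on its own
    side; on the side of [B] this follows from [cover]. *)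
Let As := A :|: [set x in ~: B | [exists a in A, near2 x a]].

Lemma near_As u : u \in As -> exists2 a, a \in A & near2 u a.
Proof.
rewrite in_setU => /orP[uA|]; first by exists u => //; apply: near2_refl.
by rewrite inE => /andP[_ /exists_inP[a aA ua]]; exists a.
Qed.

Lemma near_nAs u : u \notin As -> exists2 b, b \in B & near2 u b.
Proof.
rewrite in_setU negb_or !inE => /andP[uA]; case uB: (u \in B) => /= H.
  by exists u => //; apply: near2_refl.
have [w] := cover u; rewrite inE => /orP[wA|wB] uw; last by exists w.
by case/negP: H; apply/exists_inP; exists w.
Qed.

(** Both sides of the cut have at least [#|A|] vertices, and the larger has at least half of all. *)
Lemma card_As : (#|A| * #|V| <= 2 * (#|As| * #|~: As|))%N.
Proof.
have sA : A \subset As by apply: subsetUl.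
have sB : B \subset ~: As.
  apply/subsetP => x xB; rewrite in_setC in_setU negb_or (disjointFl dAB xB) /=.
  by rewrite !inE xB.
have cV : (#|V| = #|As| + #|~: As|)%N by rewrite cardsC.
have := subset_leq_card sA; have := leq_trans leAB (subset_leq_card sB).
rewrite cV; nia.
Qed.

Definition pathset u P :=
  [&& P \subset edges h, (#|P| <= 5)%N, [forall e in P, e.1 \in ball 3 u]
    & [exists a in A, exists b in B, connect (sub_adj P) a b]].

(** Two steps from [A] to [u], one across the cut and two more to [B]: five edges, all within
    distance 3 of [u]. *)
Lemma pathset_ex u : u \in inner_boundary h As -> exists P, pathset u P.
Proof.
rewrite inE => /andP[/near_As[a aA /existsP[u1 /andP[uu1 u1a]]]].
move=> /existsP[w /andP[/near_nAs[b bB /existsP[w1 /andP[ww1 w1b]]] uw]].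
have u0b : u \in ball 0 u by rewrite inE.
have u1b := ball_step u0b uu1; have ab := ball_step u1b u1a.
have uw' : rel1 u w by rewrite /rel1 uw orbT.
have wb := ball_step u0b uw'; have w1b' := ball_step wb ww1; have bb := ball_step w1b' w1b.
have up k x : (k <= 3)%N -> x \in ball k u -> x \in ball 3 u.
  move=> k3 xk; have -> : 3%N = (k + (3 - k))%N by rewrite subnKC.
  apply: ball_trans xk _; elim: (3 - k)%N => [|n IH]; first by rewrite inE.
  exact: ball_mono.
have [P1 L1] := link_step (etrans (rel1_sym _ _) u1a) (up 2 a isT ab) (up 1 u1 isT u1b).
have [P2 L2] := link_step (etrans (rel1_sym _ _) uu1) (up 1 u1 isT u1b) (up 0 u isT u0b).
have [P3 L3] := link_step uw' (up 0 u isT u0b) (up 1 w isT wb).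
have [P4 L4] := link_step ww1 (up 1 w isT wb) (up 2 w1 isT w1b').
have [P5 L5] := link_step w1b (up 2 w1 isT w1b') (up 3 b isT bb).
have /and4P[H1 H2 H3 H4] := link_trans (link_trans (link_trans (link_trans L1 L2) L3) L4) L5.
exists (P1 :|: P2 :|: P3 :|: P4 :|: P5); apply/and4P; split=> //.
by apply/exists_inP; exists a => //; apply/exists_inP; exists b.
Qed.

Definition chosen_pathset u : {set V * V} := odflt set0 [pick P | pathset u P].

Lemma chosen_pathsetP u : u \in inner_boundary h As -> pathset u (chosen_pathset u).
Proof.
move=> /pathset_ex[P HP]; rewrite /chosen_pathset; case: pickP => [//|H].
by rewrite H in HP.
Qed.

Definition pconf u w := (u == w) || (chosen_pathset u :&: chosen_pathset w != set0).

(** A shared edge has its first end within distance 3 of both [u] and [w], which puts [w] in the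
    ball of radius 6. *)
Lemma pconf_card u : u \in inner_boundary h As -> (#|[set w in inner_boundary h As | pconf u w]| <= D.+1 ^ 6)%N.
Proof.
move=> uI; apply: leq_trans (card_ball 6 u); apply: subset_leq_card.
apply/subsetP => w; rewrite inE => /andP[wI /orP[/eqP <-|/set0Pn[e]]].
  do 6!apply: ball_mono; by rewrite inE.
rewrite inE => /andP[eu ew]; apply: (@ball_trans 3 3 _ e.1).
  by have /and4P[_ _ /forall_inP/(_ e eu)] := chosen_pathsetP uI.
by apply: ball_sym; have /and4P[_ _ /forall_inP/(_ e ew)] := chosen_pathsetP wI.
Qed.

Lemma disjoint_paths : exists2 I : {set V},
  I \subset inner_boundary h As /\ {in I &, forall x y, x != y -> [disjoint chosen_pathset x & chosen_pathset y]}
  & (#|A| <= #|I| * (2 * M * D.+1 ^ 6))%N.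
Proof.
have [V0|V0] := posnP #|V|.
  exists set0; first by split; [exact: sub0set|move=> x; rewrite inE].
  by apply: leq_trans (max_card _) _; rewrite V0.
(* Conflicts are counted only inside the boundary, so the relation is restricted to it; the added
   diagonal keeps it reflexive elsewhere. *)
have csym : symmetric (fun u w => (u == w) || [&& u \in inner_boundary h As, w \in inner_boundary h As & pconf u w]).
  move=> u w; rewrite /pconf eq_sym setIC; case: eqVneq => //= _.
  by rewrite andbCA.
have crefl : reflexive (fun u w => (u == w) || [&& u \in inner_boundary h As, w \in inner_boundary h As & pconf u w]).
  by move=> u; rewrite eqxx.
have [|I [II dI] cI] := independent_subset (X := inner_boundary h As) csym crefl (B := (D.+1 ^ 6)%N).
  move=> u uI; apply: leq_trans (pconf_card uI); apply: subset_leq_card.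
  apply/subsetP => w; rewrite in_set => H; rewrite in_set; move: H.
  by move=> /orP[/eqP <-|/andP[_ //]]; rewrite uI /pconf eqxx.
exists I.
  split=> // x y xI yI xy; have := dI x y xI yI xy; rewrite (negbTE xy) /=.
  by rewrite (subsetP II _ xI) (subsetP II _ yI) /= /pconf (negbTE xy) /= negbK setI_eq0.
have H1 := card_As; have H2 := hexp As.
have : (#|A| * #|V| <= #|I| * (2 * M * D.+1 ^ 6) * #|V|)%N.
  apply: leq_trans H1 _; apply: leq_trans (leq_mul (leqnn 2) H2) _.
  apply: leq_trans (_ : 2 * (M * (#|I| * D.+1 ^ 6) * #|V|) <= _)%N.
    by rewrite leq_mul2l /= leq_mul2r leq_mul2l cI !orbT.
  by apply: eq_leq; ring.
by rewrite leq_mul2r eqn0Ngt V0.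
Qed.

(** The chosen paths are disjoint, hence independent. Edges already in [S'] come for free, so a path
    needs at most 5 restored edges and fails with probability at most [1 - r ^+ 5]. *)
Lemma split_prob (R : realFieldType) (r : R) S' : 0 <= r <= 1 ->
  exists2 N, (#|A| <= N * (2 * M * D.+1 ^ 6))%N &
  Ex r (edges h :\: S') (fun T =>
    (~~ [exists a in A, exists b in B, connect (sub_adj (S' :|: T)) a b])%:R)
   <= (1 - r ^+ 5) ^+ N.
Proof.
move=> r01; have /andP[r0 r1] := r01; have [I [II dI] cI] := disjoint_paths.
exists #|I| => //.
pose f (u : V) (T : {set V * V}) : R := (~~ (chosen_pathset u :\: S' \subset T))%:R.
have sP u : u \in I -> chosen_pathset u \subset edges h.
  by move=> uI; have /and4P[] := chosen_pathsetP (subsetP II _ uI).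
apply: le_trans (_ : Ex r (edges h :\: S')
   (fun T => \prod_(u in I) f u (T :&: (chosen_pathset u :\: S'))) <= _).
  apply: Ex_le => // T TS.
  case: (boolP (~~ _)) => [/exists_inPn H|_]; last by apply: prodr_ge0 => u _; rewrite /f.
  rewrite big1 // => u uI; rewrite /f.
  have /and4P[_ _ _ /exists_inP[a aA /exists_inP[b bB ab]]] := chosen_pathsetP (subsetP II _ uI).
  case: (boolP (_ \subset _)) => //; rewrite subsetI subxx andbT => sub.
  have /exists_inPn/(_ b bB)/negP[] := H a aA; apply: connectS ab.
  by rewrite -subDset.
rewrite Ex_prod_disjoint; first last.
- move=> u w uI wI uw; apply: disjointWl (subsetDl _ _) _; apply: disjointWr (subsetDl _ _) _.
  exact: dI.
- by move=> u uI; apply: setSD; apply: sP.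
rewrite -prodr_const; apply: ler_prod => u uI.
apply/andP; split; first by apply: Ex_ge0 => // T _; rewrite /f.
have -> : Ex r (chosen_pathset u :\: S') (f u) = 1 - r ^+ #|chosen_pathset u :\: S'|.
  rewrite -(Ex_sub r (subxx _)) -[X in X - _](Ex_cst r (chosen_pathset u :\: S') 1) /Ex.
  rewrite -[in RHS]mulN1r -wsumZ -wsumD; apply: eq_wsum => T _.
  by rewrite /f; case: (_ \subset _) => /=; ring.
rewrite lerB // ler_wiXn2l //.
have /and4P[_ H _ _] := chosen_pathsetP (subsetP II _ uI).
by apply: leq_trans H; apply: subset_leq_card; apply: subsetDl.
Qed.

End Split.

Section AllSplits.
Variables (S' : {set V * V}) (s L0 : nat).
Let W := [set x | (s <= #|comp S' x|)%N].
Hypothesis bigL : forall x, x \in W -> (L0 * (2 * M * D.+1 ^ 6) <= #|comp S' x|)%N.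
Hypothesis MD0 : (0 < 2 * M * D.+1 ^ 6)%N.
Hypothesis cover : forall x, exists2 w, w \in W & near2 x w.

Let comp_root := fingraph.root (sub_adj S').

Lemma comp_root_connect x y : (comp_root x == comp_root y) = connect (sub_adj S') x y.
Proof. by rewrite /comp_root root_connect //; apply: sub_adj_connect_sym. Qed.

Lemma comp_root_idem x : comp_root (comp_root x) = comp_root x.
Proof. by rewrite /comp_root root_root //; apply: sub_adj_connect_sym. Qed.

Lemma comp_eq S x y : connect (sub_adj S) x y -> comp S x = comp S y.
Proof.
move=> xy; apply/setP => z; rewrite !inE.
by apply: same_connect; [exact: sub_adj_connect_sym|].
Qed.

Lemma comp_root_big x : (comp_root x \in W) = (x \in W).
Proof. by rewrite !inE (@comp_eq S' (comp_root x) x) // -comp_root_connect comp_root_idem. Qed.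

(** Unions of big components are indexed by sets of roots, so that [#|rho|] is the number of
    components in the union bound. *)
Definition part (rho : {set V}) := [set x in W | comp_root x \in rho].

Lemma part_card (rho : {set V}) : rho \subset comp_root @: W ->
  (#|rho| * (L0 * (2 * M * D.+1 ^ 6)) <= #|part rho|)%N.
Proof.
move=> rW.
have E : (#|part rho| = \sum_(r in rho) #|comp S' r|)%N.
  rewrite -sum1_card (partition_big comp_root (mem rho)) /=; last by move=> x; rewrite inE => /andP[].
  apply: eq_bigr => r rr; rewrite -sum1_card; apply: eq_bigl => x.
  have /imsetP[y yW Er] := subsetP rW _ rr.
  rewrite inE -andbA; have -> : (x \in comp S' r) = (comp_root x == r).
    by rewrite inE -comp_root_connect Er comp_root_idem eq_sym.
  case: eqP => [Ex|]; last by rewrite !andbF.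
  by rewrite Ex rr -comp_root_big Ex Er comp_root_big yW.
rewrite E -sum_nat_const; apply: leq_sum => r rr; apply: bigL.
by have /imsetP[y yW ->] := subsetP rW _ rr; rewrite comp_root_big.
Qed.

(* Union bound over the sets [rho] of component representatives: a union of [k]
   components has at least [k L0] disjoint chances to be joined to the rest. *)
Lemma merge_prob (R : realFieldType) (r : R) : 0 <= r <= 1 ->
  Ex r (edges h :\: S') (fun T =>
    [exists x in W, exists z in W, ~~ connect (sub_adj (S' :|: T)) x z]%:R)
  <= (1 + (1 - r ^+ 5) ^+ L0) ^+ #|V| - 1.
Proof.
move=> r01; have /andP[r0 r1] := r01; set tau := (1 - r ^+ 5) ^+ L0.
have r5 : 0 <= 1 - r ^+ 5 <= 1.
  by rewrite subr_ge0 exprn_ile1 // gerBl exprn_ge0.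
pose valid (rho : {set V}) :=
  [&& rho \subset comp_root @: W, rho != set0 & (#|part rho| <= #|W :\: part rho|)%N].
pose ev rho (T : {set V * V}) := ~~ [exists a in part rho, exists b in W :\: part rho,
   connect (sub_adj (S' :|: T)) a b].
apply: le_trans (_ : Ex r (edges h :\: S')
   (fun T => \sum_(rho | valid rho) (ev rho T)%:R) <= _).
  apply: Ex_le => // T TS; case: (boolP [exists x in W, _]) => [|_]; last exact: sumr_ge0.
  move=> /exists_inP[x xW /exists_inP[z zW xz]].
  pose A0 := [set u in W | connect (sub_adj (S' :|: T)) x u].
  have key A : A \subset W -> A != set0 -> (#|A| <= #|W :\: A|)%N ->
      (forall a b, a \in A -> b \in W -> connect (sub_adj (S' :|: T)) a b -> b \in A) ->
      1 <= \sum_(rho | valid rho) ((ev rho T)%:R : R).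
    move=> AW An leA clA.
    (* A set closed under connection in the larger graph is a union of components of [S']. *)
    have Ep : part (comp_root @: A) = A.
      apply/setP => y; rewrite inE; apply/andP/idP => [[yW /imsetP[a aA E]]|yA].
        apply: (clA a y aA yW); apply: connectS (subsetUl _ _) _.
        by rewrite -comp_root_connect E.
      by split; [exact: (subsetP AW)|apply: imset_f].
    have vA : valid (comp_root @: A).
      rewrite /valid imsetS //= Ep leA andbT; have /set0Pn[a aA] := An.
      by apply/set0Pn; exists (comp_root a); apply: imset_f.
    rewrite (bigD1 (comp_root @: A)) //= (_ : ev _ T); last first.
      rewrite /ev Ep; apply/exists_inPn => a aA; apply/exists_inPn => b /setDP[bW bA].
      exact: contra (clA a b aA bW) bA.
    by rewrite lerDl sumr_ge0.
  have csym := sub_adj_connect_sym (S' :|: T).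
  have A0P a b : a \in A0 -> b \in W -> connect (sub_adj (S' :|: T)) a b = (b \in A0).
    rewrite !inE => /andP[aW xa] bW; rewrite bW /=.
    by rewrite (same_connect csym xa).
  have A0W : A0 \subset W by apply/subsetP => a; rewrite inE => /andP[].
  have xA0 : x \in A0 by rewrite inE xW connect0.
  (* [split_prob] asks its first set to be the smaller one, so a class with more than half of [W] is
     replaced by its complement in [W]. *)
  case: (leqP #|A0| #|W :\: A0|) => le.
    apply: (key A0) => //; first by apply/set0Pn; exists x.
    by move=> a b aA bW; rewrite A0P.
  have DD : W :\: (W :\: A0) = A0 by rewrite setDDr setDv set0U; apply/setIidPr.
  apply: (key (W :\: A0)); first exact: subsetDl.
  - by apply/set0Pn; exists z; rewrite inE zW andbT inE zW.
  - by rewrite DD; apply: ltnW.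
  move=> a b /setDP[aW aA] bW ab; rewrite inE bW andbT.
  by apply: contra aA => bA; rewrite -(A0P b a bA aW) csym.
rewrite Ex_bigsum.
(* All nonempty vertex sets are allowed as [rho], so that the binomial theorem sums the bounds. *)
apply: le_trans (_ : \sum_(rho in powerset [set: V] | rho != set0) tau ^+ #|rho| <= _).
  rewrite big_mkcond [leRHS]big_mkcond /=; apply: ler_sum => rho _.
  rewrite powersetE subsetT /=; case: (boolP (valid rho)) => [/and3P[rW rn le]|_]; last first.
    by case: ifP => // _; rewrite !exprn_ge0 //; have /andP[] := r5.
  rewrite rn.
  have dis : [disjoint part rho & W :\: part rho] by apply: disjoint_setD.
  have cov x : exists2 w, w \in part rho :|: (W :\: part rho) & near2 x w.
    have [w wW xw] := cover x; exists w => //; rewrite !in_setU in_setD wW andbT.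
    by case: (_ \in part rho).
  have [N cN pN] := split_prob dis cov le S' r01.
  apply: le_trans pN _; rewrite -exprM.
  have : (#|rho| * L0 <= N)%N.
    by rewrite -(leq_pmul2r MD0) -mulnA; apply: leq_trans cN; apply: part_card.
  by move=> H; rewrite [(L0 * _)%N]mulnC; have /andP[? ?] := r5; apply: ler_wiXn2l.
have -> : (1 + tau) ^+ #|V| = \sum_(rho in powerset [set: V]) tau ^+ #|rho|.
  rewrite -cardsT addrC -[LHS]mulr1 -(wsum_cst tau 1 [set: V] 1) /wsum.
  by apply: eq_bigr => rho _; rewrite expr1n !mulr1.
rewrite [X in _ <= X - 1](bigD1 set0) ?powersetE ?sub0set //= cards0 expr0.
by rewrite addrAC subrr add0r.
Qed.

End AllSplits.
End Merge.

(** * Two large components *)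

Section Components.
Variable V : finType.
Implicit Types (S F T : {set V * V}) (x y z v : V) (s : nat).

Lemma comp_sub S S' x : S \subset S' -> comp S x \subset comp S' x.
Proof. by move=> SS; apply/subsetP => y; rewrite !inE; apply: connectS. Qed.

Lemma comp_leaves S (X : {set V}) x : x \in X -> ~~ (comp S x \subset X) ->
  exists2 e, e \in S & exists a b, [/\ joins e a b, a \in X & b \notin X].
Proof.
move=> xX nsub; have [c0|[e /crossingP[eS H]]] := set_0Vmem (crossing S X); last by exists e.
case/negP: nsub; rewrite comp_reach; apply: subset_trans (_ : reach S X \subset X).
  by apply: reach_min; [rewrite sub1set; apply: (subsetP (reach_sub _ _))|move=> ? ?; apply: reach_closed].
by rewrite (reach_nocross c0 (subxx _)).
Qed.

(** A tree grown from [x] along leaving edges has more than [k] vertices after [k] edges. *)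
Lemma small_witness S x s : (0 < s)%N -> (s <= #|comp S x|)%N ->
  exists T, [/\ T \subset S, (#|T| <= s)%N & (s <= #|comp T x|)%N].
Proof.
move=> s0 sS.
suff H k : (k < s)%N -> exists T, [/\ T \subset S, (#|T| <= k)%N & (k < #|comp T x|)%N].
  have [|T [T1 T2 T3]] := H s.-1; first by rewrite prednK.
  by exists T; split=> //; [apply: leq_trans T2 (leq_pred _)|rewrite prednK in T3].
elim: k => [_|k IH ks].
  exists set0; rewrite sub0set cards0; split=> //.
  by apply/card_gt0P; exists x; rewrite inE connect0.
have [T [T1 T2 T3]] := IH (ltnW ks).
have [kT|kT] := ltnP k.+1 #|comp T x|; first by exists T; split=> //; apply: leqW.
have xT : x \in comp T x by rewrite inE connect0.
have [|e eS [a [b [ej aT bT]]]] := @comp_leaves S (comp T x) x xT.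
  apply: contraL sS => /subset_leq_card H; rewrite -ltnNge.
  exact: leq_ltn_trans (leq_trans H kT) ks.
exists (e |: T); split.
- by rewrite subUset sub1set eS.
- by rewrite cardsU1 -[k.+1]add1n leq_add //; case: (_ \notin _).
apply: leq_trans (_ : k.+1 < #|b |: comp T x|)%N _; first by rewrite cardsU1 bT.
apply: subset_leq_card; rewrite subUset comp_sub ?subsetUr // andbT sub1set inE.
move: aT; rewrite inE => xa; apply: connect_trans (connectS (subsetUr _ _) xa) (connect1 _).
by apply: joins_sub_adj ej _; rewrite !inE eqxx.
Qed.

Definition bigset s S : {set V} := [set v | (s <= #|comp S v|)%N].

(** A vertex that becomes big through [e] lay in the component of an end of [e], and that component
    had fewer than [s] vertices. *)
Lemma bigset_osc (R : realFieldType) s F :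
  osc_le (2 * s)%:R F (fun S => #|bigset s S|%:R : R).
Proof.
move=> e S eF SF.
have sub : bigset s S \subset bigset s (e |: S).
  apply/subsetP => v; rewrite !inE => H; apply: leq_trans H _.
  by apply: subset_leq_card; apply: comp_sub; apply: subsetUr.
pose small x := if (#|comp S x| < s)%N then comp S x else set0.
have csmall x : (#|small x| <= s)%N by rewrite /small; case: ifP => [/ltnW//|_]; rewrite cards0.
have sub2 : bigset s (e |: S) \subset bigset s S :|: (small e.1 :|: small e.2).
  apply/subsetP => v; rewrite inE => H; rewrite in_setU inE.
  case: leqP => //= vs; have vv : v \in comp S v by rewrite inE connect0.
  have [|e' e'S [a [b [ej aX bX]]]] := @comp_leaves (e |: S) (comp S v) v vv.
    by apply: contraL H => /subset_leq_card H; rewrite -ltnNge (leq_ltn_trans H).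
  have key c : c \in comp S v -> v \in small c.
    rewrite inE => vc; rewrite /small -(comp_eq vc) vs.
    by rewrite inE connect0.
  move: e'S; rewrite !inE => /orP[/eqP E|e'S].
    rewrite E in ej; move: (key a aX); case/orP: ej => /eqP E' aa.
      by apply/orP; left; rewrite E'.
    by apply/orP; right; rewrite E'.
  case/negP: bX; move: aX; rewrite !inE => va; apply: connect_trans va (connect1 _).
  exact: joins_sub_adj ej e'S.
have H1 := subset_leq_card sub; have H2 := subset_leq_card sub2.
have H3 : (#|bigset s (e |: S)| <= #|bigset s S| + 2 * s)%N.
  apply: leq_trans H2 _; apply: leq_trans (leq_card_setU _ _) _; rewrite leq_add2l.
  by apply: leq_trans (leq_card_setU _ _) _; rewrite mul2n -addnn leq_add.
rewrite ger0_norm ?subr_ge0 ?ler_nat // lerBlDl -natrD ler_nat.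
exact: H3.
Qed.

Definition two_big s S := [exists x, exists z,
  [&& (s <= #|comp S x|)%N, (s <= #|comp S z|)%N & ~~ connect (sub_adj S) x z]].

(* Both components contain connected witnesses with at most [s] edges, which survive
   the thinning together with probability at least [(1 - q)^(2 s)]. *)
Lemma two_big_coupling (R : realFieldType) (p q : R) s F : (0 < s)%N ->
  0 <= p <= 1 -> 0 <= q <= 1 ->
  (1 - (2 * s)%:R * q) * Ex p F (fun S => (two_big s S)%:R) <=
  Ex p F (fun S => Ex (1 - q) S (fun S' =>
    [exists x in bigset s S', exists z in bigset s S', ~~ connect (sub_adj S) x z]%:R)).
Proof.
move=> s0 p01 q01; have /andP[q0 q1] := q01.
have q01' : 0 <= 1 - q <= 1 by rewrite subr_ge0 q1 gerBl.
rewrite -wsumZ; apply: Ex_le => // S _.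
case: (boolP (two_big s S)) => [|_]; last by rewrite mulr0; apply: Ex_ge0.
move=> /existsP[x /existsP[z /and3P[xs zs xz]]]; rewrite mulr1.
have [T1 [T1S cT1 T1s]] := small_witness s0 xs.
have [T2 [T2S cT2 T2s]] := small_witness s0 zs.
have TS : T1 :|: T2 \subset S by rewrite subUset T1S.
apply: le_trans (_ : Ex (1 - q) S (fun S' => (T1 :|: T2 \subset S')%:R) <= _); last first.
  apply: Ex_le => // S' S'S; case: (boolP (_ \subset _)) => // sub.
  rewrite (_ : [exists _ in _, _]) //; apply/exists_inP; exists x.
    rewrite inE; apply: leq_trans T1s _; apply: subset_leq_card; apply: comp_sub.
    exact: subset_trans (subsetUl _ _) sub.
  apply/exists_inP; exists z => //.
  rewrite inE; apply: leq_trans T2s _; apply: subset_leq_card; apply: comp_sub.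
  exact: subset_trans (subsetUr _ _) sub.
rewrite Ex_sub //.
have cT : (#|T1 :|: T2| <= 2 * s)%N.
  by apply: leq_trans (leq_card_setU _ _) _; rewrite mul2n -addnn leq_add.
have /andP[q0' q1'] := q01'.
apply: le_trans (_ : (1 - q) ^+ (2 * s) <= _); last by rewrite ler_wiXn2l.
(* Bernoulli's inequality. *)
elim: (2 * s)%N => [|k IH]; first by rewrite mul0r subr0 expr0.
rewrite exprS; apply: le_trans (ler_wpM2l q0' IH).
rewrite -subr_ge0 (_ : _ - _ = k%:R * q ^+ 2); first by rewrite mulr_ge0 ?sqr_ge0.
by rewrite -[k.+1]addn1 natrD; ring.
Qed.

Section MergeRound.
Variables (h : rel V) (D M : nat).
Hypothesis hsym : symmetric h.
Hypothesis hirr : irreflexive h.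
Hypothesis hD : forall x, (#|nbrs h x| <= D)%N.
Hypothesis hexp : forall A : {set V}, (#|A| * #|~: A| <= M * #|inner_boundary h A| * #|V|)%N.

Definition gap_fails s L S := [exists v, (s <= #|comp S v| < L)%N].
Definition sparse_at s S v := ~~ [exists w, (s <= #|comp S w|)%N && near2 h v w].

(** [thinning_sprinkling] swaps the order of revelation. If the thinned graph has the gap and no
    sparse vertex, [merge_prob] applies; all other thinned graphs are charged in full. *)
Lemma two_big_prob (R : realFieldType) (p q r : R) s L0 : (0 < s)%N -> (0 < M)%N ->
  0 <= p <= 1 -> 0 <= q <= 1 -> 0 <= r <= 1 ->
  (1 - p * (1 - q)) * r = p * q ->
  (1 - (2 * s)%:R * q) * Ex p (edges h) (fun S => (two_big s S)%:R) <=
  Ex (p * (1 - q)) (edges h) (fun S => (gap_fails s (L0 * (2 * M * D.+1 ^ 6)) S)%:R)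
  + (\sum_v Ex (p * (1 - q)) (edges h) (fun S => (sparse_at s S v)%:R)
  + ((1 + (1 - r ^+ 5) ^+ L0) ^+ #|V| - 1)).
Proof.
move=> s0 M0 p01 q01 r01 hr.
have /andP[q0 q1] := q01; have /andP[p0 p1] := p01; have /andP[r0 r1] := r01.
have p01' : 0 <= p * (1 - q) <= 1.
  by rewrite mulr_ge0 ?subr_ge0 // mulr_ile1 ?subr_ge0 // gerBl.
have mu0 : 0 <= (1 + (1 - r ^+ 5) ^+ L0) ^+ #|V| - 1.
  by rewrite subr_ge0 exprn_ege1 // lerDl exprn_ge0 // subr_ge0 exprn_ile1.
apply: le_trans (two_big_coupling (edges h) s0 p01 q01) _.
rewrite (thinning_sprinkling _ (fun S' S => [exists x in bigset s S', exists z in bigset s S',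
  ~~ connect (sub_adj S) x z]%:R) hr).
set mu := _ - 1 in mu0 *.
apply: le_trans (_ : Ex (p * (1 - q)) (edges h) (fun S' =>
   (gap_fails s (L0 * (2 * M * D.+1 ^ 6)) S')%:R
   + (\sum_v (sparse_at s S' v)%:R + mu)) <= _); last first.
  by rewrite /Ex wsumD wsumD wsum_sum [X in _ + (_ + X)]Ex_cst.
apply: Ex_le => // S' S'E.
set L := (L0 * _)%N.
have MD0 : (0 < 2 * M * D.+1 ^ 6)%N by rewrite muln_gt0 muln_gt0 M0 expn_gt0.
have le1 : Ex r (edges h :\: S') (fun T => [exists x in bigset s S', exists z in bigset s S',
    ~~ connect (sub_adj (S' :|: T)) x z]%:R) <= 1 by apply: Ex_le1.
case: (boolP (gap_fails s L S')) => [_|/existsPn ngap].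
  by apply: le_trans le1 _; rewrite lerDl addr_ge0 // sumr_ge0.
case: (boolP [exists v, sparse_at s S' v]) => [/existsP[v vs]|/existsPn dense].
  apply: le_trans le1 _; rewrite add0r (bigD1 v) //= vs -addrA lerDl addr_ge0 //.
  exact: sumr_ge0.
apply: le_trans (_ : mu <= _); last first.
  by rewrite add0r lerDr sumr_ge0.
apply: (merge_prob hsym hirr hD hexp) => //.
- move=> x; rewrite inE => xs; have := ngap x; rewrite xs /= -leqNgt; exact.
- move=> x; have := dense x; rewrite negbK => /existsP[w /andP[ws xw]].
  by exists w => //; rewrite inE.
Qed.

End MergeRound.
End Components.

(** * Density of large components *)

Section Density.
Variables (t : nat) (Gs : 'I_t -> graph) (dg : 'I_t -> nat) (Cn : nat).
Hypothesis Gsimple : forall i, simple_graph (Gs i).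
Hypothesis Gconn : forall i, connected_graph (Gs i).
Hypothesis Greg : forall i, regular_of_degree (Gs i) (dg i).
Hypothesis G2 : forall i, (2 <= gsize (Gs i))%N.
Hypothesis GC : forall i, (gsize (Gs i) <= Cn)%N.

Local Notation V := (cvert Gs).
Local Notation E := (edges (@cadj t Gs)).

Lemma edges_restrict_sub (Q : {set V}) : edges (restrict (@cadj t Gs) Q) \subset E.
Proof.
by apply/subsetP => e; rewrite !in_set => /andP[/andP[-> _] ->].
Qed.

Lemma edges_restrict_mem (Q : {set V}) e : e \in edges (restrict (@cadj t Gs) Q) -> e.1 \in Q.
Proof. by rewrite in_set => /andP[/and3P[]]. Qed.

(* The slices of the pairs [Y] in [J] are disjoint, so the trials are independent. *)
Lemma sparse_prob (R : realFieldType) (p b : R) s (J : {set 'I_t}) (v : V) : 0 <= p <= 1 ->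
  (forall Y : {set 'I_t}, Y \subset J -> #|Y| = 2%N ->
    Ex p (edges (restrict (@cadj t Gs) (slice J v Y)))
      (fun S => (#|comp S (flip v Y)| < s)%N%:R) <= b) ->
  Ex p E (fun S => (sparse_at (@cadj t Gs) s S v)%:R) <= b ^+ 'C(#|J|, 2).
Proof.
move=> p01 hb.
pose YY := [set Y : {set 'I_t} | Y \subset J & #|Y| == 2%N].
pose EY (Y : {set 'I_t}) := edges (restrict (@cadj t Gs) (slice J v Y)).
pose f (Y : {set 'I_t}) (T : {set V * V}) : R := (#|comp T (flip v Y)| < s)%N%:R.
apply: le_trans (_ : Ex p E (fun S => \prod_(Y in YY) f Y (S :&: EY Y)) <= _).
  apply: Ex_le => // S SE; case: (boolP (sparse_at _ _ _ _)) => [/existsPn H|_]; last first.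
    by apply: prodr_ge0 => Y _; rewrite /f.
  rewrite big1 // => Y; rewrite in_set => /andP[YJ /eqP Y2]; rewrite /f.
  case: ltnP => // le; have /negP[] := H (flip v Y); apply/andP; split.
    by apply: leq_trans le _; apply: subset_leq_card; apply: comp_sub; apply: subsetIl.
  have [z vz zf] := flip_near Gconn G2 v Y2.
  by apply/existsP; exists z; rewrite /rel1 vz zf !orbT.
rewrite Ex_prod_disjoint; first last.
- move=> Y Y'; rewrite !in_set => /andP[YJ _] /andP[Y'J _] neq.
  have dis := slice_disjoint Gsimple Gconn G2 v YJ Y'J neq.
  rewrite -setI_eq0; apply/eqP/setP => e; rewrite in_set0 in_setI; apply/negbTE/negP.
  move=> /andP[/edges_restrict_mem e1 /edges_restrict_mem e2].
  by rewrite (disjointFr dis e1) in e2.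
- by move=> Y _; apply: edges_restrict_sub.
rewrite -(cards_draws J 2) -prodr_const; apply: ler_prod => Y; rewrite in_set => /andP[YJ /eqP Y2].
apply/andP; split; first by apply: Ex_ge0 => // S _; rewrite /f.
exact: hb.
Qed.

End Density.

(** * Component sizes in a slice *)

Section Rate.
Variable R : realType.
Implicit Types (l p : R).

(** The exponential decay rate of the total progeny of a Poisson branching process with mean [l]. *)
Definition rate l := l * expR (- (l - 1)).

Lemma rate_ge0 l : 1 < l -> 0 <= rate l.
Proof. by move=> l1; rewrite mulr_ge0 ?expR_ge0 //; lra. Qed.

Lemma rate_lt1 l : 1 < l -> rate l < 1.
Proof.
move=> l1; rewrite /rate expRN ltr_pdivrMr ?expR_gt0 // mul1r.
have := @expR_gt1Dx R (l - 1); rewrite (_ : 1 + (l - 1) = l); last by ring.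
by apply; lra.
Qed.

(* [(1 - p) (1 - x)^-1 <= 1 - p a] for [x = p (1 - a)], and [expR x <= (1 - x)^-1]. *)
Lemma tilt_le1 (p a : R) : 0 <= p < 1 -> 0 <= a <= 1 ->
  p * a + (1 - p) * expR (p * (1 - a)) <= 1.
Proof.
move=> /andP[p0 p1] /andP[a0 a1]; set x := p * (1 - a).
have x1 : x < 1 by rewrite /x; nra.
have ex : (1 - x) * expR x <= 1.
  have := expR_ge1Dx (- x); rewrite expRN => H.
  by have := ler_wpM2r (expR_ge0 x) H; rewrite mulVf ?gt_eqF ?expR_gt0.
have H : 1 - p <= (1 - p * a) * (1 - x).
  rewrite -subr_ge0 (_ : _ - _ = p ^+ 2 * (a * (1 - a))); last by rewrite /x; ring.
  by rewrite mulr_ge0 ?sqr_ge0 // mulr_ge0 // subr_ge0.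
have := ler_wpM2r (expR_ge0 x) H.
have pa : 0 <= 1 - p * a by nra.
have := ler_wpM2l pa ex; rewrite mulrA => H1 H2.
lra.
Qed.

End Rate.

Section HostEstimates.
Variables (R : realType) (t : nat) (Gs : 'I_t -> graph) (dg : 'I_t -> nat) (Cn : nat).
Hypothesis Gsimple : forall i, simple_graph (Gs i).
Hypothesis Gconn : forall i, connected_graph (Gs i).
Hypothesis Greg : forall i, regular_of_degree (Gs i) (dg i).
Hypothesis G2 : forall i, (2 <= gsize (Gs i))%N.
Hypothesis GC : forall i, (gsize (Gs i) <= Cn)%N.

Local Notation V := (cvert Gs).
Variables (Q : {set V}) (d0 m L : nat).
Local Notation h := (restrict (@cadj t Gs) Q).
Hypothesis hdeg : forall x, x \in Q -> (d0 <= #|nbrs h x|)%N.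
Hypothesis m2 : (2 * m <= d0)%N.
Hypothesis hL : (Cn * trunc_log 2 L <= m)%N.

Let hsym : symmetric h := restrict_sym Gsimple Q.
Let hirr : irreflexive h := restrict_irr Gsimple Q.

Let hQ (u v : V) : h u v -> v \in Q.
Proof. by case/and3P. Qed.

Variables (p l : R).
Hypothesis p01 : 0 <= p < 1.
Hypothesis l1 : 1 < l.
Hypothesis hl : l <= p * (d0 - 2 * m)%:R.

Let p01' : 0 <= p <= 1.
Proof. by have /andP[-> /ltW ->] := p01. Qed.

(** [hL] turns isoperimetry into at least [k * (d0 - 2 * m)] boundary edges. The tilt [a = l^-1] is
    the one that optimises [gap_bound] at mean offspring [l]. *)
Lemma comp_card_prob v k : v \in Q -> (0 < k <= L)%N ->
  Ex p (edges h) (fun S => (#|comp S v| == k)%:R) <= rate l ^+ k.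
Proof.
move=> vQ /andP[k0 kL].
have l0 : 0 < l by apply: lt_trans l1.
have a1 : 0 <= l^-1 <= 1 by rewrite invr_ge0 ltW //= invf_le1 // ltW.
have /andP[p0 p1] := p01.
set b := expR (p * (1 - l^-1)).
have la : 0 <= 1 - l^-1 by rewrite subr_ge0; have /andP[] := a1.
have b1 : 1 <= b by rewrite /b -[leLHS](expR0 R) ler_expR mulr_ge0.
have iso (X : {set V}) : #|X| = k -> X \subset Q -> (k * (d0 - 2 * m) <= #|crossing (edges h) X|)%N.
  move=> cX XQ; have := restrict_boundary Gsimple Greg G2 GC hdeg XQ; rewrite cX => H.
  rewrite mulnBr leq_subLR; apply: leq_trans H _; rewrite addnC leq_add2r.
  have le : (Cn * trunc_log 2 k <= m)%N.
    by apply: leq_trans hL; rewrite leq_mul2l leq_trunc_log ?orbT.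
  apply: leq_trans (_ : 2 * k * (Cn * trunc_log 2 k) <= _)%N; first by apply: eq_leq; ring.
  by apply: leq_trans (leq_mul (leqnn _) le) _; apply: eq_leq; ring.
have := gap_bound hsym hirr hQ p01' (proj1 (andP a1)) b1 (tilt_le1 p01 a1) vQ iso.
set P := Ex _ _ _; have P0 : 0 <= P by apply: Ex_ge0.
move=> H.
have bk : expR (k%:R * (l - 1)) <= b ^+ (k * (d0 - 2 * m)).
  rewrite /b -expRM_natl ler_expR natrM -mulrA ler_wpM2l //.
  rewrite (_ : l - 1 = l * (1 - l^-1)); last by rewrite mulrBr mulr1 divff ?gt_eqF.
  by rewrite mulrCA mulrA ler_wpM2r // [_%:R * _]mulrC.
have lk : 0 <= l^-1 ^+ k.-1 by rewrite exprn_ge0 // invr_ge0 ltW.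
have H1 : l^-1 ^+ k.-1 * expR (k%:R * (l - 1)) * P <= 1.
  by apply: le_trans H; rewrite ler_wpM2r // ler_wpM2l.
rewrite /rate exprMn -expRM_natl mulrN expRN ler_pdivlMr ?expR_gt0 //.
have lp : 0 < l ^+ k.-1 by rewrite exprn_gt0.
have := ler_wpM2l (ltW lp) H1; rewrite mulr1 !mulrA exprVn divff ?gt_eqF // mul1r mulrC => H2.
apply: le_trans H2 _; apply: ler_weXn2l; [exact: ltW|exact: leq_pred].
Qed.

Lemma comp_range_prob v k0 : v \in Q -> (0 < k0)%N ->
  Ex p (edges h) (fun S => (k0 <= #|comp S v| < L)%N%:R) <= L%:R * rate l ^+ k0.
Proof.
move=> vQ k00; have g0 := rate_ge0 l1; have g1 := ltW (rate_lt1 l1).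
apply: le_trans (_ : \sum_(k < L | (k0 <= k)%N)
    Ex p (edges h) (fun S => (#|comp S v| == k)%:R) <= _).
  rewrite -Ex_bigsum; apply: Ex_le => // S _.
  case: (boolP (_ <= _ < _)%N) => [/andP[kc cL]|_]; last exact: sumr_ge0.
  by rewrite (bigD1 (Ordinal cL)) //= eqxx lerDl sumr_ge0.
apply: le_trans (_ : \sum_(k < L) rate l ^+ k0 <= _); last by rewrite sumr_const card_ord mulr_natl.
rewrite big_mkcond; apply: ler_sum => k _; case: ifP => [kk|_]; last exact: exprn_ge0.
apply: le_trans (comp_card_prob vQ _) _; first by rewrite (leq_trans k00 kk) ltnW.
by rewrite ler_wiXn2l.
Qed.

(** The branching comparison reaches only [m] vertices, at most half the degree. A component that
    reaches [m] but not [s] has its order between [m] and [L], which the gap estimate makes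
    unlikely. *)
Lemma comp_big_prob v y s : v \in Q -> 0 <= y <= 1 -> (0 < m)%N -> (s <= L)%N ->
  (1 - p * y) ^+ (d0 - 2 * m) <= 1 - y ->
  y - L%:R * rate l ^+ m <= Ex p (edges h) (fun S => (s <= #|comp S v|)%N%:R).
Proof.
move=> vQ y01 m0 sL hy; rewrite lerBlDr.
have hd x : x \in Q -> (d0 <= #|nbrs h x| <= #|V|)%N by move=> xQ; rewrite hdeg // max_card.
apply: le_trans (big_comp_lower hsym hirr hQ hd p01' y01 m2 hy vQ) _.
apply: le_trans (lerD (lexx _) (comp_range_prob vQ m0)).
rewrite -wsumD; apply: Ex_le => // S _.
case: (leqP m) => [mc|_]; last by rewrite addr_ge0.
case: (leqP s) => [sc|cs]; first by rewrite lerDl.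
by rewrite add0r (leq_trans cs sL).
Qed.

End HostEstimates.

(** * Exponential estimates *)

Section Calculus.
Variable R : realType.
Implicit Types (a b c k l x y z : R).

(** The tangent at [k * z] is evaluated at 0 and at [z]; in the combination with weights [1 - k] and
    [k] the linear terms cancel. *)
Lemma expR_strict_convex z k : z != 0 -> 0 < k < 1 ->
  expR (k * z) < (1 - k) + k * expR z.
Proof.
move=> z0 /andP[k0 k1]; have e0 := expR_gt0 (k * z).
have H1 : expR (k * z) * (1 - k * z) < 1.
  rewrite [ltRHS](_ : _ = expR (k * z) * expR (- (k * z))); last first.
    by rewrite -expRD subrr expR0.
  rewrite ltr_pM2l //.
  by apply: expR_gt1Dx; rewrite oppr_eq0 mulf_neq0 // gt_eqF.
have H2 : expR (k * z) * (1 + (1 - k) * z) < expR z.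
  rewrite [ltRHS](_ : _ = expR (k * z) * expR ((1 - k) * z)); last first.
    by rewrite -expRD; congr expR; ring.
  rewrite ltr_pM2l //; apply: expR_gt1Dx.
  by rewrite mulf_neq0 // subr_eq0 gt_eqF.
have k1' : 0 < 1 - k by rewrite subr_gt0.
have := ltr_pM2l k1' (expR (k * z) * (1 - k * z)) 1; rewrite H1 => /idP H3.
have := ltr_pM2l k0 (expR (k * z) * (1 + (1 - k) * z)) (expR z); rewrite H2 => /idP H4.
rewrite [ltLHS](_ : _ = (1 - k) * (expR (k * z) * (1 - k * z)) +
  k * (expR (k * z) * (1 + (1 - k) * z))); last by ring.
by rewrite mulr1 in H3; apply: ltrD.
Qed.

Section Survival.
Variables l y : R.
Hypothesis l0 : 0 < l.
Hypothesis y01 : 0 < y < 1.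
Hypothesis hy : y = 1 - expR (- (l * y)).

Let ly0 : - (l * y) != 0.
Proof. by rewrite oppr_eq0 mulf_neq0 ?gt_eqF //; have /andP[] := y01. Qed.

(** The survival map [1 - expR (- (l * x))] is strictly concave and vanishes at 0, so it lies above
    the diagonal before the fixpoint [y] and below it afterwards. The strictness is the slack that
    absorbs all lower-order losses. *)
Lemma expR_below_fixpoint k : 0 < k < 1 -> expR (- (l * (k * y))) < 1 - k * y.
Proof.
move=> k01; have := expR_strict_convex ly0 k01.
have -> : expR (- (l * y)) = 1 - y by rewrite [in RHS]hy; ring.
rewrite (_ : k * - (l * y) = - (l * (k * y))); last by ring.
by rewrite (_ : 1 - k + k * (1 - y) = 1 - k * y); last by ring.
Qed.

Lemma expR_above_fixpoint k : 1 < k -> 1 - k * y < expR (- (l * (k * y))).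
Proof.
move=> k1; have k0 : 0 < k by apply: lt_trans k1.
have z0 : - (l * (k * y)) != 0.
  by rewrite mulrCA -mulrN mulf_neq0 // gt_eqF.
(* Convexity is used on the segment up to [k * y] with weight [k^-1], so that the interior point is
   [y], where equality is known. *)
have k01 : 0 < k^-1 < 1 by rewrite invr_gt0 k0 invf_lt1.
have := expR_strict_convex z0 k01.
rewrite (_ : k^-1 * - (l * (k * y)) = - (l * y)); last by field; rewrite gt_eqF.
have -> : expR (- (l * y)) = 1 - y by rewrite [in RHS]hy; ring.
set e := expR _ => H; have := ltr_pM2l k0 (1 - y) (1 - k^-1 + k^-1 * e); rewrite H => /idP H'.
rewrite (_ : k * (1 - k^-1 + k^-1 * e) = k - 1 + e) in H'; last by field; rewrite gt_eqF.
lra.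
Qed.

End Survival.

Lemma expR_slack a b : 0 < a -> a < b -> exists2 x : R, 0 < x & a * expR x <= b.
Proof.
move=> a0 ab; exists (ln (b / a)).
  by rewrite ln_gt0 // ltr_pdivlMr // mul1r.
have b0 : 0 < b by apply: lt_trans ab.
by rewrite lnK ?posrE ?divr_gt0 // mulrC divfK ?gt_eqF.
Qed.

Lemma onesub_expR_ge x : 0 <= x < 1 -> expR (- (x / (1 - x))) <= 1 - x.
Proof.
move=> /andP[x0 x1]; have x1' : 0 < 1 - x by rewrite subr_gt0.
rewrite expRN invf_ple ?posrE ?expR_gt0 //.
apply: le_trans (expR_ge1Dx _).
by rewrite le_eqVlt; apply/orP; left; apply/eqP; field; rewrite gt_eqF.
Qed.

Lemma onesub_expn_le x n : 0 <= x <= 1 -> (1 - x) ^+ n <= expR (- (n%:R * x)).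
Proof.
move=> /andP[x0 x1]; rewrite -mulrN expRM_natl lerXn2r ?nnegrE ?subr_ge0 ?expR_ge0 //.
exact: expR_ge1Dx.
Qed.

Lemma exp_decay a c (k : nat) : 0 < a < 1 -> 0 < c ->
  exists N : nat, forall n : nat, (N <= n)%N -> n.+1%:R ^+ k * a ^+ n <= c.
Proof.
move=> /andP[a0 a1] c0; set al := - ln a.
have al0 : 0 < al by rewrite oppr_gt0 ln_lt0 // a0.
have ae : a = expR (- al) by rewrite opprK lnK.
(* The Taylor term of degree [k.+1] leaves one factor [n.+1] to spare; [expR al] pays for the shift
   from [n] to [n.+1]. *)
pose A := k.+1`!%:R * expR al / al ^+ k.+1.
exists (Num.truncn (A / c)) => n Nn.
have An : A <= c * n.+1%:R.
  rewrite mulrC -ler_pdivrMr //; apply/ltW/(lt_le_trans (truncnS_gt _)).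
  by rewrite ler_nat.
have n0 : 0 < n.+1%:R :> R by rewrite ltr0n.
have H := @expR_ge1Dxn R (al * n.+1%:R) k (mulr_ge0 (ltW al0) (ltW n0)).
have f0 : 0 < k.+1`!%:R :> R by rewrite ltr0n fact_gt0.
have {}H : (al * n.+1%:R) ^+ k.+1 <= expR (al * n.+1%:R) * k.+1`!%:R.
  by rewrite -ler_pdivrMr //; apply: le_trans H; rewrite lerDr.
have -> : a ^+ n = expR al / expR (al * n.+1%:R).
  rewrite -expRN -expRD ae -expRM_natl -natr1; congr expR; ring.
rewrite mulrA ler_pdivrMr ?expR_gt0 //.
have alk : 0 < al ^+ k.+1 by rewrite exprn_gt0.
rewrite -(ler_pM2l alk) -(ler_pM2r n0).
apply: le_trans (_ : expR al * (expR (al * n.+1%:R) * k.+1`!%:R) <= _).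
  rewrite [leLHS](_ : _ = expR al * (al * n.+1%:R) ^+ k.+1).
    by rewrite ler_wpM2l ?expR_ge0.
  by rewrite exprMn !exprS; ring.
rewrite [leLHS](_ : _ = (al ^+ k.+1 * A) * expR (al * n.+1%:R)); last first.
  by rewrite /A; field; rewrite gt_eqF.
rewrite [leRHS](_ : _ = al ^+ k.+1 * (c * n.+1%:R) * expR (al * n.+1%:R)); last by ring.
by rewrite ler_wpM2r ?expR_ge0 // ler_wpM2l // ltW.
Qed.

Lemma exp_decay_div a c (k B : nat) : 0 < a < 1 -> 0 < c -> (0 < B)%N ->
  exists N : nat, forall n : nat, (N <= n)%N -> n%:R ^+ k * a ^+ (n %/ B) <= c.
Proof.
move=> a01 c0 B0; have Bk : 0 < B%:R ^+ k :> R by rewrite exprn_gt0 // ltr0n.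
have [N HN] := exp_decay k a01 (divr_gt0 c0 Bk).
exists (N * B)%N => n Nn.
have := HN (n %/ B)%N; rewrite leq_divRL // => /(_ Nn).
rewrite ler_pdivlMr // => H; apply: le_trans H; rewrite mulrAC -exprMn -natrM.
apply: ler_wpM2r; first by rewrite exprn_ge0 // ltW; have /andP[] := a01.
rewrite lerXn2r ?nnegrE // ler_nat; have := ltn_ceil n B0; exact: ltnW.
Qed.

Lemma onedadd_expn_le x n : 0 <= x -> n%:R * x <= 2^-1 -> (1 + x) ^+ n - 1 <= 2 * (n%:R * x).
Proof.
move=> x0 hx; set z := n%:R * x in hx *.
have z0 : 0 <= z by rewrite mulr_ge0.
have H1 : (1 + x) ^+ n <= expR z.
  by rewrite /z expRM_natl lerXn2r ?nnegrE ?expR_ge0 ?addr_ge0 // expR_ge1Dx.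
have H2 : expR z * (1 - z) <= 1.
  have := expR_ge1Dx (- z); rewrite expRN => H.
  by have := ler_wpM2l (expR_ge0 z) H; rewrite mulfV ?gt_eqF ?expR_gt0.
have := expR_ge0 z; set e := expR z in H1 H2 * => e0.
have e2 : e <= 2 by nra.
nra.
Qed.

Lemma exp_pow_lt a c : 0 <= a < 1 -> 0 < c -> exists n : nat, (0 < n)%N /\ a ^+ n <= c.
Proof.
move=> /andP[a0 a1] c0; have [a0'|] := ltrP 0 a; last first.
  by move=> a0'; exists 1%N; rewrite expr1; split=> //; apply: le_trans a0' (ltW c0).
have [|N HN] := exp_decay 0 (a := a) (c := c) _ c0; first by rewrite a0'.
exists N.+1; split=> //; have := HN N.+1 (leqnSn _); by rewrite expr0 mul1r.
Qed.

End Calculus.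

(** * Bounds at a fixed dimension *)

Lemma prob_GpE (R : realType) (V : finType) (e : rel V) (p : R) (A : pred {set V * V}) :
  prob_Gp e p A = Ex p (edges e) (fun S => (A S)%:R).
Proof.
rewrite /prob_Gp /Ex /wsum big_mkcondr /=; apply: eq_bigr => S _.
by case: (A S); rewrite ?mulr1 ?mulr0.
Qed.

Section FiniteBounds.
Variables (R : realType) (t : nat) (Gs : 'I_t -> graph) (dg : 'I_t -> nat) (Cn : nat).
Hypothesis Gsimple : forall i, simple_graph (Gs i).
Hypothesis Gconn : forall i, connected_graph (Gs i).
Hypothesis Greg : forall i, regular_of_degree (Gs i) (dg i).
Hypothesis G2 : forall i, (2 <= gsize (Gs i))%N.
Hypothesis GC : forall i, (gsize (Gs i) <= Cn)%N.

Local Notation V := (cvert Gs).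
Local Notation E := (edges (@cadj t Gs)).
Local Notation d := (\sum_(i < t) dg i)%N.
Implicit Types (v : V) (p q y w rho l : R).

Lemma edges_restrictT : edges (restrict (@cadj t Gs) [set: V]) = E.
Proof. by apply/setP => e; rewrite !in_set /restrict !in_setT !andbT. Qed.

Lemma deg_restrictT (x : V) : #|nbrs (restrict (@cadj t Gs) [set: V]) x| = d.
Proof.
rewrite -(card_nbrs Gsimple Greg x); apply: eq_card => w.
by rewrite !in_set /restrict !in_setT !andbT.
Qed.

Section Sprinkling.
Variables (p q r y l : R) (s m L0 : nat) (J : {set 'I_t}).
Let d0 := (d - Cn * #|J|)%N.
Let L := (L0 * (2 * (t * Cn) * d.+1 ^ 6))%N.
Hypothesis p01 : 0 <= p < 1.
Hypothesis q01 : 0 <= q <= 1.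
Hypothesis r01 : 0 <= r <= 1.
Hypothesis hr : (1 - p * (1 - q)) * r = p * q.
Hypothesis m2 : (2 * m <= d0)%N.
Hypothesis m0 : (0 < m)%N.
Hypothesis hL : (Cn * trunc_log 2 L <= m)%N.
Hypothesis l1 : 1 < l.
Hypothesis hl : l <= p * (1 - q) * (d0 - 2 * m)%:R.
Hypothesis y01 : 0 <= y <= 1.
Hypothesis hy : (1 - p * (1 - q) * y) ^+ (d0 - 2 * m) <= 1 - y.
Hypothesis s0 : (0 < s)%N.
Hypothesis sL : (s <= L)%N.
Hypothesis t0 : (0 < t * Cn)%N.

Lemma thinned01 : 0 <= p * (1 - q) < 1.
Proof.
have /andP[p0 p1] := p01; have /andP[q0 q1] := q01.
rewrite mulr_ge0 ?subr_ge0 //; apply: le_lt_trans p1.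
by rewrite ler_piMr // gerBl.
Qed.

(** The three terms are a failed gap, a vertex far from every big component, and a failed merging.
    The parameters refer to the slice degree [d0]; the whole product has degree at least [d0], so
    they serve for both hosts. *)
Lemma two_big_bound :
  (1 - (2 * s)%:R * q) * Ex p E (fun S => (two_big s S)%:R) <=
  #|V|%:R * (L%:R * rate l ^+ s)
  + (#|V|%:R * (1 - (y - L%:R * rate l ^+ m)) ^+ 'C(#|J|, 2)
  + ((1 + (1 - r ^+ 5) ^+ L0) ^+ #|V| - 1)).
Proof.
have p'01 := thinned01; have p'01' : 0 <= p * (1 - q) <= 1.
  by have /andP[-> /ltW ->] := p'01.
have p01' : 0 <= p <= 1 by have /andP[-> /ltW ->] := p01.
have hD x : (#|nbrs (@cadj t Gs) x| <= d)%N by rewrite (card_nbrs Gsimple Greg).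
have hexp (A : {set V}) : (#|A| * #|~: A| <= t * Cn * #|inner_boundary (@cadj t Gs) A| * #|V|)%N.
  apply: leq_trans (expansion Gconn GC A) _; rewrite -!mulnA leq_mul2l; apply/orP; right.
  by rewrite mulnCA leq_mul2l; apply/orP; right; rewrite leq_mul2r; apply/orP; right; apply: subset_leq_card.
apply: le_trans (two_big_prob (cadj_sym Gsimple) (cadj_irr Gsimple) hD hexp L0 s0 t0 p01' q01 r01 hr) _.
have degT x : x \in [set: V] -> (d0 <= #|nbrs (restrict (@cadj t Gs) [set: V]) x|)%N.
  by move=> _; rewrite deg_restrictT leq_subr.
apply: lerD.
  apply: le_trans (_ : \sum_v Ex (p * (1 - q)) E (fun S => (s <= #|comp S v| < L)%N%:R) <= _).
    rewrite -Ex_bigsum; apply: Ex_le => // S _; rewrite /gap_fails.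
    case: (boolP [exists v, _]) => [/existsP[v hv]|_]; last exact: sumr_ge0.
    by rewrite (bigD1 v) //= -/L in hv *; rewrite hv lerDl sumr_ge0.
  rewrite mulr_natl -sumr_const; apply: ler_sum => v _; rewrite -edges_restrictT.
  exact: (comp_range_prob Gsimple Greg G2 GC degT hL p'01 l1 hl).
rewrite lerD2r mulr_natl -sumr_const; apply: ler_sum => v _.
apply: (sparse_prob Gsimple Gconn G2) => // Y YJ Y2.
have degY x : x \in slice J v Y -> (d0 <= #|nbrs (restrict (@cadj t Gs) (slice J v Y)) x|)%N.
  by move=> xQ; rewrite leq_subLR addnC (slice_deg Gsimple Greg G2 GC).
have := comp_big_prob Gsimple Greg G2 GC degY m2 hL p'01 l1 hl (flip_slice J v Y) y01 m0 sL hy.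
set E1 := Ex _ _ _; set E2 := Ex _ _ _ => H.
have : E1 + E2 = 1.
  rewrite /E1 /E2 -wsumD -[RHS](Ex_cst (p * (1 - q)) (edges (restrict (@cadj t Gs) (slice J v Y)))).
  by apply: eq_wsum => S _; case: ltnP; rewrite ?addr0 ?add0r.
by move=> HE; move: H; set g := _ * _; lra.
Qed.

Lemma vertex_lower v : y - L%:R * rate l ^+ m <= Ex p E (fun S => (s <= #|comp S v|)%N%:R).
Proof.
have degT x : x \in [set: V] -> (d0 <= #|nbrs (restrict (@cadj t Gs) [set: V]) x|)%N.
  by move=> _; rewrite deg_restrictT leq_subr.
have /andP[p0 p1] := p01; have /andP[q0 q1] := q01; have /andP[y0 y1] := y01.
have pp : p * (1 - q) <= p by rewrite ler_piMr // gerBl.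
have hl' : l <= p * (d0 - 2 * m)%:R by apply: le_trans hl _; rewrite ler_wpM2r.
have hy' : (1 - p * y) ^+ (d0 - 2 * m) <= 1 - y.
  have a1 : p * (1 - q) * y <= p * y by rewrite ler_wpM2r.
  have a2 : p * y <= 1 by rewrite mulr_ile1 // ltW.
  by apply: le_trans hy; apply: lerXn2r; rewrite ?nnegrE; lra.
rewrite -edges_restrictT.
exact: (comp_big_prob Gsimple Greg G2 GC degT m2 hL p01 l1 hl' (in_setT v) y01 m0 sL hy').
Qed.

End Sprinkling.

Lemma vertex_upper p y w rho m s v : 0 <= p <= 1 -> 0 <= w -> w <= y -> y <= 1 ->
  0 < rho -> (2 * m <= d)%N -> (m <= s)%N ->
  1 - y <= (1 - p * y) ^+ d ->
  (1 - p * w) ^+ (d - 2 * m) <= rho * (1 - w) ->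
  Ex p E (fun S => (s <= #|comp S v|)%N%:R) <= y + rho ^+ m.-1.
Proof.
move=> p01 w0 wy y1 rho0 m2 ms hy hw.
apply: le_trans (_ : Ex p E (fun S => (m <= #|comp S v|)%N%:R) <= _).
  apply: Ex_le => // S _; case: (leqP s) => // H; by rewrite (leq_trans ms H).
have hd (x : V) : x \in [set: V] -> (d <= #|nbrs (@cadj t Gs) x| <= d)%N.
  by move=> _; rewrite (card_nbrs Gsimple Greg) leqnn.
apply: (big_comp_upper (cadj_sym Gsimple) (cadj_irr Gsimple) _ hd p01 w0 wy y1 rho0 m2 hy hw).
  by move=> *; rewrite in_setT.
by rewrite in_setT.
Qed.

(** Without two big components the big vertices form one component, and every other component has
    fewer than [s] vertices. The relative error [3 * k1] is [2 * k1] for the mean and [k1] for the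
    random deviation. *)
Lemma giant_prob_lower (eps K delta y k1 : R) s :
  let p := (1 + eps) / d%:R in
  let mean := Ex p E (fun S => #|bigset s S|%:R) in
  0 <= p <= 1 -> 0 < y -> 0 < k1 -> 3 * k1 <= delta -> 3 * k1 < 1 ->
  s%:R <= K * d%:R -> (0 < s)%N -> (0 < #|V|)%N ->
  `|mean - y * #|V|%:R| <= 2 * k1 * (y * #|V|%:R) ->
  1 - (Ex p E (fun S => (two_big s S)%:R) +
   Ex p E (fun S => (k1 * (y * #|V|%:R) <= `|#|bigset s S|%:R - mean|)%R%:R))
  <= giant_prob eps K delta y Gs dg.
Proof.
move=> p mean p01 y0 k0 kd k3 sK s0 V0 hm.
rewrite lerBlDl; set ind := fun S : {set V * V} => [exists x : V,
       ((1 - delta) * y * #|V|%:R <= #|comp S x|%:R <= (1 + delta) * y * #|V|%:R) &&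
       [forall z : V, ~~ connect (sub_adj S) x z ==>
          (#|comp S z|%:R <= K * d%:R)]].
have -> : giant_prob eps K delta y Gs dg = Ex p E (fun S => (ind S)%:R).
  exact: prob_GpE.
rewrite -[leLHS](Ex_cst p E 1) -!wsumD; apply: Ex_le => // S _.
case: (boolP (two_big s S)) => [_|/existsPn n2]; first by rewrite -addrA lerDl addr_ge0.
case: (boolP (_ <= `|_|)) => [_|]; first by rewrite add0r lerDl.
rewrite -ltNge => dev; rewrite !add0r.
set X := y * #|V|%:R in hm dev.
have X0 : 0 < X by rewrite mulr_gt0 // ltr0n.
have close : `|#|bigset s S|%:R - X| <= 3 * k1 * X.
  rewrite (_ : _ - X = (#|bigset s S|%:R - mean) + (mean - X)); last by ring.
  apply: le_trans (ler_normD _ _) _; apply: le_trans (lerD (ltW dev) hm) _.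
  by rewrite le_eqVlt; apply/orP; left; apply/eqP; ring.
move: close; rewrite ler_norml => /andP[lo hi].
have kX : 3 * k1 * X <= delta * X by rewrite ler_wpM2r // ltW.
have W0 : (0 < #|bigset s S|)%N.
  rewrite -(ltr0n R); have : 3 * k1 * X < X by rewrite gtr_pMl.
  lra.
have /card_gt0P[x xW] := W0; have xs : (s <= #|comp S x|)%N by rewrite inE in xW.
have CW : comp S x = bigset s S.
  apply/setP => z; rewrite !inE; apply/idP/idP => [xz|zs]; first by rewrite -(comp_eq xz).
  have /existsPn/(_ z) := n2 x; rewrite xs zs /= negbK; exact.
rewrite (_ : ind S) //; apply/existsP; exists x; rewrite CW -!mulrA -/X.
apply/andP; split.
  by apply/andP; split; rewrite ?mulrBl ?mulrDl mul1r; lra.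
apply/forallP => z; apply/implyP => xz; apply: le_trans sK; rewrite ler_nat.
have /existsPn/(_ z) := n2 x; rewrite xs xz andbT /= -ltnNge; exact: ltnW.
Qed.

Lemma deviation_bound p s (a : R) : 0 <= p <= 1 -> 0 <= a ->
  a ^+ 2 * Ex p E (fun S => (a <= `|#|bigset s S|%:R - Ex p E (fun S => #|bigset s S|%:R)|)%R%:R)
   <= #|V|%:R * (d%:R * p) * (2 * s)%:R ^+ 2.
Proof.
move=> p01 a0; have /andP[p0 _] := p01.
have H := @chebyshev R _ p E _ _ a p01 (@bigset_osc _ R s E) a0.
apply: (le_trans H).
have cE : (#|E| <= #|V| * d)%N.
  apply: leq_trans (card_edges_le _) _; rewrite -sum_nat_const; apply: leq_sum => x _.
  by rewrite (card_nbrs Gsimple Greg).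
rewrite mulrA ler_wpM2r ?sqr_ge0 // mulrA ler_wpM2r // -natrM ler_nat.
exact: cE.
Qed.

Lemma mean_bigset p s (lo hi : R) :
  (forall v, lo <= Ex p E (fun S => (s <= #|comp S v|)%N%:R) <= hi) ->
  #|V|%:R * lo <= Ex p E (fun S => #|bigset s S|%:R) <= #|V|%:R * hi.
Proof.
move=> H.
have -> : Ex p E (fun S => #|bigset s S|%:R : R) =
    \sum_v Ex p E (fun S => (s <= #|comp S v|)%N%:R).
  rewrite -Ex_bigsum; apply: eq_wsum => S _.
  by rewrite -sum1dep_card natr_sum big_mkcond /=; apply: eq_bigr => v _; case: ifP.
by rewrite !mulr_natl -!sumr_const; apply/andP; split; apply: ler_sum => v _; have /andP[] := H v.
Qed.

End FiniteBounds.

(** * Choice of the scales *)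

(* [4 Kn d^2] bounds the inverse sprinkling probability, and a path has at most 5
   edges; [merge_rounds] chances leave a failure probability of [exp (- 2 Cn d)]. *)
Definition merge_rounds (Cn Kn d : nat) : nat := (2 * Cn * d * (4 * Kn * d ^ 2) ^ 5)%N.
Definition gap_top (Cn Kn t d : nat) : nat :=
  (merge_rounds Cn Kn d * (2 * (t * Cn) * d.+1 ^ 6))%N.
Definition gap_coef (Cn Kn : nat) : nat := (2 * Cn * (4 * Kn) ^ 5 * (2 * Cn * 2 ^ 6))%N.

(** The exponent is 1 + 10 from the merging rounds, 1 from [t <= d], and 6 from the bound on
    conflicting paths. *)
Lemma gap_top_le Cn Kn t d : (0 < d)%N -> (t <= d)%N ->
  (gap_top Cn Kn t d <= gap_coef Cn Kn * d ^ 18)%N.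
Proof.
move=> d0 td; rewrite /gap_top /merge_rounds /gap_coef.
have -> : (2 * Cn * (4 * Kn) ^ 5 * (2 * Cn * 2 ^ 6) * d ^ 18 =
  2 * Cn * d * (4 * Kn * d ^ 2) ^ 5 * (2 * (d * Cn) * (2 * d) ^ 6))%N.
  ring.
rewrite leq_mul2l; apply/orP; right; apply: leq_mul.
  by rewrite leq_mul2l leq_mul2r td !orbT.
by rewrite leq_exp2r // mul2n -addnn -addn1 leq_add2l.
Qed.

Lemma card_ord_lt (t j : nat) : (j <= t)%N -> #|[set i : 'I_t | (i < j)%N]| = j.
Proof.
by move=> jt; rewrite -sum1dep_card -(big_ord_widen t (fun=> 1%N) jt) sum1_card card_ord.
Qed.

Lemma merge_rounds_ge Cn Kn d : (0 < Cn)%N -> (0 < Kn)%N -> (0 < d)%N ->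
  (Kn * d <= merge_rounds Cn Kn d)%N.
Proof.
move=> C0 K0 d0; rewrite /merge_rounds.
have A : (Kn <= 4 * Kn * d ^ 2)%N.
  by rewrite mulnAC leq_pmull // muln_gt0 expn_gt0 d0.
have B : (Kn <= (4 * Kn * d ^ 2) ^ 5)%N.
  apply: leq_trans A _; rewrite -[leqLHS]expn1 leq_pexp2l //.
  by rewrite !muln_gt0 K0 d0.
by rewrite mulnC leq_mul // leq_pmull // muln_gt0 C0.
Qed.

Section Numerics.
Variable R : realType.
Implicit Types (a b c g : R).

Lemma pow_decay g c (Cn Kn B : nat) : 0 < g < 1 -> 0 < c -> (0 < B)%N ->
  exists T : nat, forall d L : nat, (T <= d)%N -> (L <= gap_coef Cn Kn * d ^ 18)%N ->
    L%:R * g ^+ (d %/ B) <= c.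
Proof.
move=> g01 c0 B0; have K0 : 0 < (gap_coef Cn Kn)%:R + 1 :> R by rewrite ltr_wpDl.
have [T HT] := exp_decay_div 18 g01 (divr_gt0 c0 K0) B0.
exists T => d L /HT; rewrite ler_pdivlMr // => H hL.
have gd : 0 <= g ^+ (d %/ B) by rewrite exprn_ge0 // ltW; have /andP[] := g01.
apply: le_trans H; rewrite mulrAC; apply: ler_wpM2r => //.
apply: le_trans (_ : (gap_coef Cn Kn * d ^ 18)%:R <= _); first by rewrite ler_nat.
by rewrite natrM natrX mulrC ler_wpM2l ?exprn_ge0 // lerDl.
Qed.

(** A polynomial in [d] is eventually below [2 ^ (d %/ (B * Cn))]; this is [pow_decay] with ratio
    one half. *)
Lemma log_small (Cn Kn B : nat) : (0 < Cn)%N -> (0 < B)%N ->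
  exists T : nat, forall d L : nat, (T <= d)%N -> (L <= gap_coef Cn Kn * d ^ 18)%N ->
    (Cn * trunc_log 2 L <= d %/ B)%N.
Proof.
move=> C0 B0; have BC0 : (0 < B * Cn)%N by rewrite muln_gt0 B0.
have h01 : 0 < (2^-1 : R) < 1 by rewrite invr_gt0 ltr0n invf_lt1 // ltr1n.
have [T HT] := pow_decay Cn Kn h01 ltr01 BC0.
exists T => d L Td hL; have := HT d L Td hL; set k := (d %/ (B * Cn))%N.
rewrite exprVn ler_pdivrMr ?exprn_gt0 ?ltr0n // mul1r -natrX ler_nat => Lk.
have : (trunc_log 2 L <= k)%N.
  have [->|L0] := posnP L; first by rewrite trunc_log0.
  by rewrite -(@leq_exp2l 2) //; apply: leq_trans Lk; apply: trunc_logP.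
move=> H; apply: leq_trans (leq_mul (leqnn Cn) H) _.
by rewrite /k divnMA mulnC leq_trunc_div.
Qed.

(** Each factor [g ^+ Kn] beats one factor [Cn] of the vertex count with [2^-1] left over, and the
    resulting [2^-1 ^+ d] beats the polynomial [L]. *)
Lemma range_small g c (Cn Kn : nat) : 0 < g < 1 -> 0 < c -> (0 < Cn)%N ->
  Cn%:R * g ^+ Kn <= 2^-1 ->
  exists T : nat, forall t d n L : nat, (T <= d)%N -> (t <= d)%N -> (n <= Cn ^ t)%N ->
    (L <= gap_coef Cn Kn * d ^ 18)%N -> n%:R * (L%:R * g ^+ (Kn * d)) <= c.
Proof.
move=> g01 c0 C0 hK; have /andP[/ltW g0 _] := g01.
have h01 : 0 < (2^-1 : R) < 1 by rewrite invr_gt0 ltr0n invf_lt1 // ltr1n.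
have [T HT] := pow_decay Cn Kn h01 c0 (ltn0Sn 0).
exists T => t d n L Td td nC hL; apply: le_trans (HT d L Td hL).
rewrite divn1 mulrCA ler_wpM2l //.
apply: le_trans (_ : (Cn%:R * g ^+ Kn) ^+ d <= _).
  rewrite exprMn -exprM ler_wpM2r ?exprn_ge0 // -natrX ler_nat.
  by apply: leq_trans nC _; rewrite leq_pexp2l.
by rewrite lerXn2r ?nnegrE ?mulr_ge0 ?exprn_ge0 // invr_ge0.
Qed.

(** The base may be close to 1, so an exponent linear in [t] with a fixed constant would not do. A
    quadratic exponent eventually exceeds [M * t], where [M] is chosen with
    [Cn * b1 ^ M <= 1 / 2]. *)
Lemma density_small b1 c (Cn B : nat) : 0 < b1 < 1 -> 0 < c -> (0 < Cn)%N -> (0 < B)%N ->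
  exists T : nat, forall (t n : nat) (b : R), (T <= t)%N -> (n <= Cn ^ t)%N -> 0 <= b <= b1 ->
    n%:R * b ^+ 'C(t %/ B, 2) <= c.
Proof.
move=> b01 c0 C0 B0; have /andP[b0 b1'] := b01.
have CR : 0 < Cn%:R :> R by rewrite ltr0n.
have hc : 0 < 2^-1 / Cn%:R :> R by rewrite divr_gt0 // invr_gt0 ltr0n.
have [|M [M0 HM]] := @exp_pow_lt R b1 (2^-1 / Cn%:R) _ hc; first by rewrite ltW.
have h01 : 0 < (2^-1 : R) < 1 by rewrite invr_gt0 ltr0n invf_lt1 // ltr1n.
have [T HT] := exp_decay 0 h01 c0.
exists (T + B * (4 * M * B + 1))%N => t n b Tt nC /andP[bb0 bb].
have jt : (M * t <= 'C(t %/ B, 2))%N.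
  (* With [j = t %/ B] one has [t <= 2 * j * B], so [2 * M * t <= j * (4 * M * B) <= j * j.-1]. *)
  have j1 : (4 * M * B + 1 <= t %/ B)%N.
    by rewrite leq_divRL // mulnC; apply: leq_trans Tt; rewrite leq_addl.
  have tj : (t < (t %/ B).+1 * B)%N := ltn_ceil t B0.
  rewrite bin2; move: j1 tj; set j := (t %/ B)%N => j1 tj.
  have H : (2 * (M * t) <= j * j.-1)%N.
    have e1 : (4 * M * B <= j.-1)%N by move: j1; clear; lia.
    apply: leq_trans (_ : j * (4 * M * B) <= _)%N; last by rewrite leq_mul2l e1 orbT.
    have e2 : (t <= 2 * j * B)%N.
      apply: leq_trans (ltnW tj) _; rewrite leq_mul2r; apply/orP; right.
      by move: j1; clear; lia.
    apply: leq_trans (_ : 2 * (M * (2 * j * B)) <= _)%N; first by rewrite !leq_mul2l e2 !orbT.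
    by apply: eq_leq; ring.
  by rewrite geq_half_double -mul2n.
apply: le_trans (_ : (Cn%:R * b1 ^+ M) ^+ t <= _).
  rewrite exprMn -exprM; apply: ler_pM; rewrite ?exprn_ge0 ?ler0n //.
    by rewrite -natrX ler_nat.
  apply: le_trans (_ : b1 ^+ 'C(t %/ B, 2) <= _).
    by rewrite lerXn2r ?nnegrE // ltW.
  by rewrite ler_wiXn2l // ltW.
apply: le_trans (_ : 2^-1 ^+ t <= _).
  have b1ge := ltW b0; have h := HM; rewrite ler_pdivlMr // mulrC in h.
  by rewrite lerXn2r ?nnegrE ?mulr_ge0 ?exprn_ge0 ?invr_ge0.
have := HT t; rewrite expr0 mul1r; apply; apply: leq_trans Tt; exact: leq_addr.
Qed.

(** The number of rounds is tuned so that the base of the bound is at most [expR (- (2 * Cn)) ^+ d];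
    as [Cn * expR (- (2 * Cn)) <= 1 / 2], even [n] times it is at most [2^-1 ^+ d]. *)
Lemma merge_small c (Cn Kn : nat) : 0 < c -> (0 < Cn)%N -> (0 < Kn)%N ->
  exists T : nat, forall (t d n : nat) (r : R), (T <= d)%N -> (0 < d)%N -> (t <= d)%N ->
    (n <= Cn ^ t)%N -> r <= 1 -> (4 * Kn * d ^ 2)%:R^-1 <= r ->
    (1 + (1 - r ^+ 5) ^+ merge_rounds Cn Kn d) ^+ n - 1 <= c.
Proof.
move=> c0 C0 K0.
have h01 : 0 < (2^-1 : R) < 1 by rewrite invr_gt0 ltr0n invf_lt1 // ltr1n.
have c2 : 0 < c / 2 by rewrite divr_gt0.
have [T HT] := exp_decay 0 h01 c2.
exists T => t d n r Td d0 td nC r1 rK.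
set X := (4 * Kn * d ^ 2)%N in rK; have X0 : (0 < X)%N by rewrite !muln_gt0 K0 d0.
have XR : 0 < X%:R :> R by rewrite ltr0n.
have r0 : 0 <= r by apply: le_trans rK; rewrite invr_ge0.
have r5 : 0 <= r ^+ 5 <= 1 by rewrite exprn_ge0 // exprn_ile1.
set tau := _ ^+ merge_rounds _ _ _.
have tau0 : 0 <= tau by rewrite exprn_ge0 // subr_ge0; have /andP[] := r5.
have tauE : tau <= expR (- ((2 * Cn)%:R)) ^+ d.
  apply: le_trans (onesub_expn_le _ r5) _; rewrite -expRM_natl ler_expR mulrN lerN2.
  have -> : (merge_rounds Cn Kn d)%:R = d%:R * (2 * Cn)%:R * X%:R ^+ 5 :> R.
    by rewrite -natrX -!natrM; congr _%:R; rewrite /merge_rounds -/X; ring.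
  rewrite -mulrA ler_peMr ?mulr_ge0 // -exprMn exprn_ege1 //.
  by rewrite -ler_pdivrMl // mulr1.
have nt : n%:R * tau <= 2^-1 ^+ d.
  apply: le_trans (_ : (Cn%:R * expR (- (2 * Cn)%:R)) ^+ d <= _).
    rewrite exprMn; apply: ler_pM => //.
    by rewrite -natrX ler_nat; apply: leq_trans nC _; rewrite leq_pexp2l.
  rewrite lerXn2r ?nnegrE ?mulr_ge0 ?expR_ge0 ?invr_ge0 //.
  rewrite expRN ler_pdivrMr ?expR_gt0 //.
  rewrite mulrC ler_pdivlMr // mulrC -natrM; apply: le_trans (expR_ge1Dx _).
  by rewrite lerDr.
have n2 : n%:R * tau <= 2^-1.
  apply: le_trans nt _; rewrite -[leRHS]expr1 ler_wiXn2l ?invr_ge0 //.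
  by rewrite invf_le1 // ler1n.
apply: le_trans (onedadd_expn_le tau0 n2) _.
rewrite mulrC -ler_pdivlMr //; apply: le_trans nt _.
by have := HT d Td; rewrite expr0 mul1r.
Qed.

Lemma deviation_small a c (Cn : nat) : 0 <= a -> 0 < c ->
  exists T : nat, forall t d n : nat, (T <= t)%N -> (d <= Cn * t)%N -> (2 ^ t <= n)%N ->
    a * d%:R ^+ 2 <= c * n%:R.
Proof.
move=> a0 c0.
have h01 : 0 < (2^-1 : R) < 1 by rewrite invr_gt0 ltr0n invf_lt1 // ltr1n.
have A0 : 0 < a * Cn%:R ^+ 2 + 1 by rewrite ltr_wpDl // mulr_ge0 // exprn_ge0.
have [T HT] := exp_decay 2 h01 (divr_gt0 c0 A0).
exists T => t d n Tt dC nt; have := HT t Tt; rewrite ler_pdivlMr // => H.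
apply: le_trans (_ : c * 2 ^+ t <= _); last by rewrite ler_wpM2l ?(ltW c0) // -natrX ler_nat.
apply: le_trans (ler_wpM2r _ H); last by rewrite exprn_ge0.
rewrite exprVn mulrAC -mulrA -mulrA [_ ^- t * _]mulrA mulVf ?gt_eqF ?exprn_gt0 // mul1r.
have t2 : d%:R ^+ 2 <= Cn%:R ^+ 2 * t.+1%:R ^+ 2 :> R.
  rewrite -exprMn lerXn2r ?nnegrE ?mulr_ge0 // -natrM ler_nat.
  by apply: leq_trans dC _; rewrite leq_mul2l leqnSn orbT.
have ts : 0 <= t.+1%:R ^+ 2 :> R by rewrite exprn_ge0.
have := ler_wpM2l a0 t2; rewrite mulrA => H1; apply: le_trans H1 _.
by rewrite mulrA mulrC ler_wpM2l // lerDl.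
Qed.

End Numerics.

(** * The limit *)

Section Assembly.
Variable R : realType.

Lemma effective_degree (lam xi q : R) (Cn B t d : nat) : 0 < lam ->
  (0 < B)%N -> (0 < d)%N -> (t <= d)%N -> 0 <= q <= B%:R^-1 -> lam * (Cn + 3)%:R <= xi * B%:R ->
  lam - xi <= lam / d%:R * (1 - q) * (d - Cn * (t %/ B) - 2 * (d %/ B))%:R.
Proof.
move=> l0 B0 d0 td /andP[q0 qB] hB; set N := (_ - _)%N.
have BR : 0 < B%:R :> R by rewrite ltr0n.
have dR : 0 < d%:R :> R by rewrite ltr0n.
have HN : (d * B <= N * B + (Cn + 2) * d)%N.
  have e1 : (d <= N + Cn * (t %/ B) + 2 * (d %/ B))%N by rewrite /N; clear; lia.
  have e2 : (t %/ B * B <= d)%N by apply: leq_trans (leq_trunc_div _ _) td.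
  have e3 : (d %/ B * B <= d)%N := leq_trunc_div _ _.
  apply: leq_trans (leq_mul e1 (leqnn B)) _.
  apply: leq_trans (_ : N * B + (Cn * (t %/ B * B) + 2 * (d %/ B * B)) <= _)%N.
    by apply: eq_leq; ring.
  rewrite leq_add2l mulnDl.
  by apply: leq_add; [apply: (leq_mul (leqnn _) e2)|apply: (leq_mul (leqnn _) e3)].
pose v : R := (Cn + 2)%:R / B%:R.
have Nv : 1 - v <= N%:R / d%:R.
  rewrite ler_pdivlMr // /v mulrBl mul1r lerBlDr -(ler_pM2r BR) mulrDl.
  rewrite [_ / _ * _ * _](_ : _ = (Cn + 2)%:R * d%:R); last by field; rewrite gt_eqF.
  by rewrite -!natrM -natrD ler_nat.
have B1 : B%:R^-1 <= 1 :> R by rewrite invf_le1 // ler1n.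
have q1 : 0 <= 1 - q by rewrite subr_ge0 (le_trans qB).
have v0 : 0 <= v by rewrite divr_ge0.
have qv : 1 - B%:R^-1 - v <= (1 - q) * (N%:R / d%:R).
  apply: le_trans (ler_wpM2l q1 Nv); have := mulr_ge0 q0 v0; lra.
have xiE : lam - xi <= lam * (1 - B%:R^-1 - v).
  have : lam * (Cn + 3)%:R / B%:R <= xi by rewrite ler_pdivrMr.
  rewrite (_ : lam * (Cn + 3)%:R / B%:R = lam * (B%:R^-1 + v)).
    by rewrite !mulrBr !mulrDr; lra.
  by rewrite /v !natrD; field; rewrite gt_eqF.
apply: le_trans xiE _; apply: le_trans (ler_wpM2l (ltW l0) qv) _.
by rewrite le_eqVlt; apply/orP; left; apply/eqP; field; rewrite gt_eqF.
Qed.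

(** With [x = lam / d * y], [1 - x >= expR (- (x / (1 - x)))]. The exponent exceeds [lam * y] by at
    most [2 * lam * y * x], since [x <= 1 / 2], and this is at most [xi] for large [d]. *)
Lemma onesub_expn_ge (lam xi y : R) (d : nat) : 0 < lam -> 0 < xi -> 0 <= y <= 1 ->
  (0 < d)%N -> 2 * lam <= d%:R -> 2 * lam ^+ 2 <= xi * d%:R ->
  (1 - y) * expR xi <= expR (- (lam * y)) ->
  1 - y <= (1 - lam / d%:R * y) ^+ d.
Proof.
move=> l0 xi0 /andP[y0 y1] d0 d2 dx hy.
have dR : 0 < d%:R :> R by rewrite ltr0n.
set x := lam / d%:R * y.
have x0 : 0 <= x by rewrite !mulr_ge0 ?invr_ge0 ?(ltW l0).
have ld : lam / d%:R <= 2^-1 by rewrite ler_pdivrMr //; lra.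
have x2 : x <= 2^-1 by rewrite /x; nra.
have x1 : 0 < 1 - x by lra.
have x01 : 0 <= x < 1 by rewrite x0; lra.
apply: le_trans (_ : expR (- (lam * y)) * expR (- xi) <= _).
  by rewrite [expR (- xi)]expRN ler_pdivlMr ?expR_gt0.
rewrite -expRD; apply: le_trans (_ : expR (- (x / (1 - x))) ^+ d <= _); last first.
  by rewrite lerXn2r ?nnegrE ?expR_ge0 ?(ltW x1) // onesub_expR_ge.
rewrite -expRM_natl ler_expR -opprD mulrN lerN2.
have dxE : d%:R * x = lam * y by rewrite /x; field; rewrite gt_eqF.
rewrite mulrA dxE.
rewrite ler_pdivrMr //.
have lxx : lam * x <= xi / 2.
  rewrite ler_pdivlMr // /x.
  have A : lam * (lam / d%:R * y) * 2 = (2 * lam ^+ 2) * y / d%:R by field; rewrite gt_eqF.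
  rewrite A ler_pdivrMr //; apply: le_trans dx.
  by rewrite ler_piMr // mulr_ge0 // sqr_ge0.
have : lam * y * x <= xi / 2.
  apply: le_trans lxx; rewrite mulrAC ler_piMr // mulr_ge0 // ltW //.
nra.
Qed.

(* [(1 - x a)^N <= e^(-N x a)], and the exponent is at least [(lam - xi) a]. *)
Lemma expn_slack (lam xi x a b : R) (N : nat) : 0 <= xi -> 0 <= x * a <= 1 -> 0 <= a <= 1 ->
  lam - xi <= x * N%:R -> expR (- (lam * a)) * expR xi <= b ->
  (1 - x * a) ^+ N <= b.
Proof.
move=> xi0 xa /andP[a0 a1] hN hb; apply: le_trans hb; apply: le_trans (onesub_expn_le _ xa) _.
rewrite -expRD ler_expR.
have := ler_wpM2r a0 hN; have : xi * a <= xi by rewrite ler_piMr.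
rewrite mulrBl; set u := lam * a; set u' := xi * a.
rewrite (_ : N%:R * (x * a) = x * N%:R * a); last by ring.
set u'' := _ * a; lra.
Qed.

(* [xi] is the slack left in the strict inequalities at [y1 < y < y2] and at [w],
   and [B] makes all the relative losses of degree smaller than [xi / lam]. *)
Lemma giant_core (Cn Kn B : nat) (eps y k1 rho xi delta kappa : R)
    (lam := 1 + eps) (g := rate (1 + eps / 2)) (y1 := (1 - k1) * y) (y2 := (1 + k1) * y)
    (w := y / 2) :
  (0 < Cn)%N -> (0 < Kn)%N -> (0 < B)%N -> 0 < eps -> Cn%:R * g ^+ Kn <= 2^-1 ->
  0 < y < 1 -> 0 < k1 -> 3 * k1 < 1 -> 3 * k1 <= delta -> y2 <= 1 ->
  0 < rho < 1 -> 0 < xi -> xi <= eps / 2 -> lam * (Cn + 3)%:R <= xi * B%:R ->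
  expR (- (lam * y1)) * expR xi <= 1 - y1 ->
  expR (- (lam * w)) * expR xi <= rho * (1 - w) ->
  (1 - y2) * expR xi <= expR (- (lam * y2)) ->
  0 < kappa ->
  exists T : nat, forall t : nat, (T <= t)%N ->
  forall (Gs : 'I_t -> graph) (dg : 'I_t -> nat),
  (forall i, simple_graph (Gs i)) -> (forall i, connected_graph (Gs i)) ->
  (forall i, regular_of_degree (Gs i) (dg i)) ->
  (forall i, (2 <= gsize (Gs i))%N) -> (forall i, (gsize (Gs i) <= Cn)%N) ->
  1 - kappa <= giant_prob eps Kn%:R delta y Gs dg.
Proof.
move=> Cn0 Kn0 B0 eps0 hK y01 k10 k13 k1d y2_1 rho01 xi0 xi_eps hB h1 h2 h3 kappa0.
have /andP[y0 yle1] := y01.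
have lam0 : 0 < lam by rewrite /lam addr_gt0.
have l1 : 1 < 1 + eps / 2 by rewrite ltrDl divr_gt0.
have g01 : 0 < g < 1.
  by rewrite /g rate_lt1 // andbT mulr_gt0 ?expR_gt0 // (lt_trans _ l1).
have ky : 0 < k1 * y by rewrite mulr_gt0.
(* Three terms of [kappa / 12], divided by [1 - 2 * s * q = 1 / 2], bound the probability of two big
   components by [kappa / 2]; the deviation gets the other half. *)
have kap12 : 0 < kappa / 12 by rewrite divr_gt0.
have [rho0 rho1] := andP rho01.
(* The failure probability of a slice: [1 - b1] is [y1] less the error [k1 * y] allowed for orders
   between [m] and [L]. *)
pose b1 := 1 - (1 - 2 * k1) * y.
have b101 : 0 < b1 < 1.
  by rewrite /b1; clear -y0 yle1 k10 k13; apply/andP; split; nra.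
have [T1 HT1] := log_small R Kn Cn0 B0.
have [T2 HT2] := pow_decay Cn Kn g01 ky B0.
have [T3 HT3] := range_small g01 kap12 Cn0 hK.
have [T4 HT4] := density_small b101 kap12 Cn0 B0.
have [T5 HT5] := merge_small kap12 Cn0 Kn0.
have a6 : 0 <= lam * (2 * Kn)%:R ^+ 2 by rewrite mulr_ge0 ?sqr_ge0 // ltW.
have c6 : 0 < kappa / 2 * (k1 * y) ^+ 2 by rewrite mulr_gt0 ?divr_gt0 // exprn_gt0.
have [T6 HT6] := deviation_small Cn a6 c6.
(* The extra factor [rho] in the target accounts for the exponent [m.-1] in [vertex_upper]. *)
have [T7 HT7] := exp_decay_div 0 rho01 (mulr_gt0 ky rho0) B0.
pose T8 := (Num.truncn (2 * lam)).+1; pose T9 := (Num.truncn (2 * lam ^+ 2 / xi)).+1.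
exists (T1 + T2 + T3 + T4 + T5 + T6 + T7 + T8 + T9 + B)%N => t Tt Gs dg Gsimple Gconn Greg G2 GC.
have [t1 t2 t3 t4 t5] : [/\ T1 <= t, T2 <= t, T3 <= t, T4 <= t & T5 <= t]%N.
  by move: Tt; clear; split; lia.
have [t6 t7 t8 t9 tB] : [/\ T6 <= t, T7 <= t, T8 <= t, T9 <= t & B <= t]%N.
  by move: Tt; clear; split; lia.
have td := deg_ge Gconn Greg G2; have dC := deg_le Greg G2 GC.
have nC := card_cvert_le GC; have n2 := card_cvert_ge G2.
set d := (\sum_(i < t) dg i)%N in td dC *; set n := #|cvert Gs| in nC n2 *.
have d0 : (0 < d)%N := leq_trans B0 (leq_trans tB td).
have t0 : (0 < t)%N := leq_trans B0 tB.
have n0 : (0 < n)%N by apply: leq_trans n2; rewrite expn_gt0.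
have dR : 0 < d%:R :> R by rewrite ltr0n.
have nR : 0 < n%:R :> R by rewrite ltr0n.
pose s := (Kn * d)%N; pose m := (d %/ B)%N; pose J := [set i : 'I_t | (i < t %/ B)%N].
have cJ : #|J| = (t %/ B)%N by apply: card_ord_lt; apply: leq_div.
have s0 : (0 < s)%N by rewrite muln_gt0 Kn0.
have sB : (B <= s)%N by apply: leq_trans tB _; apply: leq_trans td _; apply: leq_pmull.
have lamd : 2 * lam <= d%:R.
  apply/ltW/(lt_le_trans (truncnS_gt _)); rewrite ler_nat; exact: leq_trans t8 td.
have lamd2 : 2 * lam ^+ 2 <= xi * d%:R.
  have h9 : 2 * lam ^+ 2 / xi < d%:R.
    by apply: lt_le_trans (truncnS_gt _) _; rewrite ler_nat; exact: leq_trans t9 td.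
  by move: h9; rewrite ltr_pdivrMr // [d%:R * _]mulrC => /ltW.
pose p : R := lam / d%:R; pose q : R := (4 * s)%:R^-1.
have p0 : 0 < p by rewrite divr_gt0.
have p2 : p <= 2^-1 by rewrite ler_pdivrMr //; clear -lamd; lra.
have s4 : (1 <= 4 * s)%N by rewrite muln_gt0.
have s4R : 0 < (4 * s)%:R :> R by rewrite ltr0n.
have q0 : 0 < q by rewrite invr_gt0.
have q1 : q <= 1 by rewrite invf_le1 // ler1n.
have qB : 0 <= q <= B%:R^-1.
  rewrite ltW //= lef_pV2 ?posrE ?ltr0n // ler_nat.
  by apply: leq_trans sB _; apply: leq_pmull.
have p01 : 0 <= p < 1 by rewrite ltW //=; clear -p2; lra.
have p01' : 0 <= p <= 1 by rewrite ltW //=; clear -p2; lra.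
have q01 : 0 <= q <= 1 by rewrite ltW.
have /andP[p'0 p'lt1] := thinned01 p01 q01.
have pq1 : 0 < 1 - p * (1 - q) by rewrite subr_gt0.
pose r := p * q / (1 - p * (1 - q)).
have pq0 : 0 <= p * q by rewrite ltW // mulr_gt0.
have hr : (1 - p * (1 - q)) * r = p * q by rewrite mulrC divfK // gt_eqF.
have r1 : r <= 1 by rewrite ler_pdivrMr // mul1r lerBrDr -mulrDr addrC subrK mulr1 ltW //; have /andP[] := p01.
have rpq : p * q <= r.
  rewrite ler_pdivlMr // ler_piMr // gerBl mulr_ge0 // ?subr_ge0 // ltW //.
have r01 : 0 <= r <= 1 by rewrite r1 (le_trans pq0 rpq).
have rK : (4 * Kn * d ^ 2)%:R^-1 <= r.
  apply: le_trans rpq; rewrite /p /q /s.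
  have -> : lam / d%:R / (4 * (Kn * d))%:R = lam * (4 * Kn * d ^ 2)%:R^-1 :> R.
    rewrite !natrM; have KR : Kn%:R != 0 :> R by rewrite pnatr_eq0 -lt0n.
    field; rewrite KR gt_eqF //.
  by rewrite ler_peMl ?invr_ge0 // /lam lerDl ltW.
have dN := @effective_degree lam xi q Cn B t d lam0 B0 d0 td qB hB.
rewrite -cJ -/m -/p in dN.
set N := (d - Cn * #|J| - 2 * m)%N in dN.
have Cm : (Cn * (t %/ B) + 2 * m <= d)%N.
  have BC : (Cn + 2 <= B)%N.
    rewrite -(ler_nat R) -(ler_pM2l xi0); apply: le_trans hB.
    apply: ler_pM => //; [exact: ltW|rewrite /lam; clear -xi_eps eps0; lra|by rewrite ler_nat leq_add2l].
  apply: leq_trans (_ : (Cn + 2) * (d %/ B) <= _)%N.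
    rewrite mulnDl leq_add // leq_mul2l; apply/orP; right; exact: leq_div2r.
  by apply: leq_trans (leq_mul BC (leqnn _)) _; rewrite mulnC leq_trunc_div.
have m2 : (2 * m <= d - Cn * #|J|)%N by rewrite cJ; move: Cm; clear; lia.
have m0 : (0 < m)%N by rewrite divn_gt0 //; exact: leq_trans tB td.
pose L0 := merge_rounds Cn Kn d.
have LE : (L0 * (2 * (t * Cn) * d.+1 ^ 6))%N = gap_top Cn Kn t d by [].
have Lle := gap_top_le Cn Kn d0 td.
set L := gap_top Cn Kn t d in LE Lle.
have sL : (s <= L0 * (2 * (t * Cn) * d.+1 ^ 6))%N.
  apply: leq_trans (merge_rounds_ge Cn0 Kn0 d0) _; apply: leq_pmulr.
  by rewrite muln_gt0 muln_gt0 muln_gt0 t0 Cn0 expn_gt0.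
have hL : (Cn * trunc_log 2 (L0 * (2 * (t * Cn) * d.+1 ^ 6)) <= m)%N.
  by rewrite LE; apply: HT1 Lle; exact: leq_trans t1 td.
have hl : 1 + eps / 2 <= p * (1 - q) * N%:R by apply: le_trans dN; rewrite /lam; clear -xi_eps; lra.
have y1_01 : 0 <= y1 <= 1 by rewrite /y1; clear -y0 yle1 k10 k13; apply/andP; split; nra.
have [y1_0 y1_1] := andP y1_01.
have p'1' := ltW p'lt1.
have hy1 : (1 - p * (1 - q) * y1) ^+ N <= 1 - y1.
  by apply: (expn_slack (ltW xi0) _ _ dN h1) => //; rewrite mulr_ge0 //= mulr_ile1.
have tC0 : (0 < t * Cn)%N by rewrite muln_gt0 t0.
have big := two_big_bound Gsimple Gconn Greg G2 GC p01 q01 r01 hr m2 m0 hL l1 hl y1_01 hy1 s0 sL tC0.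
have low v := vertex_lower Gsimple Greg G2 GC p01 q01 m2 m0 hL l1 hl y1_01 hy1 sL v.
rewrite LE -/g cJ -/n in big; rewrite LE -/g in low.
have Lg : L%:R * g ^+ m <= k1 * y by apply: HT2 Lle; exact: leq_trans t2 td.
have Lg0 : 0 <= L%:R * g ^+ m by rewrite mulr_ge0 // exprn_ge0 // ltW //; have /andP[] := g01.
set P2 := Ex _ _ _ in big.
have P2le : P2 <= kappa / 2.
  have e3 : n%:R * (L%:R * g ^+ s) <= kappa / 12.
    by apply: HT3 nC Lle => //; exact: leq_trans t3 td.
  have e4 : n%:R * (1 - (y1 - L%:R * g ^+ m)) ^+ 'C(t %/ B, 2) <= kappa / 12.
    apply: HT4 nC _ => //; rewrite /b1; apply/andP; split.
      by clear -y1_1 Lg0; lra.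
    by rewrite /y1; clear -Lg; lra.
  have e5 : (1 + (1 - r ^+ 5) ^+ L0) ^+ n - 1 <= kappa / 12.
    by apply: HT5 nC r1 rK => //; exact: leq_trans t5 td.
  have qs : 1 - (2 * s)%:R * q = 2^-1.
    have sR : s%:R != 0 :> R by rewrite pnatr_eq0 -lt0n.
    have aux (z : R) : z != 0 -> 1 - 2 * z * (4 * z)^-1 = 2^-1 by move=> z0; field.
    by rewrite /q natrM [(4 * s)%:R]natrM aux.
  rewrite qs in big.
  have H := le_trans big (lerD e3 (lerD e4 e5)); clear -H; lra.
pose mean := Ex p (edges (@cadj t Gs)) (fun S => #|bigset s S|%:R : R).
(* One [k1 * y] comes from replacing [y] by [y1] or [y2], the other from the error terms of the
   vertex bounds. *)
have meanE : `|mean - y * n%:R| <= 2 * k1 * (y * n%:R).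
  have up v : Ex p (edges (@cadj t Gs)) (fun S => (s <= #|comp S v|)%N%:R) <= y2 + rho ^+ m.-1.
    have w01 : 0 <= w <= 1 by rewrite /w; clear -y0 yle1; apply/andP; split; lra.
    have /andP[w0 w1] := w01; have pw : p * w <= 1 by rewrite mulr_ile1 //; have /andP[] := p01'.
    have pw0 : 0 <= p * w by rewrite mulr_ge0 // ltW.
    apply: (@vertex_upper R t Gs dg Gsimple Greg p y2 w rho m s v p01') => //.
    - by rewrite /w /y2; clear -y0 k10; nra.
    - by apply: leq_trans m2 _; apply: leq_subr.
    - by apply: leq_trans (leq_div _ _) _; apply: leq_pmull.
    - apply: onesub_expn_ge lamd2 h3 => //.
      by rewrite y2_1 andbT mulr_ge0 ?addr_ge0 ?(ltW k10) ?(ltW y0).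
    - apply: (@expn_slack lam xi p w) => //; rewrite ?pw0 ?(ltW xi0) //.
      apply: le_trans dN _; apply: ler_pM => //.
        by rewrite ler_piMr ?gerBl // ltW.
      rewrite ler_nat /N -/d; apply: leq_sub2r; apply: leq_subr.
  have rm : rho ^+ m.-1 <= k1 * y.
    have := HT7 d (leq_trans t7 td); rewrite expr0 mul1r -/m -(prednK m0) exprS mulrC.
    by rewrite ler_pM2r.
  have /andP[lo hi] : n%:R * (y - 2 * k1 * y) <= mean <= n%:R * (y + 2 * k1 * y).
    apply: mean_bigset => v; apply/andP; split.
      apply: le_trans (low v); rewrite /y1; clear -Lg; lra.
    by apply: le_trans (up v) _; rewrite /y2; clear -rm; lra.
  rewrite ler_norml; apply/andP; split; [clear -lo|clear -hi]; lra.
have sK : s%:R <= Kn%:R * d%:R :> R by rewrite /s natrM.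
apply: le_trans (giant_prob_lower p01' y0 k10 k1d k13 sK s0 n0 meanE).
rewrite lerD2l lerN2 (_ : kappa = kappa / 2 + kappa / 2); last by field.
apply: lerD; first exact: P2le.
have a0 : 0 <= k1 * (y * n%:R) by rewrite !mulr_ge0 // ltW.
have := deviation_bound (R := R) Gsimple Greg s p01' a0; rewrite -/d -/n.
set Pd := Ex _ _ _ => Hd.
have a2 : 0 < (k1 * (y * n%:R)) ^+ 2 by rewrite exprn_gt0 // !mulr_gt0.
rewrite -(ler_pM2l a2); apply: le_trans Hd _.
have := HT6 t d n t6 dC n2.
have -> : d%:R * p = lam by rewrite mulrC divfK // gt_eqF.
rewrite /s mulnA natrM exprMn => H6; have H := ler_wpM2l (ltW nR) H6; clear -H; lra.
Qed.

End Assembly.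

Lemma giant_prob_le1 (R : realType) (eps K delta y : R) (t : nat) (Gs : 'I_t -> graph)
    (dg : 'I_t -> nat) : 0 <= (1 + eps) / (\sum_(i < t) dg i)%:R <= 1 ->
  giant_prob eps K delta y Gs dg <= 1.
Proof. by move=> p01; rewrite /giant_prob prob_GpE Ex_le1. Qed.

(** The source of the constant [K]: it depends on [Cn] and [eps] alone and is fixed before [y] and
    [delta]. *)
Lemma growth_constant (R : realType) (Cn : nat) (eps : R) : (0 < Cn)%N -> 0 < eps ->
  exists Kn : nat, (0 < Kn)%N /\ Cn%:R * rate (1 + eps / 2) ^+ Kn <= 2^-1.
Proof.
move=> C0 e0; have CR : 0 < Cn%:R :> R by rewrite ltr0n.
have l1 : 1 < 1 + eps / 2 by rewrite ltrDl divr_gt0.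
have g01 : 0 <= rate (1 + eps / 2) < 1 by rewrite rate_ge0 // rate_lt1.
have hc : 0 < 2^-1 / Cn%:R :> R by rewrite divr_gt0 // invr_gt0.
have [Kn [K0 HK]] := exp_pow_lt g01 hc.
by exists Kn; split=> //; rewrite mulrC -ler_pdivlMr.
Qed.

Lemma giant_whp (R : realType) (Cn Kn : nat) (eps y delta kappa : R) :
  (0 < Cn)%N -> (0 < Kn)%N -> 0 < eps -> Cn%:R * rate (1 + eps / 2) ^+ Kn <= 2^-1 ->
  0 < y < 1 -> y = 1 - expR (- ((1 + eps) * y)) -> 0 < delta -> 0 < kappa ->
  exists T : nat, forall t : nat, (T <= t)%N ->
  forall (Gs : 'I_t -> graph) (dg : 'I_t -> nat),
  (forall i, simple_graph (Gs i)) -> (forall i, connected_graph (Gs i)) ->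
  (forall i, regular_of_degree (Gs i) (dg i)) ->
  (forall i, (2 <= gsize (Gs i))%N) -> (forall i, (gsize (Gs i) <= Cn)%N) ->
  1 - kappa <= giant_prob eps Kn%:R delta y Gs dg.
Proof.
move=> C0 K0 e0 hK y01 hy d0 k0; have /andP[y0 y1] := y01.
have l0 : 0 < 1 + eps by rewrite addr_gt0.
set lam := 1 + eps in hy l0.
(* The three terms keep [3 * k1] within [delta], keep [3 * k1] below 1, and keep [(1 + k1) * y]
   below 1. *)
pose k1 : R := Num.min (delta / 3) (Num.min (4^-1) ((1 - y) / 2)).
have k10 : 0 < k1 by rewrite /k1 !lt_min divr_gt0 //= invr_gt0 ltr0n /= divr_gt0 // subr_gt0.
have [kd [k4 ky]] : k1 <= delta / 3 /\ k1 <= 4^-1 /\ k1 <= (1 - y) / 2.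
  by rewrite /k1 !ge_min !lexx ?orbT.
have k13 : 3 * k1 < 1 by clear -k4; lra.
have k1d : 3 * k1 <= delta by clear -kd; lra.
have y21 : (1 + k1) * y < 1 by clear -ky k10 y0 y1; nra.
have hk : 0 < 1 - k1 < 1 by apply/andP; split; clear -k10 k4; lra.
have f1 := expR_below_fixpoint l0 y01 hy hk.
have f3 := @expR_above_fixpoint R lam y l0 y01 hy (1 + k1) (ltr_pwDr k10 (lexx 1)).
have h2 : 0 < (2^-1 : R) < 1 by rewrite invr_gt0 ltr0n invf_lt1 // ltr1n.
have f2 := expR_below_fixpoint l0 y01 hy h2; rewrite [2^-1 * y]mulrC in f2.
have w1 : 0 < 1 - y / 2 by clear -y1; lra.
(* The ratio in the fixpoint inequality at [y / 2], below 1 by [f2]; [rho] is taken halfway between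
   it and 1 so that the inequality stays strict. *)
pose rho0 := expR (- (lam * (y / 2))) / (1 - y / 2).
have r00 : 0 < rho0 by rewrite divr_gt0 ?expR_gt0.
have r01 : rho0 < 1 by rewrite ltr_pdivrMr // mul1r.
pose rho := (rho0 + 1) / 2.
have rho01 : 0 < rho < 1 by rewrite /rho; clear -r00 r01; apply/andP; split; lra.
have f2' : expR (- (lam * (y / 2))) < rho * (1 - y / 2).
  by rewrite -ltr_pdivrMr // /rho -/rho0; clear -r01; lra.
have [x1 x10 g1] := expR_slack (expR_gt0 _) f1.
have [x2 x20 g2] := expR_slack (expR_gt0 _) f2'.
have [x3 x30 g3] : exists2 x : R, 0 < x &
    (1 - (1 + k1) * y) * expR x <= expR (- (lam * ((1 + k1) * y))).
  by apply: expR_slack; rewrite ?subr_gt0.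
pose xi := Num.min x1 (Num.min x2 (Num.min x3 (eps / 2))).
have xi0 : 0 < xi by rewrite !lt_min x10 x20 x30 divr_gt0.
have [xi1 [xi2 [xi3 xie]]] : xi <= x1 /\ xi <= x2 /\ xi <= x3 /\ xi <= eps / 2.
  by rewrite /xi !ge_min !lexx ?orbT.
pose B := (Num.truncn (lam * (Cn + 3)%:R / xi)).+1.
have hB : lam * (Cn + 3)%:R <= xi * B%:R.
  by rewrite mulrC [leRHS]mulrC -ler_pdivrMr // [(_ * lam)%R]mulrC ltW // truncnS_gt.
apply: (@giant_core R Cn Kn B eps y k1 rho xi delta kappa) => //.
- exact: ltW.
- by apply: le_trans g1; rewrite ler_wpM2l ?expR_ge0 // ler_expR.
- by apply: le_trans g2; rewrite ler_wpM2l ?expR_ge0 // ler_expR.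
- by apply: le_trans g3; rewrite ler_wpM2l ?ler_expR // subr_ge0 ltW.
Qed.

From mathcomp Require Import all_classical all_reals all_analysis.
Import numFieldNormedType.Exports.
Local Open Scope classical_set_scope.
Local Open Scope ring_scope.

Theorem mainTheorem2 (R : realType) (C : R) :
  1 < C ->
  exists eps0 : R, 0 < eps0 /\
  forall eps : R, 0 < eps < eps0 ->
  exists K : R, 0 < K /\
  forall y : R, 0 < y < 1 -> y = 1 - expR (- ((1 + eps) * y)) ->
  forall (G : forall t : nat, 'I_t -> graph)
         (dg : forall t : nat, 'I_t -> nat),
  (forall (t : nat) (i : 'I_t),
      simple_graph (G t i) /\ connected_graph (G t i) /\
      regular_of_degree (G t i) (dg t i) /\
      (2 <= gsize (G t i))%N /\ (gsize (G t i))%:R <= C) ->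
  forall delta : R, 0 < delta ->
  ((fun t : nat => giant_prob eps K delta y (G t) (dg t)) : nat -> R) @ \oo --> (1 : R).
Proof.
(* [eps < 1] gives [1 + eps <= 2], hence [p <= 1] as soon as the degree is at least 2. *)
move=> C1; exists 1; split=> // eps /andP[e0 e1].
pose Cn := Num.truncn C.
have C0 : 0 <= C by rewrite ltW // (lt_trans _ C1).
have Cn0 : (0 < Cn)%N by rewrite truncn_gt0 ltW.
have [Kn [K0 hK]] := growth_constant Cn0 e0.
exists Kn%:R; split; first by rewrite ltr0n.
move=> y y01 hy G dg HG delta d0.
have Gsimple t i : simple_graph (G t i) by have [] := HG t i.
have Gconn t i : connected_graph (G t i) by have [_ []] := HG t i.
have Greg t i : regular_of_degree (G t i) (dg t i) by have [_ [_ []]] := HG t i.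
have G2 t i : (2 <= gsize (G t i))%N by have [_ [_ [_ []]]] := HG t i.
have GC t i : (gsize (G t i) <= Cn)%N.
  by have [_ [_ [_ [_ H]]]] := HG t i; rewrite truncn_ge_nat.
apply/cvgrPdist_le => kappa k0.
have [T HT] := giant_whp Cn0 K0 e0 hK y01 hy d0 k0.
(* The additional 2 forces [d >= t >= 2], so that [p <= 1] and the probability is at most 1. *)
exists (T + 2)%N => // t /= Tt.
have td := deg_ge (@Gconn t) (@Greg t) (@G2 t).
have lo : 1 - kappa <= giant_prob eps Kn%:R delta y (G t) (dg t).
  by apply: HT => //; apply: leq_trans Tt; apply: leq_addr.
have up : giant_prob eps Kn%:R delta y (G t) (dg t) <= 1.
  have d2 : (2 <= \sum_(i < t) dg t i)%N.
    by apply: leq_trans td; apply: leq_trans Tt; apply: leq_addl.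
  apply: giant_prob_le1; rewrite divr_ge0 ?addr_ge0 ?(ltW e0) //=.
  rewrite ler_pdivrMr ?ltr0n ?(ltn_trans _ d2) // mul1r.
  apply: (@le_trans _ _ 2%:R); last by rewrite ler_nat.
  by rewrite (natrD _ 1 1) lerD2l ltW.
by rewrite ger0_norm ?subr_ge0 // lerBlDr addrC -lerBlDr.
Qed.
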